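(* Let $\Sigma$ be a closed connected oriented smooth surface of genus $g\ge2$ with a fixed area form $\rho$. The circle action $\Psi_\theta$ on $\mathrm{Hit}_3(\Sigma)$ is Hamiltonian with respect to $\boldsymbol\omega$ and satisfies $$\Psi_\theta^*\mathbf g=\mathbf g\qquad\text{for all }\theta\in\mathbb R .$$ The Hamiltonian function is $$H(J,q)=\frac23\int_\Sigma f\Big(\frac{\|q\|^2_{g_J}}{2}\Big)\rho ,$$ where $f:[0,+\infty)\to(-\infty,0]$ is the function $f(t)=-\Big(\int_0^tF'(s)s^{-1/3}ds\Big)t^{1/3}$ and $g_J(\cdot,\cdot)=\rho(\cdot,J\cdot)$. (Here $\boldsymbol\omega$, $\mathbf g$, $F$, $\Psi_\theta$ are as defined in the context.)
   Context: **Functions.** $c:=2\pi\chi(\Sigma)/\mathrm{Vol}(\Sigma,\rho)<0$. $F:[0,\infty)\to\mathbb R$ is the unique smooth function with $ce^{-F(t)}-2te^{-3F(t)}+1=0$ and $F(0)=\log|c|$. **The space $D^3(\mathcal J(\Sigma))$.** It is the set of pairs $(J,A)$, where $J$ is an almost complex structure on $\Sigma$ compatible with the orientation, so that $g_J:=\rho(\cdot,J\cdot)$ is a Riemannian metric with Levi-Civita connection $\nabla$, and $A$ is a $1$-form with values in trace-free $g_J$-symmetric endomorphisms of $T\Sigma$ with $A(JX)=A(X)J$ and $A(X)Y=A(Y)X$. Put $C(X,Y,Z)=g_J(A(X)Y,Z)$ (written $A=g_J^{-1}C$); $C$ is the real part of the smooth complex cubic differential $q=C(\cdot,\cdot,\cdot)-iC(J\cdot,\cdot,\cdot)$.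 If $q=Q\,dz^3$ and $g=e^{\phi}|dz|^2$ then $\|q\|_g^2=|Q|^2e^{-3\phi}$. For $\mathrm{End}(T\Sigma)$-valued $1$-forms, $\langle A,B\rangle=\mathrm{tr}(A(e_1)B(e_1)+A(e_2)B(e_2))$ for a $g_J$-orthonormal frame; $\|A\|_0^2:=\frac18\|A\|^2=\frac12\|q\|_{g_J}^2$. For endomorphisms, $\langle\dot J,\dot J'\rangle=\frac12\mathrm{tr}(\dot J\dot J')$. **Tangent vectors.** A tangent vector at $(J,A)$ is a pair $(\dot J,\dot A)$ with $\dot JJ+J\dot J=0$ and $\dot A=g_J^{-1}\dot C$, where $\dot C$ is the variation of $C$: a totally symmetric $3$-tensor with $\mathrm{tr}\,\dot A(X)=\mathrm{tr}(JA(X)\dot J)$. Write $\dot A=\dot A_0+\dot A_{\mathrm{tr}}$ with $\dot A_{\mathrm{tr}}=\frac12\mathrm{tr}(JA\dot J)\,\mathrm{Id}$ and $\dot A_0$ trace-free. **Tensors.** With $f,f'$ evaluated at $\|A\|_0^2$, $$\mathbf g_f\big((\dot J,\dot A),(\dot J',\dot A')\big)=\int_\Sigma\Big((1-f)\langle\dot J,\dot J'\rangle+\tfrac{f'}6\langle\dot A_0,\dot A_0'\rangle-\tfrac{f'}{12}\langle\dot A_{\mathrm{tr}},\dot A'_{\mathrm{tr}}\rangle\Big)\rho,$$ $\mathbf I(\dot J,\dot A)=(-J\dot J,-\dot AJ-A\dot J)$ and $\boldsymbol\omega_f(\cdot,\cdot)=\mathbf g_f(\cdot,\mathbf I\cdot)$.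 **The model of $\mathrm{Hit}_3(\Sigma)$.** $\widetilde{\mathcal{HS}}_0(\Sigma,\rho)$ is the set of $(J,A)\in D^3(\mathcal J(\Sigma))$ such that, with $h:=e^{F(\|q\|^2_{g_J}/2)}g_J$, one has $K_h-\|q\|_h^2=-1$ and $d^\nabla A=0$ (equivalently $q$ is $J$-holomorphic), where $d^\nabla A(X,Y)=(\nabla_XA)(Y)-(\nabla_YA)(X)$. The $\mathrm{SL}(3,\mathbb R)$-Hitchin component $\mathrm{Hit}_3(\Sigma)$ is identified with $\widetilde{\mathcal{HS}}_0(\Sigma,\rho)/\mathrm{Symp}_0(\Sigma,\rho)$; under Labourie–Loftin's identification of $\mathrm{Hit}_3(\Sigma)$ with the bundle $Q^3(\mathcal T(\Sigma))$ of holomorphic cubic differentials over Teichmüller space, the class of $(J,A)$ corresponds to $([J],q)$. The tangent space at $[J,A]$ is identified with the space $V_{(J,A)}$ of those $(\dot J,\dot A)$ tangent to $\widetilde{\mathcal{HS}}_0(\Sigma,\rho)$ such that $d^\nabla\dot A_0-J(\mathrm{div}\,\dot J\wedge A)=0$ and the $1$-forms $\alpha_1=\mathrm{div}((f-1)\dot J)+d\dot f\circ J-\frac{f'}6\beta$ and $\alpha_2=\mathrm{div}((f-1)\dot J)\circ J+d\dot f_0\circ J-\frac{f'}6\beta\circ J$ are exact; here $\beta(X)=\langle(\nabla_XA)J,\dot A_0\rangle$, $\dot f=\frac{f'}4\langle A,\dot A_0\rangle$, $\dot f_0=-\frac{f'}4\langle A,\dot A_0J\rangle$ and $(\mathrm{div}B)(X)=\sum_ig_J((\nabla_{e_i}B)X,e_i)$.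 The tensors $\boldsymbol\omega,\mathbf g,\mathbf I$ on $\mathrm{Hit}_3(\Sigma)$ are the restrictions of $\boldsymbol\omega_f,\mathbf g_f,\mathbf I$ to $V_{(J,A)}$. **Circle action.** $\Psi_\theta([J],q)=([J],e^{-i\theta}q)$, i.e. $\Psi_\theta(J,A)=(J,\cos\theta\,A-\sin\theta\,AJ)$. **Meaning of Hamiltonian.** $\boldsymbol\omega$ is known to be non-degenerate only near the Fuchsian locus $\{A=0\}$; ''Hamiltonian with Hamiltonian function $H$'' means that $dH=\boldsymbol\omega(X,\cdot)$ on all of $\mathrm{Hit}_3(\Sigma)$, where $X$ is the vector field generating $\Psi_\theta$. *)

(* Defs.v *)
(* MathComp-Analysis, over an arbitrary model R : realType of the reals. *)
From HB Require Import structures.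
From mathcomp Require Import all_boot all_order all_algebra.
From mathcomp Require Import all_classical all_reals all_analysis.
Set Implicit Arguments.
Unset Strict Implicit.
Unset Printing Implicit Defensive.
Import Order.TTheory GRing.Theory Num.Theory numFieldNormedType.Exports.
Local Open Scope classical_set_scope.
Local Open Scope ring_scope.

Section Smooth.
Variables (R : realType) (V W : normedModType R).

Definition iter_derive (vs : seq V) (f : V -> W) : V -> W :=
  foldr (fun v h x => 'D_v h x) f vs.

(* Meant for open U: all iterated directional derivatives exist and are
   continuous on U. *)
Definition smooth_on (U : set V) (f : V -> W) : Prop :=
  forall (vs : seq V) (x : V), U x ->
    (forall v, derivable (iter_derive vs f) x v) /\
    {for x, continuous (iter_derive vs f)}.

End Smooth.

(* The surface is a (pointed, hence nonempty) topological space with an oriented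
   C^oo atlas valued in R * R.  [chart_at] records one chart around each point. *)
Record oriented_atlas (R : realType) (M : ptopologicalType) := OrientedAtlas {
  chart : Type;
  dom : chart -> set M;
  coord : chart -> M -> R * R;
  param : chart -> R * R -> M;
  chart_at : M -> chart;
  dom_open : forall i, open (dom i);
  dom_chart_at : forall m, dom (chart_at m) m;
  coordK : forall i m, dom i m -> param i (coord i m) = m;
  image_open : forall i, open (coord i @` dom i);
  coord_continuous : forall i m, dom i m -> {for m, continuous (coord i)};
  param_continuous : forall i x, (coord i @` dom i) x ->
    {for x, continuous (param i)};
  transition_smooth : forall i j,
    smooth_on (coord i @` (dom i `&` dom j)) (coord j \o param i);
  transition_oriented : forall i j x, (coord i @` (dom i `&` dom j)) x ->
    let du := 'D_((1, 0) : R * R) (coord j \o param i) x in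
    let dv := 'D_((0, 1) : R * R) (coord j \o param i) x in
    0 < du.1 * dv.2 - du.2 * dv.1
}.

Definition closed_connected (M : ptopologicalType) : Prop :=
  [/\ hausdorff_space M, compact [set: M] & connected [set: M]].

(* Tensor calculus in one chart.  A tensor on an open subset of R * R is a
   function of the point and of tangent vectors in R * R; vector arguments of
   differentiated expressions are held constant, so they are coordinate
   (commuting) vector fields. *)
Section Local.
Variable R : realType.
Local Notation E := (R * R)%type.

Definition trE (B : E -> E) : R := (B (1, 0)).1 + (B (0, 1)).2.

Variables (J : E -> E -> E) (g : E -> E -> E -> R).

(* When J is orthogonal for g, (frame1 x, J x (frame1 x)) is a g-orthonormal
   frame, smooth in x. *)
Definition frame1 (x : E) : E := (Num.sqrt (g x (1, 0) (1, 0)))^-1 *: (1, 0).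

Definition osum (W : zmodType) (x : E) (T : E -> W) : W :=
  T (frame1 x) + T (J x (frame1 x)).

Definition koszul (x u v w : E) : R :=
  2^-1 * ('D_u (fun y => g y v w) x + 'D_v (fun y => g y u w) x
          - 'D_w (fun y => g y u v) x).

(* Levi-Civita connection: nabla_u v for constant u and v, from the Koszul
   formula. *)
Definition LC (x u v : E) : E := osum x (fun e => koszul x u v e *: e).

(* (nabla_u B) v *)
Definition nabla_end (B : E -> E -> E) (x u v : E) : E :=
  'D_u (fun y => B y v) x + LC x u (B x v) - B x (LC x u v).

(* (nabla_u A)(X) v *)
Definition nabla_form (A : E -> E -> E -> E) (x u X v : E) : E :=
  'D_u (fun y => A y X v) x + LC x u (A x X v)
  - A x (LC x u X) v - A x X (LC x u v).

(* (d^nabla A)(X, Y) v *)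
Definition dnabla (A : E -> E -> E -> E) (x X Y v : E) : E :=
  nabla_form A x X Y v - nabla_form A x Y X v.

Definition divE (B : E -> E -> E) (x X : E) : R :=
  osum x (fun e => g x (nabla_end B x e X) e).

(* nabla_u nabla_v w - nabla_v nabla_u w *)
Definition riem (x u v w : E) : E :=
  'D_u (fun y => LC y v w) x + LC x u (LC x v w)
  - ('D_v (fun y => LC y u w) x + LC x v (LC x u w)).

Definition gaussK (x : E) : R :=
  let e1 := frame1 x in let e2 := J x e1 in g x (riem x e1 e2 e2) e1.

(* <A, B> at x, for End-valued covectors A and B *)
Definition ipA (x : E) (A B : E -> E -> E) : R :=
  osum x (fun e => trE (A e \o B e)).

(* ||q||^2 for q = C - i C(J., ., .).  With q = Q dz^3 and g = e^phi |dz|^2 one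
   has Q = q(d_x, d_x, d_x), so |Q|^2 e^(- 3 phi) = |q(e, e, e)|^2 for the unit
   vector e = e^(- phi / 2) d_x; as |q(e, e, e)| is the same for all unit e, it
   is evaluated on e = frame1. *)
Definition norm2q (C : E -> E -> E -> E -> R) (x : E) : R :=
  let e := frame1 x in (C x e e e) ^+ 2 + (C x (J x e) e e) ^+ 2.

End Local.

Section Surface.
Variables (R : realType) (M : ptopologicalType) (S : oriented_atlas R M).
Local Notation E := (R * R)%type.

Definition img (i : chart S) : set E := coord i @` dom i.
Definition overlap (i j : chart S) : set E := coord i @` (dom i `&` dom j).
Definition trans (i j : chart S) : E -> E := coord j \o param i.

(* Components of tensor fields in all charts; only the values on [img i] are
   meaningful. *)
Definition vec_field : Type := chart S -> E -> E.
Definition form1 : Type := chart S -> E -> E -> R.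
Definition form2 : Type := chart S -> E -> E -> E -> R.
Definition end_field : Type := chart S -> E -> E -> E.
Definition endform_field : Type := chart S -> E -> E -> E -> E.

(* Function on the surface with local expressions s. *)
Definition on_surface (s : chart S -> E -> R) (m : M) : R :=
  s (chart_at S m) (coord (chart_at S m) m).

Definition smooth_fun (u : M -> R) : Prop :=
  forall i, smooth_on (img i) (u \o param i).

Definition is_vec_field (Y : vec_field) : Prop :=
  (forall i, smooth_on (img i) (Y i)) /\
  (forall i j x, overlap i j x ->
     Y j (trans i j x) = 'D_(Y i x) (trans i j) x).

Definition is_form1 (a : form1) : Prop :=
  [/\ forall i x, img i x -> forall (c : R) (u v : E),
        a i x (c *: u + v) = c * a i x u + a i x v,
      forall i u, smooth_on (img i) (fun x => a i x u)
    & forall i j x, overlap i j x -> forall u,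
        a j (trans i j x) ('D_u (trans i j) x) = a i x u].

Definition is_area_form (rho : form2) : Prop :=
  [/\ forall i x, img i x -> forall (c : R) (u v w : E),
        rho i x (c *: u + v) w = c * rho i x u w + rho i x v w,
      forall i x, img i x -> forall u v, rho i x u v = - rho i x v u,
      forall i u v, smooth_on (img i) (fun x => rho i x u v),
      forall i j x, overlap i j x -> forall u v,
        rho j (trans i j x) ('D_u (trans i j) x) ('D_v (trans i j) x)
        = rho i x u v
    & forall i x, img i x -> 0 < rho i x (1, 0) (0, 1)].

Definition is_end_field (B : end_field) : Prop :=
  [/\ forall i x, img i x -> forall (c : R) (u v : E),
        B i x (c *: u + v) = c *: B i x u + B i x v,
      forall i u, smooth_on (img i) (fun x => B i x u)
    & forall i j x, overlap i j x -> forall u,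
        B j (trans i j x) ('D_u (trans i j) x)
        = 'D_(B i x u) (trans i j) x].

Definition is_endform_field (A : endform_field) : Prop :=
  [/\ forall i x, img i x -> forall (c : R) (u v w : E),
        A i x (c *: u + v) w = c *: A i x u w + A i x v w /\
        A i x w (c *: u + v) = c *: A i x w u + A i x w v,
      forall i u v, smooth_on (img i) (fun x => A i x u v)
    & forall i j x, overlap i j x -> forall u v,
        A j (trans i j x) ('D_u (trans i j) x) ('D_v (trans i j) x)
        = 'D_(A i x u v) (trans i j) x].

Definition closed1 (a : form1) : Prop :=
  forall i x, img i x -> forall u v,
    'D_u (fun y => a i y v) x - 'D_v (fun y => a i y u) x = 0.

Definition exact1 (a : form1) : Prop :=
  exists2 u : M -> R, smooth_fun u &
    forall i x, img i x -> forall v, 'D_v (u \o param i) x = a i x v.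

(* Genus n, as half the first Betti number: 2n closed 1-forms induce a basis of
   closed forms modulo exact forms. *)
Definition has_genus (n : nat) : Prop :=
  exists b : 'I_(2 * n) -> form1,
    (forall k, is_form1 (b k) /\ closed1 (b k)) /\
    (forall a, is_form1 a -> closed1 a ->
       exists! r : 'rV[R]_(2 * n),
         exact1 (fun i x v => a i x v - \sum_k r 0 k * b k i x v)).

Local Notation borelM := (g_sigma_algebraType (@open M)).

Definition is_area_measure (rho : form2)
    (mu : {measure set borelM -> \bar R}) : Prop :=
  forall i (B : set borelM), measurable B -> B `<=` dom i ->
    mu B = (\int[(lebesgue_measure \x lebesgue_measure)]_(x in coord i @` B)
              (rho i x (1%R, 0%R) (0%R, 1%R))%:E)%E.

Definition volume (mu : {measure set borelM -> \bar R}) : R :=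
  fine (mu [set: M]).

(* A pair (J, A), or a tangent vector (J', A') with A' = g_J^-1 C', where C' is
   the variation of C = g_J(A(.)., .). *)
Definition pairJA : Type := (end_field * endform_field)%type.

Variables (rho : form2) (mu : {measure set borelM -> \bar R}).

Definition gJ (p : pairJA) (i : chart S) (x u v : E) : R :=
  rho i x u (p.1 i x v).

Definition cubic (p : pairJA) (i : chart S) (x X Y Z : E) : R :=
  gJ p i x (p.2 i x X Y) Z.

Definition in_D3 (p : pairJA) : Prop :=
  [/\ is_end_field p.1, is_endform_field p.2
    & forall i x, img i x -> let J := p.1 i x in let A := p.2 i x in
      [/\ forall u, J (J u) = - u,
          forall u, u != 0 -> 0 < gJ p i x u u,
          forall X, trE (A X) = 0,
          forall X u v, gJ p i x (A X u) v = gJ p i x u (A X v)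
        & forall X Y, A (J X) Y = A X (J Y) /\ A X Y = A Y X]].

Definition norm2qJ (p : pairJA) (i : chart S) (x : E) : R :=
  norm2q (p.1 i) (gJ p i) (cubic p i) x.

(* ||A||_0^2 *)
Definition normA0 (p : pairJA) (i : chart S) (x : E) : R :=
  8^-1 * ipA (p.1 i) (gJ p i) x (p.2 i x) (p.2 i x).

(* HS_0(Sigma, rho) *)
Definition in_HS (F : R -> R) (p : pairJA) : Prop :=
  in_D3 p /\
  forall i x, img i x ->
    let h y u v := expR (F (norm2qJ p i y / 2)) * gJ p i y u v in
    gaussK (p.1 i) h x - norm2q (p.1 i) h (cubic p i) x = -1 /\
    (forall X Y v, dnabla (p.1 i) (gJ p i) (p.2 i) x X Y v = 0).

Definition tangent_D3 (p v : pairJA) : Prop :=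
  [/\ is_end_field v.1, is_endform_field v.2
    & forall i x, img i x ->
      let Cdot X Y Z := gJ p i x (v.2 i x X Y) Z in
      [/\ forall u, v.1 i x (p.1 i x u) + p.1 i x (v.1 i x u) = 0,
          forall X Y Z, Cdot X Y Z = Cdot Y X Z /\ Cdot X Y Z = Cdot X Z Y
        & forall X, trE (v.2 i x X)
                    = trE (p.1 i x \o p.2 i x X \o v.1 i x)]].

(* c is a smooth path in HS_0, defined near t = 0. *)
Definition path_in_HS (F : R -> R) (c : R -> pairJA) : Prop :=
  exists2 eps : R, 0 < eps &
    (forall t, `|t| < eps -> in_HS F (c t)) /\
    (forall i, let U := [set tx : R * E | `|tx.1| < eps /\ img i tx.2] in
       (forall u, smooth_on U (fun tx : R * E => (c tx.1).1 i tx.2 u)) /\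
       (forall u v, smooth_on U (fun tx : R * E => (c tx.1).2 i tx.2 u v))).

(* The velocity at t = 0: the second component differentiates the cubic tensor
   C, not the endomorphism A. *)
Definition velocity (c : R -> pairJA) (v : pairJA) : Prop :=
  forall i x, img i x ->
    (forall u, is_derive (0 : R) 1 (fun t => (c t).1 i x u) (v.1 i x u)) /\
    (forall X Y Z, is_derive (0 : R) 1 (fun t => cubic (c t) i x X Y Z)
                     (gJ (c 0) i x (v.2 i x X Y) Z)).

(* Components Adot_tr and Adot_0 of the tangent vector v at p. *)
Definition Atr (p v : pairJA) (i : chart S) (x X u : E) : E :=
  (2^-1 * trE (p.1 i x \o p.2 i x X \o v.1 i x)) *: u.
Definition A0 (p v : pairJA) (i : chart S) (x X u : E) : E :=
  v.2 i x X u - Atr p v i x X u.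

(* Derivative of a function on [0, +oo[, one-sided at 0. *)
Definition rderiv (f : R -> R) (t : R) : R :=
  lim (h^-1 * (f (t + h) - f t) @[h --> 0^'+]).

Definition g_f (f : R -> R) (p v w : pairJA) : R :=
  \int[mu]_m on_surface (fun i x =>
    let ip := ipA (p.1 i) (gJ p i) x in
    let t := normA0 p i x in
    (1 - f t) * (2^-1 * trE (v.1 i x \o w.1 i x))
    + rderiv f t / 6 * ip (A0 p v i x) (A0 p w i x)
    - rderiv f t / 12 * ip (Atr p v i x) (Atr p w i x)) m.

Definition Istr (p v : pairJA) : pairJA :=
  (fun i x u => - p.1 i x (v.1 i x u),
   fun i x X u => - v.2 i x X (p.1 i x u) - p.2 i x X (v.1 i x u)).

Definition omega_f (f : R -> R) (p v w : pairJA) : R := g_f f p v (Istr p w).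

Section Gauge.
Variables (f : R -> R) (p v : pairJA) (i : chart S).
Let J := p.1 i.
Let g := gJ p i.
Let ip (x : E) := ipA J g x.
Let t (x : E) : R := normA0 p i x.

Definition betaf (x X : E) : R :=
  ip x (fun Y u => nabla_form J g (p.2 i) x X Y (J x u)) (A0 p v i x).
Definition fdot (x : E) : R :=
  rderiv f (t x) / 4 * ip x (p.2 i x) (A0 p v i x).
Definition fdot0 (x : E) : R :=
  - (rderiv f (t x) / 4) * ip x (p.2 i x) (fun X u => A0 p v i x X (J x u)).
Definition divf (x X : E) : R :=
  divE J g (fun y u => (f (t y) - 1) *: v.1 i y u) x X.
Definition alpha1 (x X : E) : R :=
  divf x X + 'D_(J x X) fdot x - rderiv f (t x) / 6 * betaf x X.
Definition alpha2 (x X : E) : R :=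
  divf x (J x X) + 'D_(J x X) fdot0 x - rderiv f (t x) / 6 * betaf x (J x X).

(* d^nabla Adot_0 - J (div Jdot /\ A) = 0 *)
Definition lin_hol_eq (x : E) : Prop := forall X Y u,
  dnabla J g (A0 p v i) x X Y u
  - J x (divE J g (v.1 i) x X *: p.2 i x Y u
         - divE J g (v.1 i) x Y *: p.2 i x X u) = 0.

End Gauge.

(* The space V_(J, A), identified with the tangent space of Hit_3 at the class
   of p = (J, A). *)
Definition V_space (F f : R -> R) (p v : pairJA) : Prop :=
  [/\ tangent_D3 p v,
      exists c, [/\ path_in_HS F c, c 0 = p & velocity c v],
      forall i x, img i x -> lin_hol_eq p v i x,
      exact1 (alpha1 f p v)
    & exact1 (alpha2 f p v)].

(* Lie derivatives along Y, evaluated on constant vector fields. *)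
Definition lie_J (p : pairJA) (Y : vec_field) i (x u : E) : E :=
  'D_(Y i x) (fun y => p.1 i y u) x - 'D_(p.1 i x u) (Y i) x
  + p.1 i x ('D_u (Y i) x).
Definition lie_C (p : pairJA) (Y : vec_field) i (x u v w : E) : R :=
  'D_(Y i x) (fun y => cubic p i y u v w) x + cubic p i x ('D_u (Y i) x) v w
  + cubic p i x u ('D_v (Y i) x) w + cubic p i x u v ('D_w (Y i) x).
Definition lie_rho (Y : vec_field) i (x u v : E) : R :=
  'D_(Y i x) (fun y => rho i y u v) x + rho i x ('D_u (Y i) x) v
  + rho i x u ('D_v (Y i) x).

(* u and X have the same image in the tangent space of the quotient by
   Symp_0(Sigma, rho): X - u is tangent to the orbit of p, whose tangent space
   consists of the Lie derivatives of (J, C) along vector fields Y with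
   L_Y rho = 0. *)
Definition same_class (p u X : pairJA) : Prop :=
  exists Y : vec_field, is_vec_field Y /\ forall i x, img i x ->
    [/\ forall a b, lie_rho Y i x a b = 0,
        forall a, X.1 i x a = u.1 i x a + lie_J p Y i x a
      & forall a b c, gJ p i x (X.2 i x a b) c
                      = gJ p i x (u.2 i x a b) c + lie_C p Y i x a b c].

Definition Psi (theta : R) (p : pairJA) : pairJA :=
  (p.1, fun i x X u => cos theta *: p.2 i x X u
                       - sin theta *: p.2 i x X (p.1 i x u)).

(* X in V_p represents the generator of (Psi_theta) on Hit_3 at the class of p.
   The velocity (0, - A J) of Psi_theta p itself need not lie in V_p. *)
Definition generates_Psi (F f : R -> R) (p X : pairJA) : Prop :=
  V_space F f p X /\
  exists2 u, velocity (fun theta => Psi theta p) u & same_class p u X.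

(* v' is the image of the tangent vector v at p under the differential of
   Psi_theta. *)
Definition dPsi (F : R -> R) (theta : R) (p v v' : pairJA) : Prop :=
  forall c, path_in_HS F c -> c 0 = p -> velocity c v ->
    velocity (Psi theta \o c) v'.

End Surface.

(* F : [0, +oo[ -> R; smoothness up to 0 means that F extends to a smooth
   function on R.  Values of F on the negative axis are irrelevant. *)
Definition is_F (R : realType) (c : R) (F : R -> R) : Prop :=
  [/\ forall t, 0 <= t ->
        c * expR (- F t) - 2 * t * expR (- 3 * F t) + 1 = 0,
      F 0 = ln `|c|
    & exists2 G : R -> R, smooth_on [set: R] G & forall t, 0 <= t -> G t = F t].

Definition f_of (R : realType) (F : R -> R) (t : R) : R :=
  - (\int[lebesgue_measure]_(s in `]0, t[) (derive1 F s * s `^ (- 3^-1)))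
  * t `^ (3^-1).

(* Main.v *)
(* In the frame (d_1, J d_1) of a chart a cubic form is a pair of numbers (a, b),
   a tangent vector is a quadruple (m, n, k, l), and the circle acts by rotations.
   As the Levi-Civita connection commutes with J, the equations defining HS_0 and
   V_(J, A) rotate along with q; this gives the isometry statement.

   For the Hamiltonian, X = (0, - A J) + L_Y (J, A) with Y divergence free.  The
   integrand of omega_f (X, v) is 2/3 of the derivative of f (||q||^2 / 2) along v
   plus the divergence of (f - 1) Jdot Y + fdot J Y - u Y, where u is a potential
   of the exact form alpha1.  The divergence integrates to zero, by a C^1 partition
   of unity, and differentiation under the integral sign identifies the integral
   of the first term with the derivative of H. *)
Require Import Defs.
From HB Require Import structures.
From mathcomp Require Import all_boot all_order all_algebra.
From mathcomp Require Import all_classical all_reals all_analysis.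
From mathcomp Require Import measurable_realfun ring lra.
Set Implicit Arguments.
Unset Strict Implicit.
Unset Printing Implicit Defensive.
Import Order.TTheory GRing.Theory Num.Theory numFieldNormedType.Exports.
Local Open Scope classical_set_scope.
Local Open Scope ring_scope.

(** * Functions of class C^k *)

(** The formula for [f] contains the singular factors [s^(-1/3)] and [t^(1/3)], and its argument
    vanishes at the zeros of [q]. Smoothness of [f (||q||^2 / 2)] on the surface is therefore not
    evident, yet the divergence and the differentiation under the integral sign both depend on it.
    The substitution [s = t r^3] removes both singularities and yields a function, smooth on the
    whole line, that equals [f] on the half-line. Normalising a frame introduces a square root. The
    vectors d_1 and J d_1 are orthogonal, have equal length and depend on [J] without any root, so
    in their coordinates each pointwise identity becomes a rational one. The constant 2/3 is a
    quotient of two weights. The part (0, - A J) of [X] contributes (f'/6) <A, Adot_0> to the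
    integrand, whereas ||A||_0^2 varies along [v] at the rate (1/4) <A, Adot_0>. *)

Section DerivativeRules.
Variables (R : realType) (V : normedModType R).
Implicit Types (f g : V -> R) (x v : V).

Lemma is_deriveD_fun (W : normedModType R) (f g : V -> W) x v df dg :
  is_derive x v f df -> is_derive x v g dg ->
  is_derive x v (fun y => f y + g y) (df + dg).
Proof. by move=> ? ?; exact: is_deriveD. Qed.

Lemma is_deriveN_fun (W : normedModType R) (f : V -> W) x v df :
  is_derive x v f df -> is_derive x v (fun y => - f y) (- df).
Proof. by move=> ?; exact: is_deriveN. Qed.

Lemma is_deriveB_fun (W : normedModType R) (f g : V -> W) x v df dg :
  is_derive x v f df -> is_derive x v g dg ->
  is_derive x v (fun y => f y - g y) (df - dg).
Proof. by move=> ? ?; exact: is_deriveB. Qed.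

Lemma is_deriveM_fun f g x v (df dg : R) :
  is_derive x v f df -> is_derive x v g dg ->
  is_derive x v (fun y => f y * g y) (df * g x + f x * dg).
Proof.
move=> ? ?; apply: is_derive_eq (is_deriveM _ _) _ => /=.
by rewrite addrC; congr (_ + _); rewrite [LHS]mulrC.
Qed.

Lemma is_deriveV_fun f x v (df : R) : f x != 0 ->
  is_derive x v f df -> is_derive x v (fun y => (f y)^-1) (- df / (f x) ^+ 2).
Proof.
move=> fx0 [dfx <-]; apply: DeriveDef; first exact: derivableV.
by rewrite deriveV // [LHS]mulNr mulNr mulrC.
Qed.

(** Only the restriction of [f] to the line through [x] in direction [v] enters, so the one-variable
    chain rule applies to a function that is merely directionally differentiable. *)
Lemma is_derive_comp1 (h : R -> R) f x v (dh df : R) :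
  is_derive (f x) 1 h dh -> is_derive x v f df ->
  is_derive x v (fun y => h (f y)) (dh * df).
Proof.
move=> dh' [/derivable1P fx <-].
pose u t := f (t *: v + x).
have u0 : u 0 = f x by rewrite /u scale0r add0r.
have uE (k : R -> R) : (fun t => t^-1 *: (((k \o u) \o shift 0) (t *: 1) - k (u 0)))
    = (fun t => t^-1 *: (((k \o f) \o shift x) (t *: v) - k (f x))).
  by apply/funext => t /=; rewrite u0 /u addr0 [t *: 1]mulr1.
have du : is_derive (0 : R) 1 u ('D_v f x).
  by apply: DeriveDef => //; rewrite /derive (uE id).
rewrite -u0 in dh'; have [] := is_derive1_comp dh' du.
move=> hu hu'; apply: DeriveDef.
  by apply/derivable1P; exact: hu.
by rewrite -hu' /derive (uE h).
Qed.

Lemma is_derive_pair (W1 W2 : normedModType R) (f : V -> W1) (g : V -> W2)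
    x v df dg :
  is_derive x v f df -> is_derive x v g dg ->
  is_derive x v (fun y => (f y, g y)) (df, dg).
Proof.
move=> [fx <-] [gx <-].
have c : h^-1 *: (((fun y => (f y, g y)) \o shift x) (h *: v)
      - (f x, g x)) @[h --> 0^'] --> ('D_v f x, 'D_v g x).
  exact: (cvg_pair fx gx).
by apply: DeriveDef; [apply/cvg_ex; eexists; exact: c | exact: cvg_lim c].
Qed.

Lemma is_derive_fst (W1 W2 : normedModType R) (f : V -> W1 * W2) x v df :
  is_derive x v f df -> is_derive x v (fun y => (f y).1) df.1.
Proof.
move=> [fx <-].
have c : h^-1 *: (((fun y => (f y).1) \o shift x) (h *: v) - (f x).1)
    @[h --> 0^'] --> ('D_v f x).1.
  exact: (cvg_comp _ _ fx (@cvg_fst _ _ (nbhs ('D_v f x).1) (nbhs ('D_v f x).2) _)).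
by apply: DeriveDef; [apply/cvg_ex; eexists; exact: c | exact: cvg_lim c].
Qed.

Lemma is_derive_snd (W1 W2 : normedModType R) (f : V -> W1 * W2) x v df :
  is_derive x v f df -> is_derive x v (fun y => (f y).2) df.2.
Proof.
move=> [fx <-].
have c : h^-1 *: (((fun y => (f y).2) \o shift x) (h *: v) - (f x).2)
    @[h --> 0^'] --> ('D_v f x).2.
  exact: (cvg_comp _ _ fx (@cvg_snd _ _ (nbhs ('D_v f x).1) (nbhs ('D_v f x).2) _)).
by apply: DeriveDef; [apply/cvg_ex; eexists; exact: c | exact: cvg_lim c].
Qed.

Lemma is_derive_near (W : normedModType R) (f g : V -> W) (U : set V) x v df :
  open U -> U x -> (forall y, U y -> f y = g y) ->
  is_derive x v f df -> is_derive x v g df.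
Proof.
move=> oU Ux fg; apply: near_eq_is_derive.
by near=> y; apply: fg; near: y; exact: open_nbhs_nbhs.
Unshelve. all: end_near. Qed.

Lemma derive_near (W : normedModType R) (f g : V -> W) (U : set V) x v :
  open U -> U x -> (forall y, U y -> f y = g y) -> 'D_v f x = 'D_v g x.
Proof.
move=> oU Ux fg; apply: near_eq_derive.
by near=> y; apply: fg; near: y; exact: open_nbhs_nbhs.
Unshelve. all: end_near. Qed.

End DerivativeRules.

Section CkFunctions.
Variables (R : realType) (V : normedModType R).
Implicit Types (f g : V -> R) (U : set V).

(* Finite-order counterpart of [smooth_on], suited to induction on the order. *)
Fixpoint Ck (k : nat) U f : Prop :=
  (forall x, U x -> {for x, continuous f}) /\
  if k is k'.+1 then
    (forall x v, U x -> derivable f x v) /\ forall v, Ck k' U ('D_v f)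
  else True.

Lemma Ck_continuous k U f x : Ck k U f -> U x -> {for x, continuous f}.
Proof. by case: k => [|k] [cf _]; exact: cf. Qed.

Lemma Ck_is_derive k U f x v : Ck k.+1 U f -> U x -> is_derive x v f ('D_v f x).
Proof. by move=> [_ [df _]] Ux; exact/derivableP/df. Qed.

Lemma Ck_derive k U f v : Ck k.+1 U f -> Ck k U ('D_v f).
Proof. by move=> [_ [_ /(_ v)]]. Qed.

Lemma Ck_pred k U f : Ck k.+1 U f -> Ck k U f.
Proof.
elim: k f => [|k IH] f [cf [df Df]]; first by split.
by split=> //; split=> // v; apply: IH.
Qed.

Lemma Ck_le k l U f : (k <= l)%N -> Ck l U f -> Ck k U f.
Proof.
elim: l => [|l IH]; first by rewrite leqn0 => /eqP ->.
rewrite leq_eqVlt => /orP[/eqP -> //|]; rewrite ltnS => kl /Ck_pred.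
exact: IH.
Qed.

(** [Ck] speaks only of the points of its set, so the sets [U'] may leave [U]. Functions extended by
    zero are glued in this way. *)
Lemma Ck_local k U f :
  (forall x, U x -> exists2 U', U' x & Ck k U' f) -> Ck k U f.
Proof.
elim: k f => [|k IH] f H.
  by split=> // x Ux; have [U' U'x /Ck_continuous] := H x Ux; exact.
split; last split.
- by move=> x Ux; have [U' U'x /Ck_continuous] := H x Ux; exact.
- by move=> x v Ux; have [U' U'x [_ [df _]]] := H x Ux; exact: df.
- move=> v; apply: IH => x Ux; have [U' U'x [_ [_ Df]]] := H x Ux.
  by exists U' => //; exact: Df.
Qed.

Lemma Ck_sub k U U' f : U' `<=` U -> Ck k U f -> Ck k U' f.
Proof. by move=> UU' cf; apply: Ck_local => x U'x; exists U => //; exact: UU'. Qed.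

Lemma Ck_eq k U f g : open U -> (forall x, U x -> f x = g x) ->
  Ck k U f -> Ck k U g.
Proof.
move=> oU; elim: k f g => [|k IH] f g fg [cf dDf];
  have cg : forall x, U x -> {for x, continuous g}.
- move=> x Ux; rewrite /prop_for /continuous_at -fg //.
  apply: cvg_trans (cf x Ux); apply: near_eq_cvg.
  by near=> y; apply/fg; near: y; exact: open_nbhs_nbhs.
- by split.
- move=> x Ux; rewrite /prop_for /continuous_at -fg //.
  apply: cvg_trans (cf x Ux); apply: near_eq_cvg.
  by near=> y; apply/fg; near: y; exact: open_nbhs_nbhs.
split=> //; move: dDf => [df Df]; split.
  move=> x v Ux; apply: near_eq_derivable (df x v Ux).
  by near=> y; apply/fg; near: y; exact: open_nbhs_nbhs.
by move=> v; apply: IH (Df v) => x Ux; exact: derive_near oU Ux fg.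
Unshelve. all: end_near. Qed.

Lemma Ck_cst k U (c : R) : Ck k U (fun=> c).
Proof.
elim: k c => [|k IH] c; first by split=> // x _; exact: cvg_cst.
split=> [x _|]; first exact: cvg_cst.
split=> [x v _|v]; first exact: derivable_cst.
have -> : 'D_v (fun=> c) = (fun=> 0 : R).
  by apply/funext => x; exact: derive_cst.
exact: IH.
Qed.

Lemma CkD k U f g : open U -> Ck k U f -> Ck k U g ->
  Ck k U (fun x => f x + g x).
Proof.
move=> oU; elim: k f g => [|k IH] f g cf cg.
  split=> // x Ux; apply: cvgD; [exact: Ck_continuous cf Ux|exact: Ck_continuous cg Ux].
split; first by move=> x Ux; apply: cvgD; [exact: Ck_continuous cf Ux|exact: Ck_continuous cg Ux].
have d x v : U x -> is_derive x v (fun x => f x + g x) ('D_v f x + 'D_v g x).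
  by move=> Ux; apply: is_deriveD_fun; [exact: Ck_is_derive cf Ux|exact: Ck_is_derive cg Ux].
split=> [x v Ux|v]; first by case: (d x v Ux).
apply: Ck_eq (IH _ _ (Ck_derive v cf) (Ck_derive v cg)) => // x Ux.
by case: (d x v Ux).
Qed.

Lemma CkM k U f g : open U -> Ck k U f -> Ck k U g ->
  Ck k U (fun x => f x * g x).
Proof.
move=> oU; elim: k f g => [|k IH] f g cf cg.
  split=> // x Ux; apply: cvgM; [exact: Ck_continuous cf Ux|exact: Ck_continuous cg Ux].
split; first by move=> x Ux; apply: cvgM; [exact: Ck_continuous cf Ux|exact: Ck_continuous cg Ux].
have d x v : U x ->
    is_derive x v (fun x => f x * g x) ('D_v f x * g x + f x * 'D_v g x).
  by move=> Ux; apply: is_deriveM_fun; [exact: Ck_is_derive cf Ux|exact: Ck_is_derive cg Ux].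
split=> [x v Ux|v]; first by case: (d x v Ux).
apply: (@Ck_eq _ _ (fun x => 'D_v f x * g x + f x * 'D_v g x)) => //.
  by move=> x Ux; case: (d x v Ux).
apply: CkD => //.
  by apply: IH; [exact: Ck_derive cf|exact: Ck_pred].
by apply: IH; [exact: Ck_pred|exact: Ck_derive cg].
Qed.

Lemma CkN k U f : open U -> Ck k U f -> Ck k U (fun x => - f x).
Proof.
move=> oU cf; apply: (@Ck_eq _ _ (fun x => (- 1) * f x)) => //.
  by move=> x _; rewrite mulN1r.
by apply: CkM => //; exact: Ck_cst.
Qed.

Lemma CkB k U f g : open U -> Ck k U f -> Ck k U g ->
  Ck k U (fun x => f x - g x).
Proof. by move=> oU cf cg; apply: CkD => //; exact: CkN. Qed.

Lemma CkX k U f n : open U -> Ck k U f -> Ck k U (fun x => f x ^+ n).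
Proof.
move=> oU cf; elim: n => [|n IH]; first exact: Ck_cst.
apply: (@Ck_eq _ _ (fun x => f x * f x ^+ n)) => //; last exact: CkM.
by move=> x _; rewrite exprS.
Qed.

Lemma Ck_sum k U (I : Type) (s : seq I) (F : I -> V -> R) : open U ->
  (forall i, Ck k U (F i)) -> Ck k U (fun x => \sum_(i <- s) F i x).
Proof.
move=> oU cF; elim: s => [|i s IH].
  by apply: (Ck_eq oU _ (Ck_cst k U 0)) => x _; rewrite big_nil.
apply: (Ck_eq oU _ (CkD oU (cF i) IH)) => x _.
by rewrite big_cons.
Qed.

Lemma CkV k U f : open U -> (forall x, U x -> f x != 0) -> Ck k U f ->
  Ck k U (fun x => (f x)^-1).
Proof.
move=> oU f0; elim: k => [|k IH] cf.
  by split=> // x Ux; apply: cvgV; [exact: f0|exact: Ck_continuous cf Ux].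
split; first by move=> x Ux; apply: cvgV; [exact: f0|exact: Ck_continuous cf Ux].
have d x v : U x -> is_derive x v (fun x => (f x)^-1) (- 'D_v f x / (f x) ^+ 2).
  by move=> Ux; apply: is_deriveV_fun; [exact: f0|exact: Ck_is_derive cf Ux].
split=> [x v Ux|v]; first by case: (d x v Ux).
apply: (@Ck_eq _ _ (fun x => - 'D_v f x * ((f x)^-1 ^+ 2))) => //.
  by move=> x Ux; case: (d x v Ux) => _ ->; rewrite exprVn.
apply: CkM => //; first by apply: CkN => //; exact: Ck_derive.
by apply: CkX => //; apply: IH; exact: Ck_pred.
Qed.

End CkFunctions.

Section CkComp.
Variables (R : realType) (V : normedModType R).

Lemma Ck_comp k (U : set V) (h : R -> R) (f : V -> R) : open U ->
  Ck k [set: R] h -> Ck k U f -> Ck k U (fun x => h (f x)).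
Proof.
move=> oU; elim: k h => [|k IH] h ch cf.
  split=> // x Ux; apply: (@cvg_comp _ _ _ f h); first exact: Ck_continuous cf Ux.
  exact: Ck_continuous ch I.
split.
  move=> x Ux; apply: (@cvg_comp _ _ _ f h); first exact: Ck_continuous cf Ux.
  exact: Ck_continuous ch I.
have d x v : U x -> is_derive x v (fun x => h (f x)) ('D_1 h (f x) * 'D_v f x).
  move=> Ux; apply: is_derive_comp1; first exact: Ck_is_derive ch I.
  exact: Ck_is_derive cf Ux.
split=> [x v Ux|v]; first by case: (d x v Ux).
apply: (@Ck_eq _ _ _ _ (fun x => 'D_1 h (f x) * 'D_v f x)) => //.
  by move=> x Ux; case: (d x v Ux).
apply: CkM => //; last exact: Ck_derive.
have := IH _ (Ck_derive (1 : R) ch) (Ck_pred cf).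
exact.
Qed.

End CkComp.

(** * Smooth functions with values in a normed space *)

Section SmoothOn.
Variables (R : realType) (V : normedModType R).
Implicit Types U : set V.

(** In [foldr] the last direction of the list acts first, so appending [v] differentiates [f] before
    the other directions act. Inductions on the list therefore run from its end. *)
Lemma smooth_on_derive (W : normedModType R) U (f : V -> W) v :
  smooth_on U f -> smooth_on U ('D_v f).
Proof.
move=> sf vs x Ux; have := sf (rcons vs v) x Ux.
by rewrite /iter_derive foldr_rcons.
Qed.

Lemma smooth_on_is_derive (W : normedModType R) U (f : V -> W) x v :
  smooth_on U f -> U x -> is_derive x v f ('D_v f x).
Proof. by move=> sf Ux; apply/derivableP; case: (sf [::] x Ux). Qed.

Lemma smooth_on_continuous (W : normedModType R) U (f : V -> W) x :
  smooth_on U f -> U x -> {for x, continuous f}.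
Proof. by move=> sf Ux; case: (sf [::] x Ux). Qed.

Lemma smooth_on_Ck U (f : V -> R) : smooth_on U f <-> forall k, Ck k U f.
Proof.
split=> [sf k|cf vs x Ux].
  elim: k f sf => [|k IH] f sf.
    by split=> // x Ux; exact: smooth_on_continuous sf Ux.
  split; first by move=> x Ux; exact: smooth_on_continuous sf Ux.
  split=> [x v Ux|v]; first by case: (smooth_on_is_derive v sf Ux).
  by apply: IH; exact: smooth_on_derive.
elim/last_ind: vs f cf => [|vs v IH] f cf.
  split; last exact: Ck_continuous (cf 0%N) Ux.
  by move=> v; case: (Ck_is_derive v (cf 1%N) Ux).
rewrite /iter_derive foldr_rcons; apply: IH => k.
exact: Ck_derive (cf k.+1).
Qed.

(** [Ck] is scalar-valued. For vector values, smoothness is obtained by coinduction: it suffices to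
    exhibit a class of functions, continuous on [U], that contains a representative on [U] of each
    directional derivative of its members. *)
Lemma smooth_on_coind (W : normedModType R) U (P : (V -> W) -> Prop) (f : V -> W) :
  open U ->
  (forall f x, P f -> U x -> {for x, continuous f}) ->
  (forall f v, P f -> exists2 g, P g & forall x, U x -> is_derive x v f (g x)) ->
  P f -> smooth_on U f.
Proof.
(* Generalised to every function equal to [f] on [U], because the derivative supplied by [P] agrees
   with the true one only there. *)
move=> oU Pc Pd Pf vs; suff : forall g, (forall x, U x -> f x = g x) -> forall x, U x ->
    (forall v, derivable (iter_derive vs g) x v) /\
    {for x, continuous (iter_derive vs g)} by apply.
elim/last_ind: vs f Pf => [|vs v IH] f Pf g fg x Ux.
  split=> [v|].
    have [df _ dfE] := Pd f v Pf; have [fx _] := dfE x Ux.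
    apply: near_eq_derivable fx.
    by near=> y; apply/fg; near: y; exact: open_nbhs_nbhs.
  rewrite /prop_for /continuous_at /= -fg //.
  apply: cvg_trans (Pc f x Pf Ux); apply: near_eq_cvg.
  by near=> y; apply/fg; near: y; exact: open_nbhs_nbhs.
rewrite /iter_derive foldr_rcons; have [df Pdf dfE] := Pd f v Pf.
apply: (IH df) => // y Uy; have [_ <-] := dfE y Uy.
exact: derive_near oU Uy fg.
Unshelve. all: end_near. Qed.

Lemma smooth_on_eq (W : normedModType R) U (f g : V -> W) :
  open U -> (forall x, U x -> f x = g x) -> smooth_on U f -> smooth_on U g.
Proof.
move=> oU fg sf.
apply: (@smooth_on_coind _ _ (fun g => exists2 f, smooth_on U f & forall x, U x -> f x = g x)) => //.
- move=> {f g fg sf} g x [f sf fg] Ux; rewrite /prop_for /continuous_at /= -fg //.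
  apply: cvg_trans (smooth_on_continuous sf Ux); apply: near_eq_cvg.
  by near=> y; apply/fg; near: y; exact: open_nbhs_nbhs.
- move=> {f g fg sf} g v [f sf fg]; exists ('D_v f).
    by exists ('D_v f) => //; exact: smooth_on_derive.
  by move=> x Ux; apply: (is_derive_near oU Ux fg); exact: (smooth_on_is_derive v sf Ux).
- by exists f.
Unshelve. all: end_near. Qed.

Lemma smooth_on_pair U (W1 W2 : normedModType R) (f : V -> W1) (g : V -> W2) :
  open U -> smooth_on U f -> smooth_on U g -> smooth_on U (fun x => (f x, g x)).
Proof.
move=> oU sf sg; apply: (@smooth_on_coind _ _ (fun k => exists f g,
  [/\ smooth_on U f, smooth_on U g & k = (fun x => (f x, g x))])) => //.
- move=> {f g sf sg} _ x [f [g [sf sg ->]]] Ux.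
  exact: (cvg_pair (smooth_on_continuous sf Ux) (smooth_on_continuous sg Ux)).
- move=> {f g sf sg} _ v [f [g [sf sg ->]]].
  exists (fun x => ('D_v f x, 'D_v g x)).
    by exists ('D_v f), ('D_v g); split=> //; exact: smooth_on_derive.
  move=> x Ux; apply: is_derive_pair; exact: smooth_on_is_derive Ux.
- by exists f, g.
Qed.

Lemma smooth_on_fst U (W1 W2 : normedModType R) (f : V -> W1 * W2) :
  open U -> smooth_on U f -> smooth_on U (fun x => (f x).1).
Proof.
move=> oU sf; apply: (@smooth_on_coind _ _ (fun k => exists2 f : V -> W1 * W2,
  smooth_on U f & k = (fun x => (f x).1))) => //; last by exists f.
- move=> {f sf} _ x [f sf ->] Ux.
  exact: (cvg_comp _ _ (smooth_on_continuous sf Ux) (@cvg_fst _ _ (nbhs (f x).1) (nbhs (f x).2) _)).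
- move=> {f sf} _ v [f sf ->]; exists (fun x => ('D_v f x).1).
    by exists ('D_v f) => //; exact: smooth_on_derive.
  by move=> x Ux; apply: is_derive_fst; exact: smooth_on_is_derive Ux.
Qed.

Lemma smooth_on_snd U (W1 W2 : normedModType R) (f : V -> W1 * W2) :
  open U -> smooth_on U f -> smooth_on U (fun x => (f x).2).
Proof.
move=> oU sf; apply: (@smooth_on_coind _ _ (fun k => exists2 f : V -> W1 * W2,
  smooth_on U f & k = (fun x => (f x).2))) => //; last by exists f.
- move=> {f sf} _ x [f sf ->] Ux.
  exact: (cvg_comp _ _ (smooth_on_continuous sf Ux) (@cvg_snd _ _ (nbhs (f x).1) (nbhs (f x).2) _)).
- move=> {f sf} _ v [f sf ->]; exists (fun x => ('D_v f x).2).
    by exists ('D_v f) => //; exact: smooth_on_derive.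
  by move=> x Ux; apply: is_derive_snd; exact: smooth_on_is_derive Ux.
Qed.

Lemma smooth_onD U (f g : V -> R) : open U -> smooth_on U f ->
  smooth_on U g -> smooth_on U (fun x => f x + g x).
Proof. by move=> oU /smooth_on_Ck cf /smooth_on_Ck cg; apply/smooth_on_Ck => k; exact: CkD. Qed.

Lemma smooth_onB U (f g : V -> R) : open U -> smooth_on U f ->
  smooth_on U g -> smooth_on U (fun x => f x - g x).
Proof. by move=> oU /smooth_on_Ck cf /smooth_on_Ck cg; apply/smooth_on_Ck => k; exact: CkB. Qed.

Lemma smooth_onM U (f g : V -> R) : open U -> smooth_on U f ->
  smooth_on U g -> smooth_on U (fun x => f x * g x).
Proof. by move=> oU /smooth_on_Ck cf /smooth_on_Ck cg; apply/smooth_on_Ck => k; exact: CkM. Qed.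

Lemma smooth_onV U (f : V -> R) : open U -> (forall x, U x -> f x != 0) ->
  smooth_on U f -> smooth_on U (fun x => (f x)^-1).
Proof. by move=> oU f0 /smooth_on_Ck cf; apply/smooth_on_Ck => k; exact: CkV. Qed.

Lemma smooth_on_cst U (c : R) : smooth_on U (fun=> c).
Proof. by apply/smooth_on_Ck => k; exact: Ck_cst. Qed.

Lemma smooth_on_lincomb (W : normedModType R) U (f g : V -> W) (a b : R) : open U ->
  smooth_on U f -> smooth_on U g -> smooth_on U (fun x => a *: f x + b *: g x).
Proof.
move=> oU sf sg; apply: (@smooth_on_coind _ _ (fun k => exists f g,
  [/\ smooth_on U f, smooth_on U g & k = (fun x => a *: f x + b *: g x)])) => //.
- move=> {f g sf sg} _ x [f [g [sf sg ->]]] Ux; apply: cvgD; apply: cvgZr.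
    exact: smooth_on_continuous sf Ux.
  exact: smooth_on_continuous sg Ux.
- move=> {f g sf sg} _ v [f [g [sf sg ->]]].
  exists (fun x => a *: 'D_v f x + b *: 'D_v g x).
    by exists ('D_v f), ('D_v g); split=> //; exact: smooth_on_derive.
  move=> x Ux; apply: is_deriveD_fun.
    exact: (is_deriveZ a (smooth_on_is_derive v sf Ux)).
  exact: (is_deriveZ b (smooth_on_is_derive v sg Ux)).
- by exists f, g.
Qed.

End SmoothOn.

(** * Mean values along lines and differentiability in the plane *)

Section Lines.
Variables (R : realType) (V W : normedModType R).

Lemma is_derive_line (f : V -> W) x v (t : R) df :
  is_derive (x + t *: v) v f df -> is_derive t 1 (fun s => f (x + s *: v)) df.
Proof.
move=> [fx <-].
have E : (fun h => h^-1 *: (((fun s : R => f (x + s *: v)) \o shift t) (h *: 1) - f (x + t *: v)))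
   = (fun h => h^-1 *: ((f \o shift (x + t *: v)) (h *: v) - f (x + t *: v))).
  by apply/funext => h /=; rewrite [h *: 1]mulr1 scalerDl addrCA.
by apply: DeriveDef; rewrite /derivable /derive E.
Qed.

End Lines.

Section MeanValue.
Variables (R : realType) (V : normedModType R).

Lemma MVT_line (f : V -> R) x v (a : R) :
  (forall t : R, `|t| <= `|a| -> derivable f (x + t *: v) v) ->
  exists2 t : R, `|t| <= `|a| & f (x + a *: v) - f x = a * 'D_v f (x + t *: v).
Proof.
move=> df; pose u t := f (x + t *: v).
have du (t : R) : `|t| <= `|a| -> is_derive t 1 u ('D_v f (x + t *: v)).
  by move=> /df /derivableP; exact: is_derive_line.
have u0 : u 0 = f x by rewrite /u scale0r addr0.
have cu (b c : R) : (forall t : R, b <= t <= c -> `|t| <= `|a|) ->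
    {within `[b, c], continuous u}.
  move=> H; apply: derivable_within_continuous => t; rewrite in_itv /= => /H /du.
  by case.
case: (ltgtP a 0) => [a0|a0|->]; last first.
- by exists 0 => //; rewrite !scale0r addr0 subrr mul0r.
- have [||t] := @MVT R u (fun t => 'D_v f (x + t *: v)) 0 a a0.
  + by move=> t; rewrite in_itv /= => /andP[t0 ta]; apply: du; rewrite !gtr0_norm // ltW.
  + by apply: cu => t /andP[t0 ta]; rewrite !ger0_norm // ltW.
  rewrite in_itv /= u0 subr0 => /andP[t0 ta] fE.
  by exists t; [rewrite !gtr0_norm // ltW|rewrite [RHS]mulrC].
- have [||t] := @MVT R u (fun t => 'D_v f (x + t *: v)) a 0 a0.
  + by move=> t; rewrite in_itv /= => /andP[t0 ta]; apply: du; rewrite !ltr0_norm // lerN2 ltW.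
  + by apply: cu => t /andP[t0 ta]; rewrite !ler0_norm ?lerN2 // ltW.
  rewrite in_itv /= u0 sub0r => /andP[t0 ta] fE.
  exists t; first by rewrite !ltr0_norm // lerN2 ltW.
  by rewrite -[LHS]opprB fE mulrN opprK mulrC.
Qed.

End MeanValue.

Section Plane.
Variable R : realType.
Local Notation E := (R * R)%type.

Lemma plane_basisE (h : E) : h = h.1 *: (1, 0) + h.2 *: (0, 1).
Proof.
by apply: injective_projections; rewrite /= /GRing.scale /= ?mulr1 ?mulr0 ?addr0 ?add0r.
Qed.

(** The increment is split along two coordinate segments, with the mean value theorem on each. In
    the maximum norm both intermediate points stay within [|h|] of [x]. *)
Lemma Ck1_increment (U : set E) (f : E -> R) (x h : E) : Ck 1 U f ->
  (forall y : E, `|y| <= `|h| -> U (x + y)) ->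
  exists y z : E, [/\ `|y| <= `|h|, `|z| <= `|h| &
    f (x + h) - f x = h.1 * 'D_((1, 0) : E) f (x + y) + h.2 * 'D_((0, 1) : E) f (x + z)].
Proof.
move=> [_ [df _]] Uh.
have n1 (t : R) : `|t| <= `|h.1| -> `|t *: ((1, 0) : E)| <= `|h|.
  move=> th; rewrite !prod_normE /= /GRing.scale /= mulr1 mulr0 normr0.
  by rewrite ge_max le_max th /= le_max normr_ge0.
have n2 (t : R) : `|t| <= `|h.2| -> `|h.1 *: ((1, 0) : E) + t *: (0, 1)| <= `|h|.
  move=> th; rewrite !prod_normE /= /GRing.scale /= !mulr1 !mulr0 addr0 add0r.
  by rewrite ge_max !le_max th lexx /= orbT.
have [t th Ht] := @MVT_line R E f x (1, 0) h.1 (fun t ht => df _ _ (Uh _ (n1 t ht))).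
have [|s sh Hs] := @MVT_line R E f (x + h.1 *: (1, 0)) (0, 1) h.2.
  by move=> s sh; apply: df; rewrite -addrA; apply/Uh/n2.
exists (t *: (1, 0)), (h.1 *: (1, 0) + s *: (0, 1)); split; [exact: n1|exact: n2|].
rewrite [x + (_ + _)]addrA -Ht -Hs [RHS]addrC addrA subrK.
congr (f _ - _); rewrite -addrA; congr (x + _).
exact: plane_basisE.
Qed.

Definition grad (a b : R) : {linear E -> R} :=
  (a \*: (fst : {linear E -> R}) \+ b \*: (snd : {linear E -> R}))%R.

(** Continuity of the partial derivatives bounds each error term of [Ck1_increment] by [|h| e / 2]
    near [x], which is the little-o estimate of a differential. *)
Lemma Ck1_diff (U : set E) (f : E -> R) (x : E) : open U -> U x ->
  Ck 1 U f -> differentiable f x /\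
  forall v, 'D_v f x = v.1 * 'D_((1, 0) : E) f x + v.2 * 'D_((0, 1) : E) f x.
Proof.
move=> oU Ux cf; pose a : R := 'D_((1, 0) : E) f x; pose b : R := 'D_((0, 1) : E) f x.
pose L := grad a b.
have cL : continuous L.
  move=> y; apply: cvgD; apply: cvgZr; [exact: cvg_fst|exact: cvg_snd].
pose W : normedModType R := R; have H : (f : E -> W) \o shift x = cst (f x : W) + (L : E -> W) +o_ (0 : E) id.
  apply/eqaddoP => e e0; have e20 : 0 < e / 2 by rewrite divr_gt0.
  have c1 : \forall y \near x, `|a - 'D_((1, 0) : E) f y| <= e / 2.
    have := Ck_continuous (Ck_derive ((1, 0) : E) cf) Ux.
    by move=> /cvgrPdist_le /(_ _ e20).
  have c2 : \forall y \near x, `|b - 'D_((0, 1) : E) f y| <= e / 2.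
    have := Ck_continuous (Ck_derive ((0, 1) : E) cf) Ux.
    by move=> /cvgrPdist_le /(_ _ e20).
  have oUx : \forall y \near x, U y by exact: open_nbhs_nbhs.
  have : \forall y \near x, [/\ U y, `|a - 'D_((1, 0) : E) f y| <= e / 2 & `|b - 'D_((0, 1) : E) f y| <= e / 2].
    by apply: filterS3 oUx c1 c2 => y.
  move=> /nbhs_ballP [d /= d0 Hd].
  apply/nbhs_ballP; exists d => // h /=; rewrite prod_norm_ball /ball_ /= sub0r normrN => hd.
  have Hy (y : E) : `|y| <= `|h| -> [/\ U (x + y), `|a - 'D_((1, 0) : E) f (x + y)| <= e / 2 & `|b - 'D_((0, 1) : E) f (x + y)| <= e / 2].
    move=> yh; apply: Hd; rewrite prod_norm_ball /ball_ /= opprD addrA subrr sub0r normrN.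
    exact: le_lt_trans hd.
  have [|y [z [yh zh fE]]] := @Ck1_increment U f x h cf.
    by move=> y /Hy [].
  have [_ Hy1 _] := Hy _ yh; have [_ _ Hz2] := Hy _ zh.
  rewrite /= !fctE /= addrC [h + x]addrC.
  have -> : - (cst (f x) h + L h) + f (x + h) = - (h.1 * (a - 'D_((1, 0) : E) f (x + y)) + h.2 * (b - 'D_((0, 1) : E) f (x + z))).
    have -> : f (x + h) = f x + (h.1 * 'D_((1, 0) : E) f (x + y) + h.2 * 'D_((0, 1) : E) f (x + z)).
      by rewrite -fE [RHS]addrC subrK.
    have -> : L h = a * h.1 + b * h.2 by [].
    by rewrite /cst; ring.
  rewrite normrN; apply: le_trans (ler_normD _ _) _; rewrite !normrM.
  rewrite [leRHS](_ : _ = `|h| * (e / 2) + `|h| * (e / 2)); last by field.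
  by apply: lerD; apply: ler_pM => //; rewrite prod_normE le_max lexx ?orbT.
have dE := diff_unique cL H.
have df : differentiable f x by apply/diff_locallyP; rewrite dE.
split=> // v; rewrite deriveE // dE /L /=.
by congr (_ + _); exact: mulrC.
Unshelve. all: end_near. Qed.

Lemma smooth_on_diff (U : set E) (f : E -> R) (x : E) : open U -> U x ->
  smooth_on U f -> differentiable f x.
Proof. by move=> oU Ux /smooth_on_Ck cf; case: (Ck1_diff oU Ux (cf 1%N)). Qed.

Lemma smooth_on_diff2 (U : set E) (f : E -> E) (x : E) : open U -> U x ->
  smooth_on U f -> differentiable f x.
Proof.
move=> oU Ux sf; have -> : f = (fun y => ((f y).1, (f y).2)).
  by apply/funext => y; case: (f y).
apply: differentiable_pair; apply: (smooth_on_diff oU Ux).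
  exact: smooth_on_fst.
exact: smooth_on_snd.
Qed.

End Plane.

Section Differentiable.
Variables (R : realType) (V W X : normedModType R).

Lemma derive_linear (f : V -> W) x (c : R) u v : differentiable f x ->
  'D_(c *: u + v) f x = c *: 'D_u f x + 'D_v f x.
Proof. by move=> df; rewrite !deriveE // linearP. Qed.

Lemma derive_lincomb (f : V -> W) x (a b : R) u v : differentiable f x ->
  'D_(a *: u + b *: v) f x = a *: 'D_u f x + b *: 'D_v f x.
Proof. by move=> df; rewrite !deriveE // linearP linearZ. Qed.

Lemma derive_chain (T : V -> W) (g : W -> X) x v :
  differentiable T x -> differentiable g (T x) ->
  is_derive x v (g \o T) ('D_('D_v T x) g (T x)).
Proof.
move=> dT dg; have dgT := differentiable_comp dT dg.
apply: DeriveDef; first exact: diff_derivable.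
by rewrite deriveE // diff_comp //= -!deriveE.
Qed.

End Differentiable.

(** * Algebra in the frame (d_1, J d_1) *)

Section Frame.
Variable R : realType.
Local Notation E := (R * R)%type.

(** The data that an area form and a compatible complex structure leave at one point. The pointwise
    algebra refers to nothing else, so it applies in every chart. *)
Record hermitian_at (x : E) (J : E -> E -> E) (g : E -> E -> E -> R)
    (rho : E -> E -> R) : Prop := HermitianAt {
  rho_linl : forall c u v w, rho (c *: u + v) w = c * rho u w + rho v w;
  rho_alt : forall u v, rho u v = - rho v u;
  J_lin : forall c u v, J x (c *: u + v) = c *: J x u + J x v;
  J_sq : forall u, J x (J x u) = - u;
  g_pos : forall u, u != 0 -> 0 < g x u u;
  gE : forall u v, g x u v = rho u (J x v)
}.

(* Coordinates in the frame (d_1, J d_1), orthogonal and of constant length for g. *)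
Definition frv (J : E -> E -> E) x (a b : R) : E := a *: (1, 0) + b *: J x (1, 0).
Definition gfr (g : E -> E -> E -> R) x : R := g x (1, 0) (1, 0).

(** The matrix of [B] in the frame, with rows [(p, q)] and [(s, t)]. Prescribing the values on all
    vectors makes linearity part of the property. *)
Definition frmat J x (B : E -> E) (p q s t : R) : Prop :=
  forall a b, B (frv J x a b) = frv J x (p * a + q * b) (s * a + t * b).

Lemma lin_fun0 (V W : lmodType R) (B : V -> W) :
  (forall (c : R) u v, B (c *: u + v) = c *: B u + B v) -> B 0 = 0.
Proof.
move=> lB; have := lB 1 0 0; rewrite !scale1r addr0 => /eqP.
by rewrite -subr_eq subrr eq_sym => /eqP.
Qed.

Lemma lin_funZ (V W : lmodType R) (B : V -> W) :
  (forall (c : R) u v, B (c *: u + v) = c *: B u + B v) -> forall c u, B (c *: u) = c *: B u.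
Proof. by move=> lB c u; rewrite -[c *: u]addr0 lB (lin_fun0 lB) addr0. Qed.

Lemma lin_funD (V W : lmodType R) (B : V -> W) :
  (forall (c : R) u v, B (c *: u + v) = c *: B u + B v) -> forall u v, B (u + v) = B u + B v.
Proof. by move=> lB u v; rewrite -[u]scale1r lB !scale1r. Qed.

Lemma lin_funN (V W : lmodType R) (B : V -> W) :
  (forall (c : R) u v, B (c *: u + v) = c *: B u + B v) -> forall u, B (- u) = - B u.
Proof. by move=> lB u; rewrite -scaleN1r (lin_funZ lB) scaleN1r. Qed.

Section At.
Variables (x : E) (J : E -> E -> E) (g : E -> E -> E -> R) (rho : E -> E -> R).
Hypothesis H : hermitian_at x J g rho.
Local Notation fr := (frv J x).
Local Notation fmat := (frmat J x).
Local Notation G := (gfr g x).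

Lemma frD a b c d : fr a b + fr c d = fr (a + c) (b + d).
Proof. by rewrite /frv !scalerDl addrACA. Qed.

Lemma frN a b : - fr a b = fr (- a) (- b).
Proof. by rewrite /frv !scaleNr opprD. Qed.

Lemma frB a b c d : fr a b - fr c d = fr (a - c) (b - d).
Proof. by rewrite frN frD. Qed.

Lemma frZ k a b : k *: fr a b = fr (k * a) (k * b).
Proof. by rewrite /frv scalerDr !scalerA. Qed.

Definition frE := (frD, frN, frB, frZ).

Lemma fr10 : fr 1 0 = (1, 0).
Proof. by rewrite /frv scale1r scale0r addr0. Qed.

Lemma fr00 : fr 0 0 = 0.
Proof. by rewrite /frv !scale0r addr0. Qed.

Lemma gfr_gt0 : 0 < G.
Proof. by apply: (g_pos H); rewrite xpair_eqE oner_eq0. Qed.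

Lemma gfr_neq0 : G != 0.
Proof. by rewrite gt_eqF // gfr_gt0. Qed.

(** An alternating bilinear form on the plane is a multiple of the determinant; linearity in the
    second argument comes from [rho_alt]. *)
Lemma rho_det u v : rho u v = rho (1, 0) (0, 1) * (u.1 * v.2 - u.2 * v.1).
Proof.
have l0 w : rho 0 w = 0.
  have := rho_linl H 1 0 0 w; rewrite scale1r addr0 mul1r => /eqP.
  by rewrite -subr_eq subrr eq_sym => /eqP.
have lZ c w z : rho (c *: w) z = c * rho w z.
  by rewrite -[c *: w]addr0 (rho_linl H) l0 addr0.
have alt w : rho w w = 0.
  have := rho_alt H w w => /eqP; rewrite -addr_eq0 -mulr2n mulrn_eq0 => /eqP.
  by [].
have l2 w : rho (1, 0) w = w.2 * rho (1, 0) (0, 1).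
  rewrite (rho_alt H) {1}(plane_basisE w) (rho_linl H) alt mulr0 add0r lZ.
  by rewrite (rho_alt H (0, 1)) mulrN opprK.
have l3 w : rho (0, 1) w = - w.1 * rho (1, 0) (0, 1).
  rewrite (rho_alt H) {1}(plane_basisE w) (rho_linl H) lZ alt mulr0 addr0.
  by rewrite mulNr.
by rewrite {1}(plane_basisE u) (rho_linl H) lZ (l2 v) (l3 v); ring.
Qed.

(** Positivity of [g] on d_1 forces J d_1 off the line of d_1, so the frame is a basis. The second
    component of J (J d_1) = - d_1 is (J d_1).2 times the trace of [J], which therefore vanishes. *)
Lemma J_trace : (J x (1, 0)).1 + (J x (0, 1)).2 = 0 /\ (J x (1, 0)).2 != 0.
Proof.
have g0 := gfr_gt0; have c0 : (J x (1, 0)).2 != 0.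
  apply/eqP => c0; move: g0.
  by rewrite /gfr (gE H) rho_det /= c0 mul1r mul0r subr0 mulr0 ltxx.
split=> //; have /(congr1 snd) := J_sq H (1, 0).
rewrite {1}(plane_basisE (J x (1, 0))) (J_lin H) (lin_funZ (J_lin H)) /=.
rewrite /GRing.scale /= oppr0 => /eqP.
rewrite [X in X + _]mulrC -mulrDr mulf_eq0 (negbTE c0) /= => /eqP.
by [].
Qed.

Lemma fr_surj u : exists a b, u = fr a b.
Proof.
have [_ c0] := J_trace.
exists (u.1 - u.2 / (J x (1, 0)).2 * (J x (1, 0)).1), (u.2 / (J x (1, 0)).2).
apply: injective_projections; rewrite /= /GRing.scale /= ?mulr0 ?add0r ?mulr1.
  by rewrite subrK.
by rewrite divfK.
Qed.

Lemma J_fr a b : J x (fr a b) = fr (- b) a.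
Proof.
rewrite /frv (J_lin H) (lin_funZ (J_lin H)) (J_sq H).
by rewrite scalerN addrC scaleNr.
Qed.

Lemma fmatJ : fmat (J x) 0 (-1) 1 0.
Proof. by move=> a b; rewrite J_fr; congr fr; ring. Qed.

Lemma det_fr a b c d : rho (fr a b) (fr c d) = G * (a * d - b * c).
Proof.
have [t0 _] := J_trace.
have GE : G = rho (1, 0) (0, 1) * (J x (1, 0)).2.
  by rewrite /gfr (gE H) rho_det /= mul1r mul0r subr0.
by rewrite GE rho_det /= /GRing.scale /=; ring.
Qed.

Lemma g_fr a b c d : g x (fr a b) (fr c d) = G * (a * c + b * d).
Proof. by rewrite (gE H) J_fr det_fr; ring. Qed.

Lemma fr_inj a b c d : fr a b = fr c d -> a = c /\ b = d.
Proof.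
move=> e; have H1 : g x (fr a b) (fr 1 0) = g x (fr c d) (fr 1 0) by rewrite e.
have H2 : g x (fr a b) (fr 0 1) = g x (fr c d) (fr 0 1) by rewrite e.
move: H1 H2; rewrite !g_fr => /(mulfI gfr_neq0) + /(mulfI gfr_neq0).
by rewrite !mulr1 !mulr0 !addr0 !add0r.
Qed.

Lemma g_linl c u v w : g x (c *: u + v) w = c * g x u w + g x v w.
Proof. by rewrite !(gE H) (rho_linl H). Qed.

Lemma g_sym u v : g x u v = g x v u.
Proof.
have [a [b ->]] := fr_surj u; have [c [d ->]] := fr_surj v.
by rewrite !g_fr; ring.
Qed.

Lemma fmat_exists (B : E -> E) :
  (forall c u v, B (c *: u + v) = c *: B u + B v) ->
  exists p q s t, fmat B p q s t.
Proof.
move=> lB; have [p [s e1]] := fr_surj (B (1, 0)).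
have [q [t e2]] := fr_surj (B (J x (1, 0))).
exists p, q, s, t => a b; rewrite /frv lB (lin_funZ lB) e1 e2 !frE.
by congr fr; ring.
Qed.

(** [trE] is taken in the standard basis, so d_2 is first written in the frame, dividing by the
    nonzero second component of J d_1. *)
Lemma fmat_tr B p q s t : fmat B p q s t -> trE B = p + t.
Proof.
move=> FB; have [t0 c0] := J_trace.
set a := (J x (1, 0)).1 in t0; set c := (J x (1, 0)).2 in c0.
have e1 : B (1, 0) = fr p s by rewrite -fr10 FB; congr fr; ring.
have e2E : (0, 1) = fr (- a / c) c^-1.
  apply: injective_projections; rewrite /= /GRing.scale /= ?mulr0 ?mulr1 ?add0r -/a -/c.
    by rewrite mulNr addrC mulrC subrr.
  by rewrite mulVf.
have e2 : B (0, 1) = fr (p * (- a / c) + q / c) (s * (- a / c) + t / c).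
  by rewrite e2E FB.
rewrite /trE e1 e2 /= /GRing.scale /= -/a -/c; field.
exact: c0.
Qed.

Lemma fmat_comp B1 B2 p q s t p' q' s' t' :
  fmat B1 p q s t -> fmat B2 p' q' s' t' ->
  fmat (B1 \o B2) (p * p' + q * s') (p * q' + q * t') (s * p' + t * s') (s * q' + t * t').
Proof. by move=> F1 F2 a b; rewrite /= F2 F1; congr fr; ring. Qed.

Lemma fmat_tr_comp B1 B2 p q s t p' q' s' t' :
  fmat B1 p q s t -> fmat B2 p' q' s' t' ->
  trE (B1 \o B2) = p * p' + q * s' + s * q' + t * t'.
Proof. by move=> F1 F2; rewrite (fmat_tr (fmat_comp F1 F2)); ring. Qed.

Lemma frame1_fr : frame1 g x = fr (Num.sqrt G)^-1 0.
Proof. by rewrite /frame1 /frv scale0r addr0. Qed.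

Lemma osum_fr (W : zmodType) (T : E -> W) :
  osum J g x T = T (fr (Num.sqrt G)^-1 0) + T (fr 0 (Num.sqrt G)^-1).
Proof. by rewrite /osum frame1_fr J_fr oppr0. Qed.

Lemma sqrtG_sq : (Num.sqrt G)^-1 * (Num.sqrt G)^-1 = G^-1.
Proof. by rewrite -invfM -expr2 sqr_sqrtr // ltW // gfr_gt0. Qed.

(* Matrices of an End-valued covector on the two vectors of the frame. *)
Definition format (B : E -> E -> E) (c1 c2 c3 c4 d1 d2 d3 d4 : R) : Prop :=
  forall a b, fmat (B (fr a b)) (a * c1 + b * d1) (a * c2 + b * d2)
                                (a * c3 + b * d3) (a * c4 + b * d4).

Lemma formatE B c1 c2 c3 c4 d1 d2 d3 d4 : format B c1 c2 c3 c4 d1 d2 d3 d4 ->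
  forall a b c d, B (fr a b) (fr c d) =
    fr ((a * c1 + b * d1) * c + (a * c2 + b * d2) * d)
       ((a * c3 + b * d3) * c + (a * c4 + b * d4) * d).
Proof. by move=> FB a b c d; rewrite FB. Qed.

Lemma ipA_format A B a1 a2 a3 a4 b1 b2 b3 b4 c1 c2 c3 c4 d1 d2 d3 d4 :
  format A a1 a2 a3 a4 b1 b2 b3 b4 -> format B c1 c2 c3 c4 d1 d2 d3 d4 ->
  ipA J g x A B = (a1 * c1 + a2 * c3 + a3 * c2 + a4 * c4
                 + b1 * d1 + b2 * d3 + b3 * d2 + b4 * d4) / G.
Proof.
move=> FA FB; rewrite /ipA osum_fr.
rewrite (fmat_tr_comp (FA _ _) (FB _ _)) (fmat_tr_comp (FA _ _) (FB _ _)).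
have <- := sqrtG_sq; ring.
Qed.

Lemma format_exists (B : E -> E -> E) :
  (forall c u v w, B (c *: u + v) w = c *: B u w + B v w) ->
  (forall c u v w, B w (c *: u + v) = c *: B w u + B w v) ->
  exists c1 c2 c3 c4 d1 d2 d3 d4, format B c1 c2 c3 c4 d1 d2 d3 d4.
Proof.
move=> l1 l2.
have [c1 [c2 [c3 [c4 F1]]]] := fmat_exists (fun c u v => l2 c u v (1, 0)).
have [d1 [d2 [d3 [d4 F2]]]] := fmat_exists (fun c u v => l2 c u v (J x (1, 0))).
exists c1, c2, c3, c4, d1, d2, d3, d4 => a b c d.
rewrite {1}/frv l1 (lin_funZ (fun k u v => l1 k u v (fr c d))) F1 F2 !frE.
by congr fr; ring.
Qed.

Lemma formatJ B c1 c2 c3 c4 d1 d2 d3 d4 : format B c1 c2 c3 c4 d1 d2 d3 d4 ->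
  format (fun X u => B X (J x u)) c2 (- c1) c4 (- c3) d2 (- d1) d4 (- d3).
Proof. by move=> FB a b c d; rewrite J_fr (formatE FB); congr fr; ring. Qed.

(* A = g^-1 Re(q) for a cubic form q whose value on the first frame vector is
   proportional to a - i b. *)
Definition cubic_format A (a b : R) : Prop := format A a b b (- a) b (- a) (- a) (- b).

(** A trace-free symmetric endomorphism A(d_1) has two free entries, and A(JX) = A(X)J then
    determines A(J d_1). *)
Lemma cubic_format_exists (A : E -> E -> E) :
  (forall c u v w, A (c *: u + v) w = c *: A u w + A v w) ->
  (forall c u v w, A w (c *: u + v) = c *: A w u + A w v) ->
  (forall X, trE (A X) = 0) ->
  (forall X u v, g x (A X u) v = g x u (A X v)) ->
  (forall X Y, A (J x X) Y = A X (J x Y)) ->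
  exists a b, cubic_format A a b.
Proof.
move=> l1 l2 tr0 sym AJ; have [c1 [c2 [c3 [c4 [d1 [d2 [d3 [d4 F]]]]]]]] := format_exists l1 l2.
have e4 : c4 = - c1.
  have := tr0 (fr 1 0); rewrite (fmat_tr (F 1 0)) => e; lra.
have e3 : c3 = c2.
  have := sym (fr 1 0) (fr 1 0) (fr 0 1); rewrite !(formatE F) !g_fr => /(mulfI gfr_neq0).
  by move=> e; lra.
have e5 c d := AJ (fr 1 0) (fr c d); have := e5 1 0; have := e5 0 1.
rewrite !J_fr !(formatE F) => /fr_inj [e6 e7] /fr_inj [e8 e9].
exists c1, c2 => a b c d; rewrite (formatE F) e3 e4.
have -> : d1 = c2 by lra.
have -> : d2 = - c1 by lra.
have -> : d3 = - c1 by lra.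
by have -> : d4 = - c2 by lra.
Qed.

Lemma format_lin1 B c1 c2 c3 c4 d1 d2 d3 d4 : format B c1 c2 c3 c4 d1 d2 d3 d4 ->
  forall c u v w, B (c *: u + v) w = c *: B u w + B v w.
Proof.
move=> F c u v w; have [a [b ->]] := fr_surj u; have [a' [b' ->]] := fr_surj v.
by have [e [h ->]] := fr_surj w; rewrite !frE !(formatE F) !frE; congr fr; ring.
Qed.

Lemma format_lin2 B c1 c2 c3 c4 d1 d2 d3 d4 : format B c1 c2 c3 c4 d1 d2 d3 d4 ->
  forall c u v w, B w (c *: u + v) = c *: B w u + B w v.
Proof.
move=> F c u v w; have [a [b ->]] := fr_surj u; have [a' [b' ->]] := fr_surj v.
by have [e [h ->]] := fr_surj w; rewrite !frE !(formatE F) !frE; congr fr; ring.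
Qed.

Lemma cubic_format_algebra A a b : cubic_format A a b ->
  [/\ forall X, trE (A X) = 0, forall X u v, g x (A X u) v = g x u (A X v)
    & forall X Y, A (J x X) Y = A X (J x Y) /\ A X Y = A Y X].
Proof.
move=> F; split.
- by move=> X; have [c [d ->]] := fr_surj X; rewrite (fmat_tr (F _ _)); ring.
- move=> X u v; have [c [d ->]] := fr_surj X; have [e [h ->]] := fr_surj u.
  by have [e' [h' ->]] := fr_surj v; rewrite !(formatE F) !g_fr; ring.
- move=> X Y; have [c [d ->]] := fr_surj X; have [e [h ->]] := fr_surj Y.
  by rewrite !J_fr !(formatE F); split; congr fr; ring.
Qed.

(** In the plane, anticommuting with [J] is the same as being symmetric and trace-free in the
    frame. *)
Definition Jdot_format V1 (m n : R) : Prop := fmat V1 m n n (- m).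

(* Total symmetry and the trace condition leave two free parameters k and l; t1 and
   t2 are half the traces of V2 on the two frame vectors. *)
Definition Adot_format a b V2 (m n k l : R) : Prop :=
  let t1 := a * n - b * m in let t2 := b * n + a * m in
  format V2 k l l (2 * t1 - k) l (2 * t1 - k) (2 * t1 - k) (2 * t2 - l).

Lemma Jdot_format_exists (V1 : E -> E) :
  (forall c u v, V1 (c *: u + v) = c *: V1 u + V1 v) ->
  (forall u, V1 (J x u) + J x (V1 u) = 0) ->
  exists m n, Jdot_format V1 m n.
Proof.
move=> l1 a0; have [p [q [s [t F]]]] := fmat_exists l1.
have := a0 (fr 1 0); rewrite J_fr !F J_fr frD -[RHS]fr00.
move=> /fr_inj [e1 e2].
exists p, q => a b; rewrite F.
have -> : s = q by lra.
by have -> : t = - p by lra.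
Qed.

Lemma Adot_format_exists A V1 (V2 : E -> E -> E) a b m n :
  cubic_format A a b -> Jdot_format V1 m n ->
  (forall c u v w, V2 (c *: u + v) w = c *: V2 u w + V2 v w) ->
  (forall c u v w, V2 w (c *: u + v) = c *: V2 w u + V2 w v) ->
  (forall X Y Z, g x (V2 X Y) Z = g x (V2 Y X) Z /\ g x (V2 X Y) Z = g x (V2 X Z) Y) ->
  (forall X, trE (V2 X) = trE (J x \o A X \o V1)) ->
  exists k l, Adot_format a b V2 m n k l.
Proof.
move=> FA FV l1 l2 sym tr.
have [c1 [c2 [c3 [c4 [d1 [d2 [d3 [d4 F]]]]]]]] := format_exists l1 l2.
have FJA X Y := fmat_comp (fmat_comp fmatJ (FA X Y)) FV.
have e1 := tr (fr 1 0); have e2 := tr (fr 0 1).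
rewrite (fmat_tr (F _ _)) (fmat_tr (FJA _ _)) in e1.
rewrite (fmat_tr (F _ _)) (fmat_tr (FJA _ _)) in e2.
have s1 := proj1 (sym (fr 1 0) (fr 0 1) (fr 1 0)).
have s2 := proj1 (sym (fr 1 0) (fr 0 1) (fr 0 1)).
have s3 := proj2 (sym (fr 1 0) (fr 1 0) (fr 0 1)).
have s4 := proj2 (sym (fr 0 1) (fr 1 0) (fr 0 1)).
move: s1 s2 s3 s4; rewrite !(formatE F) !g_fr.
move=> /(mulfI gfr_neq0) s1 /(mulfI gfr_neq0) s2 /(mulfI gfr_neq0) s3 /(mulfI gfr_neq0) s4.
exists c1, c2; rewrite /Adot_format.
have -> : 2 * (a * n - b * m) - c1 = c4 by lra.
have -> : 2 * (b * n + a * m) - c2 = d4 by lra.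
have e3 : c3 = c2 by lra.
have e4 : d1 = c2 by lra.
have e5 : d2 = c4 by lra.
have e6 : d3 = c4 by lra.
by move: F; rewrite e3 e4 e5 e6.
Qed.

Lemma Adot_format_algebra A V1 V2 a b m n k l : cubic_format A a b ->
  Jdot_format V1 m n -> Adot_format a b V2 m n k l ->
  (forall X Y Z, g x (V2 X Y) Z = g x (V2 Y X) Z /\ g x (V2 X Y) Z = g x (V2 X Z) Y) /\
  (forall X, trE (V2 X) = trE (J x \o A X \o V1)).
Proof.
move=> FA F1 F2; split.
  move=> X Y Z; have [c [d ->]] := fr_surj X; have [e [h ->]] := fr_surj Y.
  by have [e' [h' ->]] := fr_surj Z; rewrite !(formatE F2) !g_fr; split; ring.
move=> X; have [c [d ->]] := fr_surj X.
by rewrite (fmat_tr (F2 _ _)) (fmat_tr (fmat_comp (fmat_comp fmatJ (FA c d)) F1)); ring.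
Qed.

End At.
End Frame.

(** * Levi-Civita calculus in a chart *)

Ltac vec := apply: injective_projections; rewrite /= /GRing.scale /=; ring.

Section LinearApplication.
Variable R : realType.

Lemma scaler_comb2 (V : lmodType R) (c k1 k2 l1 l2 : R) (e1 e2 : V) :
  (c * k1 + k2) *: e1 + (c * l1 + l2) *: e2 =
  c *: (k1 *: e1 + l1 *: e2) + (k2 *: e1 + l2 *: e2).
Proof. by rewrite !scalerDl scalerDr !scalerA addrACA. Qed.

Lemma scaler_comb3 (V : lmodType R) (c : R) (a1 a2 b1 b2 d1 d2 : V) :
  c *: a1 + a2 + (c *: b1 + b2) - (c *: d1 + d2) =
  c *: (a1 + b1 - d1) + (a2 + b2 - d2).
Proof. by rewrite addrACA -scalerDr opprD addrACA -scalerN -scalerDr. Qed.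

Local Notation E := (R * R)%type.

Lemma scaler_comb4 (V : lmodType R) (c : R) (a1 a2 b1 b2 d1 d2 e1 e2 : V) :
  c *: a1 + a2 + (c *: b1 + b2) - (c *: d1 + d2) - (c *: e1 + e2) =
  c *: (a1 + b1 - d1 - e1) + (a2 + b2 - d2 - e2).
Proof. by rewrite scaler_comb3 opprD addrACA -scalerN -scalerDr. Qed.

(** The cancellation behind [nabla_form_rot]. There [b1] is B X (J (nabla_u v)); it arises once from
    the derivative of [J] and once from the rotated last term. *)
Lemma rot_comb (c s : R) (d1 d2 b1 b2 l1 l2 m1 m2 n1 : R * R) :
  c *: d1 - s *: (d2 + (b1 - b2)) + (c *: l1 + - (s *: l2)) - (c *: m1 - s *: m2)
    - (c *: n1 - s *: b1) =
  c *: (d1 + l1 - m1 - n1) - s *: (d2 + l2 - m2 - b2).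
Proof. by vec. Qed.

Lemma addr_cancel3 (V : zmodType) (a b c : V) : - a - b - c + (a + c + b) = 0.
Proof. by rewrite -!opprD [a + c + b]addrAC addNr. Qed.

Lemma lin_funE (W : lmodType R) (B : E -> W) :
  (forall (c : R) u v, B (c *: u + v) = c *: B u + B v) ->
  forall u : E, B u = u.1 *: B (1, 0) + u.2 *: B (0, 1).
Proof. by move=> lB u; rewrite {1}(plane_basisE u) lB (lin_funZ lB). Qed.

(** The derivative of [B] is known only on constant vectors. Expanding [Y] in the standard basis
    reduces the claim to the product rule for scalars. *)
Lemma is_derive_lin_appR (V : normedModType R) (U : set V) (B : V -> E -> R)
    (Y : V -> E) x v (dB : E -> R) dY : open U -> U x ->
  (forall y, U y -> forall (c : R) u w, B y (c *: u + w) = c * B y u + B y w) ->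
  (forall a, is_derive x v (fun y => B y a) (dB a)) -> is_derive x v Y dY ->
  is_derive x v (fun y => B y (Y y)) (dB (Y x) + B x dY).
Proof.
move=> oU Ux lB HB HY.
have BE y : U y -> forall u : E, B y u = u.1 * B y (1, 0) + u.2 * B y (0, 1).
  by move=> Uy; exact: (lin_funE (lB y Uy)).
have HY1 := is_derive_fst HY; have HY2 := is_derive_snd HY.
(* Linearity of [dB] follows from that of [B] by uniqueness of derivatives. *)
have dBE : dB (Y x) = (Y x).1 * dB (1, 0) + (Y x).2 * dB (0, 1).
  have H1 : is_derive x v (fun y => B y (Y x))
      (0 * B x (1, 0) + (Y x).1 * dB (1, 0) + (0 * B x (0, 1) + (Y x).2 * dB (0, 1))).
    apply: (@is_derive_near _ _ _ (fun y => (Y x).1 * B y (1, 0) + (Y x).2 * B y (0, 1)) _ U) => //.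
      by move=> y Uy; rewrite [RHS]BE.
    by apply: is_deriveD_fun; apply: is_deriveM_fun; try exact: HB; exact: is_derive_cst.
  have [_ <-] := HB (Y x); have [_ ->] := H1.
  by rewrite !mul0r !add0r.
apply: (@is_derive_near _ _ _ (fun y => (Y y).1 * B y (1, 0) + (Y y).2 * B y (0, 1)) _ U) => //.
  by move=> y Uy; rewrite [RHS]BE.
have H2 := is_deriveD_fun (is_deriveM_fun HY1 (HB (1, 0))) (is_deriveM_fun HY2 (HB (0, 1))).
apply: (is_derive_eq H2); rewrite dBE (BE _ Ux dY); ring.
Qed.

Lemma is_derive_lin_app (V : normedModType R) (U : set V) (B : V -> E -> E)
    (Y : V -> E) x v (dB : E -> E) dY : open U -> U x ->
  (forall y, U y -> forall (c : R) u w, B y (c *: u + w) = c *: B y u + B y w) ->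
  (forall a, is_derive x v (fun y => B y a) (dB a)) -> is_derive x v Y dY ->
  is_derive x v (fun y => B y (Y y)) (dB (Y x) + B x dY).
Proof.
move=> oU Ux lB HB HY.
have -> : (fun y => B y (Y y)) = (fun y => ((B y (Y y)).1, (B y (Y y)).2)).
  by apply/funext => y; case: (B y (Y y)).
have -> : dB (Y x) + B x dY = ((dB (Y x)).1 + (B x dY).1, (dB (Y x)).2 + (B x dY).2) by [].
apply: is_derive_pair.
  apply: (@is_derive_lin_appR _ U (fun y a => (B y a).1) Y x v (fun a => (dB a).1)) => //.
    by move=> y Uy c u w; rewrite lB.
  by move=> a; exact: is_derive_fst (HB a).
apply: (@is_derive_lin_appR _ U (fun y a => (B y a).2) Y x v (fun a => (dB a).2)) => //.
  by move=> y Uy c u w; rewrite lB.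
by move=> a; exact: is_derive_snd (HB a).
Qed.

Lemma smooth_on_lin_appR (V : normedModType R) (U : set V) (B : V -> E -> R) (Y : V -> E) :
  open U ->
  (forall y, U y -> forall (c : R) u w, B y (c *: u + w) = c * B y u + B y w) ->
  (forall a, smooth_on U (fun y => B y a)) -> smooth_on U Y ->
  smooth_on U (fun y => B y (Y y)).
Proof.
move=> oU lB sB sY.
apply: (@smooth_on_eq _ _ _ U (fun y => (Y y).1 * B y (1, 0) + (Y y).2 * B y (0, 1))) => //.
  by move=> y Uy; rewrite [RHS](lin_funE (lB y Uy)).
by apply: smooth_onD => //; apply: smooth_onM => //; [exact: smooth_on_fst|exact: smooth_on_snd].
Qed.

Lemma smooth_on_lin_app (V : normedModType R) (U : set V) (B : V -> E -> E) (Y : V -> E) :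
  open U ->
  (forall y, U y -> forall (c : R) u w, B y (c *: u + w) = c *: B y u + B y w) ->
  (forall a, smooth_on U (fun y => B y a)) -> smooth_on U Y ->
  smooth_on U (fun y => B y (Y y)).
Proof.
move=> oU lB sB sY.
have -> : (fun y => B y (Y y)) = (fun y => ((B y (Y y)).1, (B y (Y y)).2)).
  by apply/funext => y; case: (B y (Y y)).
apply: smooth_on_pair => //.
  apply: (@smooth_on_lin_appR _ U (fun y a => (B y a).1)) => //.
    by move=> y Uy c u w; rewrite lB.
  by move=> a; exact: (smooth_on_fst oU (sB a)).
apply: (@smooth_on_lin_appR _ U (fun y a => (B y a).2)) => //.
  by move=> y Uy c u w; rewrite lB.
by move=> a; exact: (smooth_on_snd oU (sB a)).
Qed.

Lemma smooth_on_cstE (V W : normedModType R) (U : set V) (c : W) : smooth_on U (fun=> c).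
Proof.
move=> vs x Ux; suff [d ->] : exists d : W, iter_derive vs (fun=> c) = (fun=> d).
  by split=> [v|]; [exact: derivable_cst|exact: cvg_cst].
elim: vs => [|v vs [d IH]]; first by exists c.
by exists 0; rewrite /= IH; apply/funext => y; exact: derive_cst.
Qed.

End LinearApplication.

(** * Levi-Civita connection of a metric compatible with J *)

Section LeviCivita.
Variable R : realType.
Local Notation E := (R * R)%type.
Variables (U : set E) (J : E -> E -> E) (g : E -> E -> E -> R) (rho : E -> E -> E -> R).
Hypothesis oU : open U.
Hypothesis herm : forall x, U x -> hermitian_at x J g (rho x).
Hypothesis sJ : forall u, smooth_on U (fun y => J y u).
Hypothesis srho : forall u v, smooth_on U (fun y => rho y u v).

Lemma smooth_g u v : smooth_on U (fun y => g y u v).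
Proof.
apply: (@smooth_on_eq _ _ _ U (fun y => rho y u (J y v))) => //.
  by move=> y Uy; rewrite (gE (herm Uy)).
apply: (@smooth_on_lin_appR _ _ U (fun y b => rho y u b) (fun y => J y v)) => // y Uy c a b.
by rewrite (rho_alt (herm Uy)) (rho_linl (herm Uy)) !(rho_alt (herm Uy) _ u); ring.
Qed.

Section AtPoint.
Variable x : E.
Hypothesis Ux : U x.
Let H := herm Ux.

Definition Dg u v w := 'D_u (fun y => g y v w) x.

Lemma is_derive_g u v w : is_derive x u (fun y => g y v w) (Dg u v w).
Proof. exact: (smooth_on_is_derive u (smooth_g v w) Ux). Qed.

Lemma g_linr y : U y -> forall c u v w, g y w (c *: u + v) = c * g y w u + g y w v.
Proof.
by move=> Uy c u v w; rewrite (g_sym (herm Uy)) (g_linl (herm Uy)) !(g_sym (herm Uy) _ w).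
Qed.

Lemma Dg_lin1 c u u' v w : Dg (c *: u + u') v w = c * Dg u v w + Dg u' v w.
Proof. exact: derive_linear (smooth_on_diff oU Ux (smooth_g v w)). Qed.

Lemma Dg_lin2 c u v v' w : Dg u (c *: v + v') w = c * Dg u v w + Dg u v' w.
Proof.
have <- : 0 * g x v w + c * Dg u v w + Dg u v' w = c * Dg u v w + Dg u v' w by rewrite mul0r add0r.
apply: derive_val; apply: (@is_derive_near _ _ _ (fun y => c * g y v w + g y v' w) _ U) => //.
  by move=> y Uy; rewrite (g_linl (herm Uy)).
apply: is_deriveD_fun; last exact: is_derive_g.
exact: (is_deriveM_fun (is_derive_cst c x u) (is_derive_g _ _ _)).
Qed.

Lemma Dg_sym u v w : Dg u v w = Dg u w v.
Proof. exact: (derive_near u oU Ux (fun y Uy => g_sym (herm Uy) v w)). Qed.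

Lemma Dg_lin3 c u v w w' : Dg u v (c *: w + w') = c * Dg u v w + Dg u v w'.
Proof. by rewrite Dg_sym Dg_lin2 !(Dg_sym u _ v). Qed.

Lemma koszulE u v w : koszul g x u v w = 2^-1 * (Dg u v w + Dg v u w - Dg w u v).
Proof. by []. Qed.

Lemma koszul_linw c u v w w' :
  koszul g x u v (c *: w + w') = c * koszul g x u v w + koszul g x u v w'.
Proof. rewrite !koszulE !Dg_lin3 Dg_lin1; move: (Dg u v w) (Dg u v w') (Dg v u w) (Dg v u w').
by move: (Dg w u v) (Dg w' u v) => *; ring. Qed.

Lemma koszul_linu c u u' v w :
  koszul g x (c *: u + u') v w = c * koszul g x u v w + koszul g x u' v w.
Proof. rewrite !koszulE Dg_lin1 !Dg_lin2; move: (Dg u v w) (Dg u' v w) (Dg v u w) (Dg v u' w).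
by move: (Dg w u v) (Dg w u' v) => *; ring. Qed.

Lemma koszul_sym u v w : koszul g x u v w = koszul g x v u w.
Proof. by rewrite !koszulE (Dg_sym w); ring. Qed.

Lemma LC_sym u v : LC J g x u v = LC J g x v u.
Proof. by rewrite /LC /osum !(koszul_sym u v). Qed.

Lemma LC_linl c u u' v : LC J g x (c *: u + u') v = c *: LC J g x u v + LC J g x u' v.
Proof.
by rewrite /LC /osum !koszul_linu; exact: scaler_comb2.
Qed.

Lemma LC_linr c u v v' : LC J g x u (c *: v + v') = c *: LC J g x u v + LC J g x u v'.
Proof. by rewrite LC_sym LC_linl !(LC_sym _ u). Qed.

(** [LC] is the expansion of the Koszul functional in an orthonormal frame; since that functional is
    linear in [w], pairing with [w] recovers it. *)
Lemma g_LC u v w : g x (LC J g x u v) w = koszul g x u v w.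
Proof.
have k0 : (Num.sqrt (gfr g x))^-1 != 0.
  by rewrite invr_eq0 gt_eqF // sqrtr_gt0 (gfr_gt0 H).
have k2 := sqrtG_sq H; rewrite /LC (osum_fr H).
set k := (Num.sqrt _)^-1 in k0 k2 *; have [a [b ->]] := fr_surj H w.
have -> : frv J x a b = (a / k) *: frv J x k 0 + (b / k) *: frv J x 0 k.
  by rewrite !frE; congr frv; field.
rewrite (koszul_linw (a / k) u v (frv J x k 0)).
rewrite (lin_funZ (fun c => koszul_linw c u v) (b / k) (frv J x 0 k)).
move: (koszul g x u v (frv J x k 0)) (koszul g x u v (frv J x 0 k)) => k1 k3.
rewrite !frE !(g_fr H) /GRing.scale /=.
have -> : gfr g x = (k * k)^-1 by rewrite k2 invrK.
by field.
Qed.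

Lemma nabla_g u v w : Dg u v w = g x (LC J g x u v) w + g x v (LC J g x u w).
Proof. by rewrite (g_sym H v) !g_LC !koszulE (Dg_sym u w v); field. Qed.

Definition DJ u v := 'D_u (fun y => J y v) x.

Lemma is_derive_J u v : is_derive x u (fun y => J y v) (DJ u v).
Proof. exact: (smooth_on_is_derive u (sJ v) Ux). Qed.

(** In dimension two a compatible [J] is parallel. Differentiating J^2 = - 1 shows that nabla_u J
    anticommutes with [J], hence is symmetric and trace-free; differentiating the skewness of [J]
    for [g] shows that it is skew. Only zero is both. *)
Lemma nabla_J u v : DJ u v + LC J g x u (J x v) - J x (LC J g x u v) = 0.
Proof.
pose K v := DJ u v + LC J g x u (J x v) - J x (LC J g x u v).
have DJl c v1 v2 : DJ u (c *: v1 + v2) = c *: DJ u v1 + DJ u v2.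
  apply: derive_val; apply: (@is_derive_near _ _ _ (fun y => c *: J y v1 + J y v2) _ U) => //.
    by move=> y Uy; rewrite (J_lin (herm Uy)).
  apply: is_deriveD_fun; last exact: is_derive_J.
  by have := is_derive_J u v1; exact: is_deriveZ.
have Kl c v1 v2 : K (c *: v1 + v2) = c *: K v1 + K v2.
  by rewrite /K DJl (J_lin H) !LC_linr (J_lin H) scaler_comb3.
have KJ v1 : K (J x v1) + J x (K v1) = 0.
  have d1 : is_derive x u (fun y => J y (J y v1)) (DJ u (J x v1) + J x (DJ u v1)).
    exact: (@is_derive_lin_app _ _ U J (fun y => J y v1) x u (DJ u) (DJ u v1) oU Ux
      (fun y Uy => J_lin (herm Uy)) (is_derive_J u) (is_derive_J u v1)).
  have e1 : DJ u (J x v1) + J x (DJ u v1) = 0.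
    have [_ <-] := d1; rewrite (derive_near (g := fun=> - v1) _ oU Ux).
      exact: derive_cst.
    by move=> y Uy; rewrite (J_sq (herm Uy)).
  have e2 : DJ u (J x v1) = - J x (DJ u v1) by apply/eqP; rewrite -addr_eq0 e1.
  rewrite /K (J_sq H v1) (lin_funN (fun c => LC_linr c u) v1) e2.
  move: (LC J g x u v1) (LC J g x u (J x v1)) (DJ u v1) => L1 L2 D1.
  rewrite !(lin_funD (J_lin H)) (lin_funN (J_lin H)) (J_sq H) opprK.
  exact: addr_cancel3.
have Kas v1 w : g x (K v1) w = - g x v1 (K w).
  have d1 a b : is_derive x u (fun y => g y (J y a) b) (Dg u (J x a) b + g x (DJ u a) b).
    exact: (@is_derive_lin_appR _ _ U (fun y c => g y c b) (fun y => J y a) x u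
      (fun c => Dg u c b) (DJ u a) oU Ux
      (fun y Uy c a1 a2 => g_linl (herm Uy) c a1 a2 b)
      (fun c => is_derive_g u c b) (is_derive_J u a)).
  have e1 : Dg u (J x v1) w + g x (DJ u v1) w = - (Dg u (J x w) v1 + g x (DJ u w) v1).
    have [_ <-] := d1 v1 w; have [_ <-] := is_deriveN_fun (d1 w v1).
    suff Eg y : U y -> g y (J y v1) w = - g y (J y w) v1.
      exact: (derive_near u oU Ux Eg).
    move=> Uy; have [a [b ->]] := fr_surj (herm Uy) v1; have [c [d ->]] := fr_surj (herm Uy) w.
    by rewrite !(J_fr (herm Uy)) !(g_fr (herm Uy)); ring.
  rewrite !nabla_g in e1.
  have gD a b c : g x (a + b) c = g x a c + g x b c.
    exact: (lin_funD (fun k p q => g_linl H k p q c)).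
  have gN a c : g x (- a) c = - g x a c.
    exact: (lin_funN (fun k p q => g_linl H k p q c)).
  have gJ a b : g x (J x a) b = - g x a (J x b).
    have [p [q ->]] := fr_surj H a; have [r [s ->]] := fr_surj H b.
    by rewrite !(J_fr H) !(g_fr H); ring.
  move: e1; rewrite /K.
  move: (LC J g x u (J x v1)) (LC J g x u (J x w)) (LC J g x u v1) (LC J g x u w).
  move: (DJ u v1) (DJ u w) => D1 D2 L1 L2 L3 L4.
  rewrite (g_sym H (J x v1) L4) (g_sym H (J x w) L3) (g_sym H v1) !gD !gN !gJ.
  move: (g x L1 w) (g x L4 (J x v1)) (g x D1 w) (g x L2 v1) (g x L3 (J x w)) (g x D2 v1).
  by move=> a1 a2 a3 a4 a5 a6 e1; lra.
have [p [q [s [t F]]]] := fmat_exists H Kl.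
have := KJ (frv J x 1 0); rewrite (J_fr H) !F (J_fr H) frE -[RHS](fr00 x J) => /(fr_inj H) [e1 e2].
have := Kas (frv J x 1 0) (frv J x 0 1); have := Kas (frv J x 1 0) (frv J x 1 0).
rewrite !F !(g_fr H) -!mulrN => /(mulfI (gfr_neq0 H)) e3 /(mulfI (gfr_neq0 H)) e4.
have [a [b vE]] := fr_surj H v.
rewrite -/(K v) vE F -(fr00 x J); congr frv.
  have -> : p = 0 by lra.
  have -> : q = 0 by lra.
  by ring.
have -> : s = 0 by lra.
have -> : t = 0 by lra.
by ring.
Qed.

Section NablaForm.
Variable B : E -> E -> E -> E.
Hypothesis B_lin1 : forall y, U y -> forall c u v w, B y (c *: u + v) w = c *: B y u w + B y v w.
Hypothesis B_lin2 : forall y, U y -> forall c u v w, B y w (c *: u + v) = c *: B y w u + B y w v.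
Hypothesis sB : forall X u, smooth_on U (fun y => B y X u).

Definition DB u X v := 'D_u (fun y => B y X v) x.

Lemma is_derive_B u X v : is_derive x u (fun y => B y X v) (DB u X v).
Proof. exact: (smooth_on_is_derive u (sB X v) Ux). Qed.

Lemma DB_lin1 u c X X' v : DB u (c *: X + X') v = c *: DB u X v + DB u X' v.
Proof.
apply: derive_val.
apply: (is_derive_near oU Ux (f := fun y => c *: B y X v + B y X' v)).
  by move=> y Uy; rewrite B_lin1.
apply: is_deriveD_fun; last exact: is_derive_B.
by have := is_derive_B u X v; exact: is_deriveZ.
Qed.

Lemma DB_lin2 u c X v v' : DB u X (c *: v + v') = c *: DB u X v + DB u X v'.
Proof.
apply: derive_val.
apply: (is_derive_near oU Ux (f := fun y => c *: B y X v + B y X v')).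
  by move=> y Uy; rewrite B_lin2.
apply: is_deriveD_fun; last exact: is_derive_B.
by have := is_derive_B u X v; exact: is_deriveZ.
Qed.

Lemma nabla_formE u X v : nabla_form J g B x u X v =
  DB u X v + LC J g x u (B x X v) - B x (LC J g x u X) v - B x X (LC J g x u v).
Proof. by []. Qed.

Lemma nabla_form_lin1 u c X X' v : nabla_form J g B x u (c *: X + X') v =
  c *: nabla_form J g B x u X v + nabla_form J g B x u X' v.
Proof.
rewrite !nabla_formE DB_lin1 (B_lin1 Ux c X X' v) (B_lin1 Ux c X X' (LC J g x u v)).
rewrite (LC_linr c u (B x X v)) (LC_linr c u X X') (B_lin1 Ux c (LC J g x u X)).
exact: scaler_comb4.
Qed.

Lemma nabla_form_lin2 u c X v v' : nabla_form J g B x u X (c *: v + v') =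
  c *: nabla_form J g B x u X v + nabla_form J g B x u X v'.
Proof.
rewrite !nabla_formE DB_lin2 (B_lin2 Ux c v v' X) (B_lin2 Ux c v v' (LC J g x u X)).
rewrite (LC_linr c u (B x X v)) (LC_linr c u v v') (B_lin2 Ux c (LC J g x u v)).
exact: scaler_comb4.
Qed.

(** As [J] is parallel and [c], [s] are constant, the covariant derivative commutes with right
    multiplication by c - s J. Every invariance of a differential equation under the circle rests on
    this; [c = 0], [s = - 1] gives plain multiplication by [J]. *)
Lemma nabla_form_rot (B' : E -> E -> E -> E) (c s : R) :
  (forall y, U y -> forall X u, B' y X u = c *: B y X u - s *: B y X (J y u)) ->
  forall u X v, nabla_form J g B' x u X v =
    c *: nabla_form J g B x u X v - s *: nabla_form J g B x u X (J x v).
Proof.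
move=> HB' u X v; rewrite /(nabla_form J g B' _ _ _ _) !(HB' x Ux).
have dB' : 'D_u (fun y => B' y X v) x =
    c *: DB u X v - s *: (DB u X (J x v) + B x X (DJ u v)).
  apply: derive_val.
  apply: (is_derive_near oU Ux (f := fun y => c *: B y X v - s *: B y X (J y v))).
    by move=> y Uy; rewrite (HB' y Uy).
  apply: is_deriveB_fun; first by have := is_derive_B u X v; exact: is_deriveZ.
  have := (@is_derive_lin_app _ _ U (fun y => B y X) (fun y => J y v) x u (DB u X) (DJ u v) oU Ux
      (fun y Uy c a b => B_lin2 Uy c a b X) (is_derive_B u X) (is_derive_J u v)).
  exact: is_deriveZ.
have DJE : DJ u v = J x (LC J g x u v) - LC J g x u (J x v).
  by apply/eqP; rewrite -subr_eq0 opprB addrA; apply/eqP; exact: nabla_J.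
rewrite dB' DJE !nabla_formE.
have l2 := B_lin2 Ux; rewrite (lin_funD (fun c a b => l2 c a b X)) (lin_funN (fun c a b => l2 c a b X)).
rewrite (lin_funD (fun k => LC_linr k u)) (lin_funN (fun k => LC_linr k u)) !(lin_funZ (fun k => LC_linr k u)).
exact: rot_comb.
Qed.

End NablaForm.

End AtPoint.
End LeviCivita.

(** * Locality of the Gauss curvature *)

Section GaussCongruence.
Variable R : realType.
Local Notation E := (R * R)%type.
Variables (U : set E) (J : E -> E -> E) (h h' : E -> E -> E -> R).
Hypothesis oU : open U.
Hypothesis hh' : forall y, U y -> forall u v, h y u v = h' y u v.

Lemma koszul_near x u v w : U x -> koszul h x u v w = koszul h' x u v w.
Proof.
move=> Ux; rewrite /koszul (derive_near u oU Ux (fun y Uy => hh' Uy v w)).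
rewrite (derive_near v oU Ux (fun y Uy => hh' Uy u w)).
by rewrite (derive_near w oU Ux (fun y Uy => hh' Uy u v)).
Qed.

Lemma frame1_near x : U x -> frame1 h x = frame1 h' x.
Proof. by move=> Ux; rewrite /frame1 hh'. Qed.

Lemma LC_near x u v : U x -> LC J h x u v = LC J h' x u v.
Proof. by move=> Ux; rewrite /LC /osum frame1_near // !koszul_near. Qed.

Lemma riem_near x u v w : U x -> riem J h x u v w = riem J h' x u v w.
Proof.
move=> Ux; rewrite /riem (LC_near v w Ux) (LC_near u w Ux) (LC_near u _ Ux) (LC_near v _ Ux).
rewrite (derive_near u oU Ux (fun y Uy => LC_near v w Uy)).
by rewrite (derive_near v oU Ux (fun y Uy => LC_near u w Uy)).
Qed.

Lemma gaussK_near x : U x -> gaussK J h x = gaussK J h' x.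
Proof. by move=> Ux; rewrite /gaussK hh' // riem_near // frame1_near. Qed.

End GaussCongruence.

(** * Invariance under the circle action *)

Section SurfaceTensors.
Variables (R : realType) (M : ptopologicalType) (S : oriented_atlas R M).
Local Notation E := (R * R)%type.
Implicit Types (i j : chart S) (x : E) (p : pairJA S).

Lemma img_open i : open (img i).
Proof. exact: image_open. Qed.

Lemma overlap_img i j x : overlap i j x -> img i x.
Proof. by move=> [m [im jm] <-]; exists m. Qed.

Lemma overlap_open i j : open (overlap i j).
Proof.
rewrite openE => _ [m [im jm] <-].
have imgm : img i (Defs.coord i m) by exists m.
have n1 : \forall y \near Defs.coord i m, img i y.
  by apply: open_nbhs_nbhs; split=> //; exact: img_open.
have n2 : \forall y \near Defs.coord i m, dom j (param i y).
  apply: (param_continuous imgm); rewrite coordK //.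
  by apply: open_nbhs_nbhs; split=> //; exact: dom_open.
apply: filterS2 n1 n2 => _ [m' im' <-]; rewrite coordK // => jm'.
by exists m'.
Qed.

Lemma trans_smooth i j : smooth_on (overlap i j) (trans i j).
Proof. exact: transition_smooth. Qed.

Lemma trans_diff i j x : overlap i j x -> differentiable (trans i j) x.
Proof. by move=> ox; exact: (smooth_on_diff2 (overlap_open (i:=i) (j:=j)) ox (@trans_smooth i j)). Qed.

Variable rho : form2 S.

Section Pointwise.
Hypothesis rho_area : is_area_form rho.

Lemma in_D3_herm p i x : in_D3 rho p -> img i x ->
  hermitian_at x (p.1 i) (gJ rho p i) (rho i x).
Proof.
move=> [[lJ _ _] _ Dp] ix; have [JJ pos _ _ _] := Dp i x ix.
have [rl ra _ _ _] := rho_area.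
by split=> //; [exact: rl|exact: ra|exact: lJ].
Qed.

Lemma in_D3_format p i x : in_D3 rho p -> img i x ->
  exists a b, cubic_format x (p.1 i) (p.2 i x) a b.
Proof.
move=> Dp ix; have H := in_D3_herm Dp ix.
have [_ [lA _ _] Ap] := Dp; have [_ _ tr0 sym AJ] := Ap i x ix.
apply: (cubic_format_exists H) => //.
- by move=> c u v w; case: (lA i x ix c u v w).
- by move=> c u v w; case: (lA i x ix c u v w).
- by move=> X Y; case: (AJ X Y).
Qed.

Lemma tangent_D3_format p v i x a b : in_D3 rho p -> tangent_D3 rho p v -> img i x ->
  cubic_format x (p.1 i) (p.2 i x) a b ->
  exists m n k l, Jdot_format x (p.1 i) (v.1 i x) m n /\
    Adot_format x (p.1 i) a b (v.2 i x) m n k l.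
Proof.
move=> Dp [[l1 _ _] [l2 _ _] Tv] ix FA; have H := in_D3_herm Dp ix.
have [a0 sym tr] := Tv i x ix.
have [m [n F1]] := Jdot_format_exists H (l1 i x ix) a0.
have [k [l F2]] := Adot_format_exists H FA F1
  (fun c u1 u2 u3 => proj1 (l2 i x ix c u1 u2 u3)) (fun c u1 u2 u3 => proj2 (l2 i x ix c u1 u2 u3)) sym tr.
by exists m, n, k, l.
Qed.

Section CubicFormats.
Variables (p : pairJA S) (i : chart S) (x : E) (a b : R).
Hypothesis H : hermitian_at x (p.1 i) (gJ rho p i) (rho i x).
Hypothesis FA : cubic_format x (p.1 i) (p.2 i x) a b.
Local Notation G := (gfr (gJ rho p i) x).

(** The metric [h] enters only through the length of the frame vector, three factors of it in each
    value of C and hence six in the square. One computation thus serves both g_J and the conformal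
    metric of HS_0. *)
Lemma norm2q_format (h : E -> E -> E -> R) :
  norm2q (p.1 i) h (cubic rho p i) x =
  ((Num.sqrt (gfr h x))^-1) ^+ 6 * G ^+ 2 * (a ^+ 2 + b ^+ 2).
Proof.
rewrite /norm2q /cubic (frame1_fr x (p.1 i) h) (J_fr H) !(formatE FA) !(g_fr H).
set s := (Num.sqrt _)^-1; ring.
Qed.

Lemma norm2qJ_format : norm2qJ rho p i x = (a ^+ 2 + b ^+ 2) / G.
Proof.
rewrite /norm2qJ norm2q_format; have := sqrtG_sq H; set s := (Num.sqrt _)^-1 => ss.
have -> : s ^+ 6 = (s * s) ^+ 3 by ring.
by rewrite ss; field; exact: gfr_neq0 H.
Qed.

Lemma normA0_format : normA0 rho p i x = (a ^+ 2 + b ^+ 2) / G / 2.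
Proof.
rewrite /normA0 (ipA_format H FA FA).
by field; exact: gfr_neq0 H.
Qed.

End CubicFormats.

Section Formats.
Variables (p v : pairJA S) (i : chart S) (x : E) (a b m n k l : R).
Hypothesis H : hermitian_at x (p.1 i) (gJ rho p i) (rho i x).
Hypothesis FA : cubic_format x (p.1 i) (p.2 i x) a b.
Hypothesis F1 : Jdot_format x (p.1 i) (v.1 i x) m n.
Hypothesis F2 : Adot_format x (p.1 i) a b (v.2 i x) m n k l.
Local Notation G := (gfr (gJ rho p i) x).
Local Notation t1 := (a * n - b * m).
Local Notation t2 := (b * n + a * m).

Lemma trJAJdot c d : trE (p.1 i x \o p.2 i x (frv (p.1 i) x c d) \o v.1 i x) = 2 * (c * t1 + d * t2).
Proof.
rewrite (fmat_tr H (fmat_comp (fmat_comp (fmatJ H) (FA c d)) F1)); ring.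
Qed.

Lemma Atr_format : format x (p.1 i) (Atr p v i x) t1 0 0 t1 t2 0 0 t2.
Proof.
move=> c d c' d'; rewrite /Atr trJAJdot frZ; congr frv; by field.
Qed.

Lemma A0_format : format x (p.1 i) (A0 p v i x)
  (k - t1) l l (t1 - k) (l - t2) (2 * t1 - k) (2 * t1 - k) (t2 - l).
Proof.
move=> c d c' d'; rewrite /A0 (formatE F2) (formatE Atr_format) frB; congr frv; ring.
Qed.

Lemma Istr1_format : Jdot_format x (p.1 i) ((Istr p v).1 i x) n (- m).
Proof. by move=> c d; rewrite /= F1 (J_fr H) frN; congr frv; ring. Qed.

Lemma Istr2_format : Adot_format x (p.1 i) a b ((Istr p v).2 i x) n (- m) (- l - t2) (k - t1).
Proof.
move=> c d c' d'; rewrite /= (J_fr H) (formatE F2) F1 (formatE FA) frN frB; congr frv; ring.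
Qed.

End Formats.

Lemma normA0_norm2qJ p i x : in_D3 rho p -> img i x ->
  normA0 rho p i x = norm2qJ rho p i x / 2.
Proof.
move=> Dp ix; have H := in_D3_herm Dp ix; have [a [b FA]] := in_D3_format Dp ix.
by rewrite (normA0_format H FA) (norm2qJ_format H FA).
Qed.

End Pointwise.

(* The differential of Psi_theta at v; the last summand comes from the variation of
   J in cos theta A - sin theta A J. *)
Definition rotv (theta : R) p v : pairJA S :=
  (v.1, fun i x X u => cos theta *: v.2 i x X u
     - sin theta *: (v.2 i x X (p.1 i x u) + p.2 i x X (v.1 i x u))).

Section RotFormats.
Variables (theta : R) (p v : pairJA S) (i : chart S) (x : E) (a b m n k l : R).
Hypothesis H : hermitian_at x (p.1 i) (gJ rho p i) (rho i x).
Hypothesis FA : cubic_format x (p.1 i) (p.2 i x) a b.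
Hypothesis F1 : Jdot_format x (p.1 i) (v.1 i x) m n.
Hypothesis F2 : Adot_format x (p.1 i) a b (v.2 i x) m n k l.
Local Notation c := (cos theta).
Local Notation s := (sin theta).

(** The value of q on the first frame vector is proportional to a - i b, so multiplying q by e^(-i
    theta) rotates (a, b) through theta. *)
Lemma Psi_format : cubic_format x (p.1 i) ((Psi theta p).2 i x) (c * a - s * b) (c * b + s * a).
Proof.
by move=> d e d' e'; rewrite /= (J_fr H) !(formatE FA) !frE; congr frv; ring.
Qed.

Lemma rotv_format : Adot_format x (p.1 i) (c * a - s * b) (c * b + s * a)
  ((rotv theta p v).2 i x) m n
  (c * k - s * (l + (b * n + a * m))) (c * l + s * (k - (a * n - b * m))).
Proof.
by move=> d e d' e'; rewrite /= (J_fr H) F1 !(formatE F2) (formatE FA) !frE; congr frv; ring.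
Qed.

(** Removing the trace absorbs the summand A Jdot of [rotv], so Adot_0 is rotated exactly like A.
    The linearised holomorphy equation and the gauge forms see the tangent vector only through Jdot,
    which is fixed, and Adot_0. *)
Lemma A0_rotv X u : A0 (Psi theta p) (rotv theta p v) i x X u =
  c *: A0 p v i x X u - s *: A0 p v i x X (p.1 i x u).
Proof.
have E1 := @A0_format (Psi theta p) (rotv theta p v) i x _ _ _ _ _ _ H Psi_format F1 rotv_format.
have E2 := A0_format H FA F1 F2.
have [d [e ->]] := fr_surj H X; have [d' [e' ->]] := fr_surj H u.
by rewrite (J_fr H) [LHS](formatE E1) !(formatE E2) !frE; congr frv; ring.
Qed.

End RotFormats.
End SurfaceTensors.

Section LinearCombinations.
Variables (R : realType) (V : lmodType R).

Lemma rot_lin (c s k : R) (a b a' b' : V) :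
  c *: (k *: a + b) - s *: (k *: a' + b') = k *: (c *: a - s *: a') + (c *: b - s *: b').
Proof.
rewrite !scalerDr !scalerA [c * k]mulrC [s * k]mulrC opprD addrACA.
by rewrite -!scalerA -scalerN.
Qed.

Lemma rot_sub (c s : R) (a b a' b' : V) :
  c *: a - s *: b - (c *: a' - s *: b') = c *: (a - a') - s *: (b - b').
Proof. by rewrite !scalerBr !opprB [s *: b' - _]addrC addrACA [- _ + _]addrC. Qed.

Lemma lin_comb (k : R) (a b a' b' : V) :
  k *: a + b + (k *: a' + b') = k *: (a + a') + (b + b').
Proof. by rewrite addrACA -scalerDr. Qed.

End LinearCombinations.

(** * The circle acts on pairs (J, A) and on their tangent vectors *)

Section RotateStructure.
Variables (R : realType) (M : ptopologicalType) (S : oriented_atlas R M).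
Local Notation E := (R * R)%type.
Variables (rho : form2 S) (theta : R).
Hypothesis rho_area : is_area_form rho.
Implicit Types (i : chart S) (p : pairJA S).
Local Notation c0 := (cos theta).
Local Notation s0 := (sin theta).

Lemma smooth_on_rot (V : normedModType R) (U : set V) (f g : V -> E) : open U ->
  smooth_on U f -> smooth_on U g -> smooth_on U (fun x => c0 *: f x - s0 *: g x).
Proof.
move=> oU sf sg; have := smooth_on_lincomb c0 (- s0) oU sf sg.
by apply: smooth_on_eq => // x _; rewrite scaleNr.
Qed.

Lemma derive_rot (T : E -> E) (x : E) (a b : E) : differentiable T x ->
  'D_(c0 *: a - s0 *: b) T x = c0 *: 'D_a T x - s0 *: 'D_b T x.
Proof. by move=> dT; rewrite -!scaleNr; exact: derive_lincomb. Qed.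

Lemma Psi_endform p : in_D3 rho p -> is_endform_field (Psi theta p).2.
Proof.
move=> [[lJ sJ tJ] [lA sA tA] _]; split.
- move=> i x ix c u v w; have [A1 A2] := lA i x ix c u v w.
  have [A3 _] := lA i x ix c u v (p.1 i x w).
  have [_ A4] := lA i x ix c (p.1 i x u) (p.1 i x v) w.
  by rewrite /= A1 A2 A3 (lJ i x ix) A4; split; exact: rot_lin.
- move=> i u v; apply: smooth_on_rot; [exact: img_open|exact: sA|].
  apply: (@smooth_on_lin_app _ _ (img i) (fun y => p.2 i y u) (fun y => p.1 i y v)).
  + exact: img_open.
  + by move=> y iy c a b; case: (lA i y iy c a b u).
  + by move=> a; exact: sA.
  + exact: sJ.
- move=> i j x ox u v; rewrite /= (tA i j x ox) (tJ i j x ox) (tA i j x ox).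
  by rewrite (derive_rot _ _ (trans_diff ox)).
Qed.

Lemma Psi_in_D3 p : in_D3 rho p -> in_D3 rho (Psi theta p).
Proof.
move=> Dp; have [Dp1 _ alg] := Dp; split; [exact: Dp1|exact: Psi_endform|].
- move=> i x ix /=; have H := in_D3_herm rho_area Dp ix.
  have [JJ pos _ _ _] := alg i x ix.
  have [a [b FA]] := in_D3_format rho_area Dp ix.
  by have [A1 A2 A3] := cubic_format_algebra H (Psi_format theta H FA).
Qed.

Lemma rotv_endform p (v : pairJA S) : in_D3 rho p -> tangent_D3 rho p v ->
  is_endform_field (rotv theta p v).2.
Proof.
move=> [[lJ sJ tJ] [lA sA tA] _] [[l1 s1 tr1] [l2 s2 tr2] _]; split.
- move=> i x ix c u w z; have [A1 A2] := l2 i x ix c u w z.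
  have [A3 _] := l2 i x ix c u w (p.1 i x z).
  have [_ A4] := l2 i x ix c (p.1 i x u) (p.1 i x w) z.
  have [A5 _] := lA i x ix c u w (v.1 i x z).
  have [_ A6] := lA i x ix c (v.1 i x u) (v.1 i x w) z.
  rewrite /= A1 A2 A3 A5 (lJ i x ix) (l1 i x ix) A4 A6 !lin_comb.
  by split; exact: rot_lin.
- move=> i u w; apply: smooth_on_rot; [exact: img_open|exact: s2|].
  have a1 : smooth_on (img i) (fun y => v.2 i y u (p.1 i y w)).
    apply: (@smooth_on_lin_app _ _ (img i) (fun y => v.2 i y u) (fun y => p.1 i y w)).
    + exact: img_open.
    + by move=> y iy c a b; case: (l2 i y iy c a b u).
    + by move=> a; exact: s2.
    + exact: sJ.
  have a2 : smooth_on (img i) (fun y => p.2 i y u (v.1 i y w)).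
    apply: (@smooth_on_lin_app _ _ (img i) (fun y => p.2 i y u) (fun y => v.1 i y w)).
    + exact: img_open.
    + by move=> y iy c a b; case: (lA i y iy c a b u).
    + by move=> a; exact: sA.
    + exact: s1.
  have := smooth_on_lincomb 1 1 (@img_open _ _ _ i) a1 a2.
  by apply: smooth_on_eq; [exact: img_open|move=> y _; rewrite !scale1r].
- move=> i j x ox u w; have dT := trans_diff ox.
  rewrite /= (tr2 i j x ox) (tJ i j x ox) (tr2 i j x ox) (tr1 i j x ox) (tA i j x ox).
  rewrite (derive_rot _ _ dT); congr (_ - _ *: _).
  by have := derive_linear 1 (v.2 i x u (p.1 i x w)) (p.2 i x u (v.1 i x w)) dT; rewrite !scale1r.
Qed.

Lemma rotv_tangent p (v : pairJA S) : in_D3 rho p -> tangent_D3 rho p v ->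
  tangent_D3 rho (Psi theta p) (rotv theta p v).
Proof.
move=> Dp Tv; have [Tv1 _ Ta] := Tv; split; [exact: Tv1|exact: rotv_endform|].
- move=> i x ix; have H := in_D3_herm rho_area Dp ix.
  have [a [b FA]] := in_D3_format rho_area Dp ix.
  have [m [n [k [l [F1 F2]]]]] := tangent_D3_format rho_area Dp Tv ix FA.
  have [A1 A2] := Adot_format_algebra H (Psi_format theta H FA) F1 (rotv_format theta H FA F1 F2).
  by have [a0 _ _] := Ta i x ix.
Qed.

Lemma Psi_norm2qJ p i x : in_D3 rho p -> img i x ->
  norm2qJ rho (Psi theta p) i x = norm2qJ rho p i x.
Proof.
move=> Dp ix; have H := in_D3_herm rho_area Dp ix.
have [a [b FA]] := in_D3_format rho_area Dp ix.
rewrite (norm2qJ_format H FA) (norm2qJ_format (p := Psi theta p) H (Psi_format theta H FA)).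
by congr (_ / _); have := cos2Dsin2 theta => cs; rewrite -[RHS]mul1r -cs; ring.
Qed.

Lemma Psi_normA0 p i x : in_D3 rho p -> img i x ->
  normA0 rho (Psi theta p) i x = normA0 rho p i x.
Proof.
move=> Dp ix; rewrite !normA0_norm2qJ // ?Psi_norm2qJ //.
exact: Psi_in_D3.
Qed.

End RotateStructure.

(** * The equations of HS_0 and of V under the circle action *)

Section RotateTangent.
Variables (R : realType) (M : ptopologicalType) (S : oriented_atlas R M).
Local Notation E := (R * R)%type.
Variables (rho : form2 S) (theta : R).
Hypothesis rho_area : is_area_form rho.
Local Notation c0 := (cos theta).
Local Notation s0 := (sin theta).

Lemma cs1 : c0 ^+ 2 + s0 ^+ 2 = 1.
Proof. exact: cos2Dsin2. Qed.

(** Multiplying one side by cos^2 + sin^2 turns invariance under rotation into a polynomial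
    identity. *)
Lemma mulcs (y : R) : y = (c0 ^+ 2 + s0 ^+ 2) * y.
Proof. by rewrite cs1 mul1r. Qed.

Lemma rot_sq (a b : R) : (c0 * a - s0 * b) ^+ 2 + (c0 * b + s0 * a) ^+ 2 = a ^+ 2 + b ^+ 2.
Proof. by rewrite [RHS]mulcs; ring. Qed.

Section OnePoint.
Variable p : pairJA S.
Hypothesis Dp : in_D3 rho p.

Lemma herm_p i : forall x, img i x -> hermitian_at x (p.1 i) (gJ rho p i) (rho i x).
Proof. by move=> x; exact: in_D3_herm. Qed.

Lemma smooth_p1 i u : smooth_on (img i) (fun y => p.1 i y u).
Proof. by have [[_ sJ _] _ _] := Dp; exact: sJ. Qed.

Lemma smooth_p2 i X u : smooth_on (img i) (fun y => p.2 i y X u).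
Proof. by have [_ [_ sA _] _] := Dp; exact: sA. Qed.

Lemma smooth_rho i u v : smooth_on (img i) (fun y => rho i y u v).
Proof. by have [_ _ sr _ _] := rho_area; exact: sr. Qed.

Lemma p2_lin1 i y : img i y -> forall c u v w,
  p.2 i y (c *: u + v) w = c *: p.2 i y u w + p.2 i y v w.
Proof. by have [_ [lA _ _] _] := Dp => iy c u v w; case: (lA i y iy c u v w). Qed.

Lemma p2_lin2 i y : img i y -> forall c u v w,
  p.2 i y w (c *: u + v) = c *: p.2 i y w u + p.2 i y w v.
Proof. by have [_ [lA _ _] _] := Dp => iy c u v w; case: (lA i y iy c u v w). Qed.

Lemma nabla_Psi i x u X v : img i x ->
  nabla_form (p.1 i) (gJ rho p i) ((Psi theta p).2 i) x u X v =
  c0 *: nabla_form (p.1 i) (gJ rho p i) (p.2 i) x u X v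
  - s0 *: nabla_form (p.1 i) (gJ rho p i) (p.2 i) x u X (p.1 i x v).
Proof.
move=> ix; exact (nabla_form_rot (@img_open _ _ _ i) (@herm_p i) (@smooth_p1 i)
  (@smooth_rho i) ix (@p2_lin2 i) (@smooth_p2 i)
  (B' := (Psi theta p).2 i) (c := c0) (s := s0) (fun y iy X u => erefl) u X v).
Qed.

Lemma dnabla_rot i x (B B' : E -> E -> E -> E) :
  (forall u X v, nabla_form (p.1 i) (gJ rho p i) B' x u X v =
    c0 *: nabla_form (p.1 i) (gJ rho p i) B x u X v
    - s0 *: nabla_form (p.1 i) (gJ rho p i) B x u X (p.1 i x v)) ->
  forall X Y v, dnabla (p.1 i) (gJ rho p i) B' x X Y v =
  c0 *: dnabla (p.1 i) (gJ rho p i) B x X Y v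
  - s0 *: dnabla (p.1 i) (gJ rho p i) B x X Y (p.1 i x v).
Proof.
by move=> HB X Y v; rewrite /dnabla !HB; exact: rot_sub.
Qed.

(** The conformal factor depends on ||q|| alone, so the metric h, and with it the curvature, is the
    same for both pairs on the chart. The norm of q is invariant, and d^nabla A is multiplied by the
    rotation. *)
Lemma Psi_in_HS F : in_HS rho F p -> in_HS rho F (Psi theta p).
Proof.
move=> [_ HSp]; split; first exact: Psi_in_D3.
move=> i x ix h; have [K dA] := HSp i x ix; split; last first.
  by move=> X Y v; rewrite (dnabla_rot (fun u X v => nabla_Psi u X v ix)) !dA !scaler0 subr0.
have hE y : img i y -> forall u v, h y u v = expR (F (norm2qJ rho p i y / 2)) * gJ rho p i y u v.
  by move=> iy u v; rewrite /h Psi_norm2qJ.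
rewrite (gaussK_near (p.1 i) (@img_open _ _ _ i) hE ix) -[RHS]K; congr (_ - _).
have [a [b FA]] := in_D3_format rho_area Dp ix; have H := herm_p ix.
rewrite (norm2q_format H FA) (norm2q_format (p := Psi theta p) H (Psi_format theta H FA)).
by rewrite rot_sq /gfr hE.
Qed.

Section OneTangent.
Variable v : pairJA S.
Hypothesis Tv : tangent_D3 rho p v.

Lemma A0_lin1 i y : img i y -> forall c u w z,
  A0 p v i y (c *: u + w) z = c *: A0 p v i y u z + A0 p v i y w z.
Proof.
move=> iy; have [a [b FA]] := in_D3_format rho_area Dp iy.
have [m [n [k [l [F1 F2]]]]] := tangent_D3_format rho_area Dp Tv iy FA.
exact (format_lin1 (herm_p iy) (A0_format (herm_p iy) FA F1 F2)).
Qed.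

Lemma A0_lin2 i y : img i y -> forall c u w z,
  A0 p v i y z (c *: u + w) = c *: A0 p v i y z u + A0 p v i y z w.
Proof.
move=> iy; have [a [b FA]] := in_D3_format rho_area Dp iy.
have [m [n [k [l [F1 F2]]]]] := tangent_D3_format rho_area Dp Tv iy FA.
exact (format_lin2 (herm_p iy) (A0_format (herm_p iy) FA F1 F2)).
Qed.

Lemma A0_rotvE i y : img i y -> forall X u,
  A0 (Psi theta p) (rotv theta p v) i y X u =
  c0 *: A0 p v i y X u - s0 *: A0 p v i y X (p.1 i y u).
Proof.
move=> iy; have [a [b FA]] := in_D3_format rho_area Dp iy.
have [m [n [k [l [F1 F2]]]]] := tangent_D3_format rho_area Dp Tv iy FA.
exact: A0_rotv (herm_p iy) FA F1 F2.
Qed.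

Lemma smooth_v1 i u : smooth_on (img i) (fun y => v.1 i y u).
Proof. by have [[_ sJ _] _ _] := Tv; exact: sJ. Qed.

Lemma smooth_v2 i X u : smooth_on (img i) (fun y => v.2 i y X u).
Proof. by have [_ [_ sA _] _] := Tv; exact: sA. Qed.

Lemma smooth_JAV i X u : smooth_on (img i) (fun y => p.1 i y (p.2 i y X (v.1 i y u))).
Proof.
have oi := @img_open _ _ _ i.
have s2 : smooth_on (img i) (fun y => p.2 i y X (v.1 i y u)).
  exact (@smooth_on_lin_app _ _ (img i) (fun y => p.2 i y X) (fun y => v.1 i y u) oi
    (fun y iy c a b => p2_lin2 iy c a b X) (@smooth_p2 i X) (@smooth_v1 i u)).
exact (@smooth_on_lin_app _ _ (img i) (p.1 i) (fun y => p.2 i y X (v.1 i y u)) oi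
    (fun y iy => J_lin (herm_p iy)) (@smooth_p1 i) s2).
Qed.

Lemma smooth_A0 i X u : smooth_on (img i) (fun y => A0 p v i y X u).
Proof.
have oi := @img_open _ _ _ i.
have st : smooth_on (img i) (fun y => trE (p.1 i y \o p.2 i y X \o v.1 i y)).
  apply: smooth_onD => //.
    exact (smooth_on_fst oi (@smooth_JAV i X (1, 0))).
  exact: (smooth_on_snd oi (@smooth_JAV i X (0, 1))).
have st2 (r : R) : smooth_on (img i)
    (fun y => 2^-1 * trE (p.1 i y \o p.2 i y X \o v.1 i y) * r).
  apply: smooth_onM => //; last exact: smooth_on_cst.
  by apply: smooth_onM => //; exact: smooth_on_cst.
have := smooth_on_lincomb 1 (- 1) oi (@smooth_v2 i X u) (smooth_on_pair oi (st2 u.1) (st2 u.2)).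
apply: smooth_on_eq => // y iy; rewrite scale1r scaleN1r /A0; congr (_ - _).
Qed.

Lemma nabla_A0_rotv i x u X w : img i x ->
  nabla_form (p.1 i) (gJ rho p i) (A0 (Psi theta p) (rotv theta p v) i) x u X w =
  c0 *: nabla_form (p.1 i) (gJ rho p i) (A0 p v i) x u X w
  - s0 *: nabla_form (p.1 i) (gJ rho p i) (A0 p v i) x u X (p.1 i x w).
Proof.
move=> ix; exact (nabla_form_rot (@img_open _ _ _ i) (@herm_p i) (@smooth_p1 i)
  (@smooth_rho i) ix (@A0_lin2 i) (@smooth_A0 i) (@A0_rotvE i) u X w).
Qed.

(** The equation is linear in the pair (Adot_0, A), both of which are rotated. At [u] it becomes cos
    theta times the old equation at [u] minus sin theta times the old one at [J u]. *)
Lemma lin_hol_rotv i x : img i x -> lin_hol_eq rho p v i x ->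
  lin_hol_eq rho (Psi theta p) (rotv theta p v) i x.
Proof.
move=> ix lh X Y u; rewrite (dnabla_rot (fun u X v => nabla_A0_rotv u X v ix)).
have lJ := J_lin (herm_p ix).
have dn w : dnabla (p.1 i) (gJ rho p i) (A0 p v i) x X Y w =
    p.1 i x (divE (p.1 i) (gJ rho p i) (v.1 i) x X *: p.2 i x Y w
           - divE (p.1 i) (gJ rho p i) (v.1 i) x Y *: p.2 i x X w).
  by apply/eqP; rewrite -subr_eq0; apply/eqP; exact: lh.
rewrite !dn -(lin_funZ lJ) -(lin_funZ lJ) -(lin_funN lJ) -(lin_funD lJ).
rewrite -(lin_funN lJ) -(lin_funD lJ) -[RHS](lin_fun0 lJ); congr (p.1 i x _).
move: (divE _ _ _ _ _) (divE _ _ _ _ _) => d1 d2 /=.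
move: (p.2 i x Y _) (p.2 i x Y _) (p.2 i x X _) (p.2 i x X _) => a1 a2 a3 a4.
by vec.
Qed.

Variable f : R -> R.

(** Put R = cos theta - sin theta J. The symmetric trace-free Adot_0(Y) anticommutes with [J], so R
    Adot_0(Y) R = Adot_0(Y). The trace of a product is therefore unchanged when both factors are
    multiplied by R on the right, and the same holds for Adot_0 J. *)
Lemma ip_A_A0_rotv i x : img i x ->
  ipA (p.1 i) (gJ rho p i) x ((Psi theta p).2 i x) (A0 (Psi theta p) (rotv theta p v) i x) =
  ipA (p.1 i) (gJ rho p i) x (p.2 i x) (A0 p v i x) /\
  ipA (p.1 i) (gJ rho p i) x ((Psi theta p).2 i x)
    (fun X u => A0 (Psi theta p) (rotv theta p v) i x X (p.1 i x u)) =
  ipA (p.1 i) (gJ rho p i) x (p.2 i x) (fun X u => A0 p v i x X (p.1 i x u)).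
Proof.
move=> ix; have H := herm_p ix; have [a [b FA]] := in_D3_format rho_area Dp ix.
have [m [n [k [l [F1 F2]]]]] := tangent_D3_format rho_area Dp Tv ix FA.
have FA' := Psi_format theta H FA; have F2' := rotv_format theta H FA F1 F2.
have F0 := A0_format H FA F1 F2.
have F0' := @A0_format _ _ _ _ (Psi theta p) (rotv theta p v) i x _ _ _ _ _ _ H FA' F1 F2'.
split.
  rewrite (ipA_format H FA F0) (ipA_format H FA' F0'); congr (_ / _).
  by rewrite [RHS]mulcs; ring.
rewrite (ipA_format H FA (formatJ H F0)) (ipA_format H FA' (formatJ H F0')); congr (_ / _).
by rewrite [RHS]mulcs; ring.
Qed.

(** nabla_X A is rotated like A because [J] is parallel; the pairing with the rotated Adot_0 is then
    preserved as in [ip_A_A0_rotv]. *)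
Lemma betaf_rotv i x X : img i x ->
  betaf rho (Psi theta p) (rotv theta p v) i x X = betaf rho p v i x X.
Proof.
move=> ix; have H := herm_p ix; have [a [b FA]] := in_D3_format rho_area Dp ix.
have [m [n [k [l [F1 F2]]]]] := tangent_D3_format rho_area Dp Tv ix FA.
have FA' := Psi_format theta H FA; have F2' := rotv_format theta H FA F1 F2.
have F0 := A0_format H FA F1 F2.
have F0' := @A0_format _ _ _ _ (Psi theta p) (rotv theta p v) i x _ _ _ _ _ _ H FA' F1 F2'.
have l1 := nabla_form_lin1 (@img_open _ _ _ i) (@herm_p i) (@smooth_p1 i) (@smooth_rho i) ix
  (@p2_lin1 i) (@smooth_p2 i) X.
have l2 := nabla_form_lin2 (@img_open _ _ _ i) (@herm_p i) (@smooth_p1 i) (@smooth_rho i) ix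
  (@p2_lin2 i) (@smooth_p2 i) X.
have [c1 [c2 [c3 [c4 [d1 [d2 [d3 [d4 FN]]]]]]]] := format_exists H l1 (fun c a b w => l2 c w a b).
have FNJ := formatJ H FN.
have FN' : format x (p.1 i) (fun Y u => nabla_form (p.1 i) (gJ rho p i) ((Psi theta p).2 i) x X Y (p.1 i x u))
    (c0 * c2 + s0 * c1) (c0 * - c1 + s0 * c2) (c0 * c4 + s0 * c3) (c0 * - c3 + s0 * c4)
    (c0 * d2 + s0 * d1) (c0 * - d1 + s0 * d2) (c0 * d4 + s0 * d3) (c0 * - d3 + s0 * d4).
  move=> e h e' h'; rewrite nabla_Psi // !(J_fr H) !(formatE FN) !frE; congr frv; ring.
rewrite /betaf (ipA_format H FNJ F0) (ipA_format H FN' F0'); congr (_ / _).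
by rewrite [RHS]mulcs; ring.
Qed.

Lemma fdot_rotv i x : img i x ->
  fdot rho f (Psi theta p) (rotv theta p v) i x = fdot rho f p v i x /\
  fdot0 rho f (Psi theta p) (rotv theta p v) i x = fdot0 rho f p v i x.
Proof.
move=> ix; have [E1 E2] := ip_A_A0_rotv ix.
by rewrite /fdot /fdot0 E1 E2 Psi_normA0.
Qed.

(** The metric and Jdot are the same on both sides, and [f] sees only the invariant norm. *)
Lemma divf_rotv i x X : img i x ->
  divf rho f (Psi theta p) (rotv theta p v) i x X = divf rho f p v i x X.
Proof.
move=> ix; rewrite /divf /divE /osum /nabla_end.
have E1 e : 'D_e (fun y => (f (normA0 rho (Psi theta p) i y) - 1) *: v.1 i y X) x =
            'D_e (fun y => (f (normA0 rho p i y) - 1) *: v.1 i y X) x.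
  suff HE y : img i y -> (f (normA0 rho (Psi theta p) i y) - 1) *: v.1 i y X =
      (f (normA0 rho p i y) - 1) *: v.1 i y X by exact: (derive_near e (@img_open _ _ _ i) ix HE).
  by move=> iy; rewrite Psi_normA0.
by rewrite /= !E1 Psi_normA0.
Qed.

Lemma alpha_rotv i x X : img i x ->
  alpha1 rho f (Psi theta p) (rotv theta p v) i x X = alpha1 rho f p v i x X /\
  alpha2 rho f (Psi theta p) (rotv theta p v) i x X = alpha2 rho f p v i x X.
Proof.
move=> ix; rewrite /alpha1 /alpha2 /= (divf_rotv X ix) (divf_rotv (p.1 i x X) ix).
rewrite (betaf_rotv X ix) (betaf_rotv (p.1 i x X) ix) (Psi_normA0 theta rho_area Dp ix).
rewrite (derive_near _ (@img_open _ _ _ i) ix (fun y iy => proj1 (fdot_rotv iy))).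
by rewrite (derive_near _ (@img_open _ _ _ i) ix (fun y iy => proj2 (fdot_rotv iy))).
Qed.

End OneTangent.
End OnePoint.
End RotateTangent.

(** * The circle acts by isometries *)

Section Isometry.
Variables (R : realType) (M : ptopologicalType) (S : oriented_atlas R M).
Local Notation E := (R * R)%type.
Variables (rho : form2 S) (theta : R) (F : R -> R).
Hypothesis rho_area : is_area_form rho.
Local Notation c0 := (cos theta).
Local Notation s0 := (sin theta).

Lemma open_abs_lt (e : R) : open [set t : R | `|t| < e].
Proof.
have -> : [set t : R | `|t| < e] = ball (0 : R) e.
  by apply/seteqP; split=> t; rewrite /= -ball_normE /ball_ /= sub0r normrN.
exact: ball_open.
Qed.

Lemma open_prod_set (T1 T2 : topologicalType) (A : set T1) (B : set T2) :
  open A -> open B -> open (A `*` B).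
Proof.
move=> oA oB; rewrite openE => -[a b] [/= Aa Bb].
by exists (A, B) => //=; split; apply: open_nbhs_nbhs.
Qed.

Lemma cubic_lin2 (p : pairJA S) i x : in_D3 rho p -> img i x -> forall X Z c u w,
  cubic rho p i x X (c *: u + w) Z = c * cubic rho p i x X u Z + cubic rho p i x X w Z.
Proof.
move=> Dp ix X Z c u w; rewrite /cubic (p2_lin2 Dp ix).
exact: (g_linl (in_D3_herm rho_area Dp ix)).
Qed.

Lemma gJ_linl (p : pairJA S) i x c u v w : img i x ->
  gJ rho p i x (c *: u + v) w = c * gJ rho p i x u w + gJ rho p i x v w.
Proof. by have [rl _ _ _ _] := rho_area => ix; exact: rl. Qed.

Lemma gJ_rot (p : pairJA S) i x a b u v w : img i x ->
  gJ rho p i x (a *: u - b *: v) w = a * gJ rho p i x u w - b * gJ rho p i x v w.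
Proof.
move=> ix; rewrite gJ_linl // -scaleNr.
by rewrite (lin_funZ (fun k p1 p2 => gJ_linl p k p1 p2 w ix)) /GRing.scale /= mulNr.
Qed.

Lemma gJ_add (p : pairJA S) i x u v w : img i x ->
  gJ rho p i x (u + v) w = gJ rho p i x u w + gJ rho p i x v w.
Proof. by move=> ix; exact: (lin_funD (fun k p1 p2 => gJ_linl p k p1 p2 w ix)). Qed.

(** On cubic tensors the action is cos theta C(X, Y, Z) - sin theta C(X, J Y, Z). The product rule
    for the moving argument J Y gives the summand A Jdot of [rotv]. *)
Lemma Psi_velocity (p v : pairJA S) : dPsi rho F theta p v (rotv theta p v).
Proof.
move=> c [e e0 [cHS cs]] c0p vel i x ix; have [vJ vC] := vel i x ix.
split; first exact: vJ.
move=> X Y Z; pose U := [set t : R | `|t| < e].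
have oU : open U by exact: open_abs_lt.
have U0 : U 0 by rewrite /U /= normr0.
pose C t a := cubic rho (c t) i x X a Z.
have HJ := is_derive_lin_appR (B := C) (Y := fun t => (c t).1 i x Y)
  (dB := fun a => gJ rho (c 0) i x (v.2 i x X a) Z) oU U0
  (fun t Ut k u w => cubic_lin2 (proj1 (cHS t Ut)) ix X Z k u w)
  (fun a => vC X a Z) (vJ Y).
have d1 := is_deriveM_fun (is_derive_cst c0 (0 : R) 1) (vC X Y Z).
have d2 := is_deriveM_fun (is_derive_cst s0 (0 : R) 1) HJ.
have d3 := is_deriveB_fun d1 d2.
have d4 : is_derive (0 : R) 1 (fun t => cubic rho ((Psi theta \o c) t) i x X Y Z) _ :=
  is_derive_near (g := fun t => cubic rho ((Psi theta \o c) t) i x X Y Z) oU U0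
   (fun t _ => esym (gJ_rot (c t) c0 s0 (((c t).2 i x X Y)) ((c t).2 i x X ((c t).1 i x Y)) Z ix)) d3.
apply: (is_derive_eq d4); rewrite !mul0r !add0r c0p /=.
rewrite [RHS]gJ_rot // gJ_add // /C /cubic c0p.
by [].
Qed.

Lemma Psi_path c : path_in_HS rho F c -> path_in_HS rho F (Psi theta \o c).
Proof.
move=> [e e0 [cHS cs]]; exists e; first exact: e0.
split.
  by move=> t te; apply: Psi_in_HS => //; [exact: (proj1 (cHS t te))|exact: cHS].
move=> i U; have [sJ sA] := cs i; split; first exact: sJ.
have oU : open U.
  have -> : U = [set t : R | `|t| < e] `*` img i by apply/seteqP; split.
  by apply: open_prod_set; [exact: open_abs_lt|exact: img_open].
move=> u v; apply: (smooth_on_rot theta oU (sA u v)).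
exact: (@smooth_on_lin_app _ _ U (fun tx => (c tx.1).2 i tx.2 u)
  (fun tx => (c tx.1).1 i tx.2 v) oU
  (fun tx Utx k a b => p2_lin2 (proj1 (cHS tx.1 (proj1 Utx))) (proj2 Utx) k a b u)
  (sA u) (sJ v)).
Qed.

Variable f : R -> R.

Lemma V_space_rotv (p v : pairJA S) : in_HS rho F p -> V_space rho F f p v ->
  V_space rho F f (Psi theta p) (rotv theta p v).
Proof.
move=> HSp [Tv [c [pc c0p vel]] lh ex1 ex2]; have Dp := proj1 HSp; split.
- exact: rotv_tangent.
- exists (Psi theta \o c); split; first exact: Psi_path.
    by rewrite /= c0p.
  exact: (Psi_velocity pc c0p vel).
- by move=> i x ix; exact: (lin_hol_rotv theta rho_area Dp Tv ix (lh i x ix)).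
- have [u su Hu] := ex1; exists u; first exact: su.
  move=> i x ix w; rewrite (Hu i x ix w).
  exact (esym (proj1 (alpha_rotv theta rho_area Dp Tv f w ix))).
- have [u su Hu] := ex2; exists u; first exact: su.
  move=> i x ix w; rewrite (Hu i x ix w).
  exact (esym (proj2 (alpha_rotv theta rho_area Dp Tv f w ix))).
Qed.

(** The integrands agree point by point. In the trace term, the half traces of Adot on the two frame
    vectors form a pair that is itself rotated through theta, so its pairing is preserved. *)
Lemma g_f_rotv (mu : {measure set (g_sigma_algebraType (@open M)) -> \bar R})
    (p v w : pairJA S) : in_D3 rho p -> tangent_D3 rho p v -> tangent_D3 rho p w ->
  g_f rho mu f (Psi theta p) (rotv theta p v) (rotv theta p w) = g_f rho mu f p v w.
Proof.
move=> Dp Tv Tw; rewrite /g_f; congr (Rintegral _ _ _); apply/funext => m0.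
rewrite /on_surface; set i := chart_at S m0; set x := Defs.coord i m0.
have ix : img i x by exists m0 => //; exact: dom_chart_at.
have H := in_D3_herm rho_area Dp ix; have [a [b FA]] := in_D3_format rho_area Dp ix.
have [m [n [k [l [F1 F2]]]]] := tangent_D3_format rho_area Dp Tv ix FA.
have [m' [n' [k' [l' [F1' F2']]]]] := tangent_D3_format rho_area Dp Tw ix FA.
have FP := Psi_format theta H FA.
have FPv := rotv_format theta H FA F1 F2; have FPw := rotv_format theta H FA F1' F2'.
rewrite (Psi_normA0 theta rho_area Dp ix).
rewrite (ipA_format H (A0_format H FA F1 F2) (A0_format H FA F1' F2')).
rewrite (ipA_format H (Atr_format H FA F1) (Atr_format H FA F1')).
rewrite (ipA_format H (@A0_format _ _ _ _ (Psi theta p) (rotv theta p v) i x _ _ _ _ _ _ H FP F1 FPv)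
  (@A0_format _ _ _ _ (Psi theta p) (rotv theta p w) i x _ _ _ _ _ _ H FP F1' FPw)).
rewrite (ipA_format H (@Atr_format _ _ _ _ (Psi theta p) (rotv theta p v) i x _ _ _ _ H FP F1)
  (@Atr_format _ _ _ _ (Psi theta p) (rotv theta p w) i x _ _ _ _ H FP F1')).
congr (_ + _ * (_ / _) - _ * (_ / _)).
  by rewrite [RHS](mulcs theta); ring.
by rewrite [RHS](mulcs theta); ring.
Qed.

Lemma Psi_isometry (mu : {measure set (g_sigma_algebraType (@open M)) -> \bar R})
    (p v w : pairJA S) : in_HS rho F p -> V_space rho F f p v -> V_space rho F f p w ->
  exists v' w' : pairJA S,
    [/\ dPsi rho F theta p v v' /\ dPsi rho F theta p w w',
        V_space rho F f (Psi theta p) v',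
        V_space rho F f (Psi theta p) w'
      & g_f rho mu f (Psi theta p) v' w' = g_f rho mu f p v w].
Proof.
move=> HSp Vv Vw; exists (rotv theta p v), (rotv theta p w); split.
- by split; exact: Psi_velocity.
- exact: V_space_rotv.
- exact: V_space_rotv.
- have [Tv _ _ _ _] := Vv; have [Tw _ _ _ _] := Vw.
  exact: (g_f_rotv mu (proj1 HSp)).
Qed.

End Isometry.

(** * Extension of f to a smooth function on the line *)

Section RealCk.
Variable R : realType.

Lemma is_derive1_dir (f : R -> R) (t v d : R) :
  is_derive t 1 f d -> is_derive t v f (v * d).
Proof.
move=> [/derivable1_diffP df <-]; apply: DeriveDef; first exact: diff_derivable.
rewrite !deriveE //.
have -> : v = v *: (1 : R) by rewrite /GRing.scale /= mulr1.
by rewrite linearZ /GRing.scale /= !mulr1.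
Qed.

Lemma Ck_id k (U : set R) : Ck k U (fun x : R => x).
Proof.
case: k => [|k]; first by split=> // x _; exact: cvg_id.
split=> [x _|]; first exact: cvg_id.
split=> [x v _|v]; first exact: derivable_id.
have -> : 'D_v (fun x : R => x) = (fun=> v).
  by apply/funext => x; exact: derive_id.
exact: Ck_cst.
Qed.

Lemma Ck_setT_continuous k (f : R -> R) : Ck k setT f -> continuous f.
Proof. by move=> cf x; exact: Ck_continuous cf I. Qed.

Lemma continuous_Ck0 (f : R -> R) : continuous f -> Ck 0 setT f.
Proof. by move=> cf; split=> // x _; exact: cf. Qed.

Lemma continuous_bounded_itv (f : R -> R) (a b : R) : continuous f ->
  exists C : R, forall t, a <= t <= b -> `|f t| <= C.
Proof.
move=> cf; have [ab|ba] := leP a b; last first.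
  by exists 0 => t /andP[at_ tb]; have := le_trans at_ tb; rewrite leNgt ba.
have cn : {within `[a, b], continuous (fun x => `|f x|)}.
  by apply: continuous_subspaceT => x; apply: cvg_norm; exact: cf.
have [c _ Hc] := EVT_max ab cn; exists `|f c| => t tab.
by apply: Hc; rewrite in_itv.
Qed.

Lemma continuous_integrable_itv (f : R -> R) (a b : R) : continuous f ->
  lebesgue_measure.-integrable `[a, b] (EFin \o f).
Proof.
move=> cf; apply: continuous_compact_integrable; first exact: segment_compact.
by apply: continuous_subspaceT => x; exact: cf.
Qed.

End RealCk.

(** * Integrals of w(r) phi(t r^3) over [0, 1] *)

Section CubeIntegral.
Variable R : realType.
Local Notation leb := (@lebesgue_measure R).

(** The weight [w] is left general because differentiation in [t] stays in this family: it replaces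
    [w] by w r^3 and [phi] by its derivative. *)
Definition cube_int (w phi : R -> R) (t : R) : R :=
  \int[leb]_(r in `[0, 1]) (w r * phi (t * r ^+ 3)).

Lemma cube_integrand_continuous (w phi : R -> R) (t : R) : continuous w -> continuous phi ->
  continuous (fun r : R => w r * phi (t * r ^+ 3)).
Proof.
move=> cw cphi; apply: (@Ck_setT_continuous _ 0); apply: CkM; first exact: openT.
  exact: continuous_Ck0.
apply: Ck_comp; [exact: openT|exact: continuous_Ck0|].
by apply: CkM; [exact: openT|exact: Ck_cst|apply: CkX; [exact: openT|exact: Ck_id]].
Qed.

Lemma continuous_mulX3 (w : R -> R) : continuous w -> continuous (fun r => w r * r ^+ 3).
Proof.
move=> cw; apply: (@Ck_setT_continuous _ 0); apply: CkM; first exact: openT.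
  exact: continuous_Ck0.
by apply: CkX; [exact: openT|exact: Ck_id].
Qed.

(** A constant dominating function for parameters near [a], available since |t r^3| is at most |a| +
    1 there. *)
Lemma cube_int_bound (w phi : R -> R) (a : R) : continuous w -> continuous phi ->
  exists2 C : R, 0 <= C & forall t r, t \in `]a - 1, a + 1[ -> r \in `[0, 1] ->
    `|w r * phi (t * r ^+ 3)| <= C.
Proof.
move=> cw cphi; have [Cw Hw] := continuous_bounded_itv 0 1 cw.
have [Cp Hp] := continuous_bounded_itv (- (`|a| + 1)) (`|a| + 1) cphi.
exists (`|Cw| * `|Cp|); first by rewrite mulr_ge0.
move=> t r; rewrite !in_itv /= => /andP[t1 t2] /andP[r0 r1].
rewrite normrM; apply: ler_pM => //.
  by apply: le_trans (Hw _ _) (ler_norm _); rewrite r0 r1.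
apply: le_trans (Hp _ _) (ler_norm _); rewrite -ler_norml.
have ta : `|t| <= `|a| + 1.
  have -> : t = a + (t - a) by rewrite addrC subrK.
  apply: le_trans (ler_normD _ _) _; rewrite lerD2l ler_norml.
  by apply/andP; split; lra.
rewrite normrM; apply: le_trans ta; rewrite -[leRHS]mulr1; apply: ler_wpM2l => //.
by rewrite normrX exprn_ile1 // ger0_norm.
Qed.

Lemma cube_int_continuous (w phi : R -> R) : continuous w -> continuous phi ->
  continuous (cube_int w phi).
Proof.
move=> cw cphi a; have [C C0 HC] := cube_int_bound a cw cphi.
have ia : a \in `]a - 1, a + 1[%classic.
  by rewrite inE /= in_itv /=; apply/andP; split; lra.
apply: (@continuity_under_integral R _ _ leb (fun t r => w r * phi (t * r ^+ 3)) `[0, 1]%classic _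
  (a - 1) (a + 1) _ _ (fun=> C)) => //.
- by move=> x _; apply: continuous_integrable_itv; exact: cube_integrand_continuous.
- apply: aeW => r _ x _; apply: cvgM; first exact: cvg_cst.
  apply: (@cvg_comp _ _ _ (fun x : R => x * r ^+ 3) phi); last exact: cphi.
  by apply: cvgM; [exact: cvg_id|exact: cvg_cst].
- by apply: continuous_integrable_itv => x; exact: cvg_cst.
- by move=> x xa; apply: aeW => r r01; apply: HC.
Qed.

Lemma cube_int_is_derive (w phi : R -> R) (a : R) : continuous w -> Ck 1 setT phi ->
  is_derive a 1 (cube_int w phi) (cube_int (fun r => w r * r ^+ 3) ('D_1 phi) a).
Proof.
move=> cw cphi; pose f (t r : R) := w r * phi (t * r ^+ 3).
have cp : continuous phi := Ck_setT_continuous cphi.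
have cdp : continuous ('D_1 phi) := Ck_setT_continuous (Ck_derive (1 : R) cphi).
have cw3 : continuous (fun r => w r * r ^+ 3).
  exact: continuous_mulX3.
have [C C0 HC] := cube_int_bound a cw3 cdp.
have df (t r : R) : is_derive t 1 (f ^~ r) (w r * r ^+ 3 * 'D_1 phi (t * r ^+ 3)).
  have d1 : is_derive t 1 (fun t : R => t * r ^+ 3) (1 * r ^+ 3 + t * 0).
    exact: (is_deriveM_fun (is_derive_id t 1) (is_derive_cst _ _ _)).
  have d2 := is_derive_comp1 (f := fun t : R => t * r ^+ 3) (Ck_is_derive (1 : R) cphi (I : setT (t * r ^+ 3))) d1.
  have d3 := is_deriveM_fun (is_derive_cst (w r) t 1) d2.
  by apply: (is_derive_eq d3); rewrite /cst; ring.
have d1f t r : partial1of2 f t r = w r * r ^+ 3 * 'D_1 phi (t * r ^+ 3).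
  by rewrite partial1of2E; case: (df t r).
have Ia : `]a - 1, a + 1[%classic a by rewrite /= in_itv /=; apply/andP; split; lra.
have := @cvg_differentiation_under_integral R _ _ leb f `[0, 1]%classic _ a (a - 1) (a + 1) Ia _ _ (fun=> C) _ _ _.
have -> : \int[leb]_(y in `[0, 1]) partial1of2 f a y = cube_int (fun r => w r * r ^+ 3) ('D_1 phi) a.
  by apply: eq_Rintegral => r _; rewrite d1f.
move=> H; suff c : h^-1 *: ((cube_int w phi \o shift a) (h *: 1) - cube_int w phi a)
    @[h --> 0^'] --> cube_int (fun r => w r * r ^+ 3) ('D_1 phi) a.
  by apply: DeriveDef; [apply/cvg_ex; eexists; exact: c|exact: cvg_lim c].
have -> : (fun h : R => h^-1 *: ((cube_int w phi \o shift a) (h *: 1) - cube_int w phi a)) =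
  (fun h : R => h^-1 *: (\int[leb]_(y in `[0, 1]) f (h + a) y - \int[leb]_(y in `[0, 1]) f a y)).
  by apply/funext => h /=; rewrite [h *: 1]mulr1.
apply: H => //.
all: first [ by move=> t r _ _; case: (df t r)
           | by move=> t r tI rI; rewrite d1f; apply: HC
           | by apply: continuous_integrable_itv => x; exact: cvg_cst
           | by move=> x _; apply: continuous_integrable_itv; exact: cube_integrand_continuous ].
Qed.

Lemma cube_int_Ck k (w phi : R -> R) : continuous w -> Ck k setT phi ->
  Ck k setT (cube_int w phi).
Proof.
elim: k w phi => [|k IH] w phi cw cphi.
  by apply: continuous_Ck0; apply: cube_int_continuous => //; exact: Ck_setT_continuous cphi.
split=> [x _|]; first by apply: cube_int_continuous => //; exact: Ck_setT_continuous cphi.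
have cphi1 : Ck 1 setT phi by exact: Ck_le cphi.
have d x v := is_derive1_dir v (cube_int_is_derive x cw cphi1).
split=> [x v _|v]; first by case: (d x v).
apply: (@Ck_eq _ _ _ setT (fun x => v * cube_int (fun r => w r * r ^+ 3) ('D_1 phi) x)) => //.
- exact: openT.
- by move=> x _; case: (d x v).
- apply: CkM; [exact: openT|exact: Ck_cst|]; apply: IH; last exact: (Ck_derive (1 : R) cphi).
  exact: continuous_mulX3.
Qed.

(** The kernel s^(-1/3) in the definition of [f]. *)
Definition pow13 (s : R) : R := s `^ (- 3^-1).

Lemma continuous_pow13 s : 0 < s -> {for s, continuous pow13}.
Proof.
move=> s0; apply: differentiable_continuous; apply/derivable1_diffP.
by apply: derivable_powR; rewrite in_itv /= s0.
Qed.

(** Under s = t r^3 the singular kernel times the Jacobian 3 t r^2 becomes 3 t^(2/3) r, which is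
    continuous down to r = 0. *)
Lemma pow13_cube (t r : R) : 0 < t -> 0 < r ->
  pow13 (t * r ^+ 3) * (3 * t * r ^+ 2) = t `^ (2 / 3) * (3 * r).
Proof.
move=> t0 r0; rewrite /pow13 powRM ?ltW ?exprn_gt0 //.
rewrite -powR_mulrn ?ltW // -powRrM.
have -> : 3%:R * - 3^-1 = -1 :> R by field.
rewrite -[t in 3 * t](powRr1 (ltW t0)).
have -> : t `^ (2 / 3) = t `^ (- 3^-1) * t `^ 1.
  by rewrite -powRD; [congr (_ `^ _); field|rewrite (gt_eqF t0) implybT].
rewrite (powR_inv1 (ltW r0)) (powRr1 (ltW t0)); field.
exact: lt0r_neq0.
Qed.

(** The change of variables is made away from 0, where the kernel is continuous; the lower end is
    sent to 0 afterwards. *)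
Lemma substitution_cube (phi : R -> R) (t e : R) : continuous phi -> 0 < t -> 0 < e <= 1 ->
  integral leb `[t * e ^+ 3, t] (fun s => (phi s * pow13 s)%:E) =
  integral leb `[e, 1] (fun r => (t `^ (2 / 3) * (3 * r * phi (t * r ^+ 3)))%:E).
Proof.
move=> cphi t0 /andP[e0 e1]; pose f (r : R) := t * r ^+ 3.
have cf : continuous f.
  apply: (@Ck_setT_continuous _ 0); apply: CkM; [exact: openT|exact: Ck_cst|].
  by apply: CkX; [exact: openT|exact: Ck_id].
have df : f^`()%classic = (fun r => 3 * t * r ^+ 2).
  apply/funext => r; rewrite derive1E.
  have d1 := is_deriveM_fun (is_derive_cst t r 1) (is_deriveX 3 (is_derive_id r (1 : R))).
  have [_ ->] := d1.
  rewrite /GRing.scale /=; ring.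
have cdf : continuous (f^`()%classic : R -> R).
  rewrite df; apply: (@Ck_setT_continuous _ 0); apply: CkM; [exact: openT|exact: Ck_cst|].
  by apply: CkX; [exact: openT|exact: Ck_id].
have f1 : t = f 1 by rewrite /f expr1n mulr1.
transitivity (integral leb `[f e, f 1] (fun s => (phi s * pow13 s)%:E)); first by rewrite -f1.
rewrite (@integration_by_substitution_increasing _ f (fun s => phi s * pow13 s)) //.
- apply: eq_integral => r; rewrite inE /= in_itv /= => /andP[er r1].
  have r0 : 0 < r by exact: lt_le_trans er.
  congr EFin; rewrite /= mulrA -pow13_cube // df /f.
  by rewrite fctE /=; ring.
- move=> x y; rewrite !in_itv /= => /andP[ex _] _ xy.
  by rewrite /f ltr_pM2l // ltrXn2r // (le_trans (ltW e0)).
- by apply/cvg_ex; eexists; apply: cvg_at_right_filter; exact: cdf.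
- by apply/cvg_ex; eexists; apply: cvg_at_left_filter; exact: cdf.
- split.
  + by move=> x _; case: (is_deriveM_fun (is_derive_cst t x 1) (is_deriveX 3 (is_derive_id x (1 : R)))).
  + by apply: cvg_at_right_filter; exact: cf.
  + by apply: cvg_at_left_filter; exact: cf.
- apply: continuous_in_subspaceT => x; rewrite inE /= in_itv /= => /andP[fx _].
  apply: cvgM; first exact: cphi.
  by apply: continuous_pow13; apply: lt_le_trans fx; rewrite mulr_gt0 // exprn_gt0.
Qed.

Lemma bigcup_shrink (t : R) : 0 < t ->
  \bigcup_n `[t * (n.+1%:R^-1) ^+ 3, t]%classic = `]0, t]%classic.
Proof.
move=> t0; apply/seteqP; split=> s /=.
  move=> [n _]; rewrite /= !in_itv /= => /andP[ns ->]; rewrite andbT.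
  by apply: lt_le_trans ns; rewrite mulr_gt0 // exprn_gt0 // invr_gt0 ltr0n.
rewrite in_itv /= => /andP[s0 st].
have [n Hn] : exists n : nat, (n.+1%:R)^-1 < s / t.
  have st0 : 0 < s / t by rewrite divr_gt0.
  by have [k Hk] := ltr_add_invr st0; exists k; rewrite add0r in Hk.
exists n => //=; rewrite in_itv /= st andbT.
have n1 : (n.+1%:R : R)^-1 <= 1 by rewrite invf_le1 ?ltr0n // ler1n.
have n0 : 0 <= (n.+1%:R : R)^-1 by rewrite invr_ge0 ler0n.
rewrite mulrC -ler_pdivlMr //; apply: le_trans (ltW Hn).
by rewrite -[leRHS]expr1; apply: ler_wiXn2l.
Qed.

Lemma measurable_pow13 (phi : R -> R) (D : set R) : continuous phi ->
  measurable_fun D (fun s => phi s * pow13 s).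
Proof.
move=> cphi; apply: measurable_funTS; apply: measurable_funM.
  exact: continuous_measurable_fun.
exact: measurable_powR.
Qed.

Definition cube_integrand (t : R) (phi : R -> R) (r : R) : R :=
  t `^ (2 / 3) * (3 * r * phi (t * r ^+ 3)).

Lemma continuous_cube_integrand t phi : continuous phi -> continuous (cube_integrand t phi).
Proof.
move=> cphi; apply: (@Ck_setT_continuous _ 0); apply: CkM; [exact: openT|exact: Ck_cst|].
apply: continuous_Ck0; apply: (@cube_integrand_continuous (fun r => 3 * r)) => //.
apply: (@Ck_setT_continuous _ 0); apply: CkM; [exact: openT|exact: Ck_cst|exact: Ck_id].
Qed.

Lemma integrable_cube_integrand t phi : continuous phi ->
  leb.-integrable `]0, 1] (EFin \o cube_integrand t phi).
Proof.
move=> cphi; have := continuous_integrable_itv 0 1 (continuous_cube_integrand (t := t) cphi).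
by apply: integrableS => //; move=> s /=; rewrite !in_itv /= => /andP[/ltW -> ->].
Qed.

(** The half-open intervals are exhausted by the closed ones with e = 1/(n+1), and for non-negative
    [phi] both sides converge monotonically. *)
Lemma ge0_integral_cube (phi : R -> R) (t : R) : continuous phi -> (forall s, 0 <= phi s) -> 0 < t ->
  integral leb `]0, t] (fun s => (phi s * pow13 s)%:E) =
  integral leb `]0, 1] (EFin \o cube_integrand t phi).
Proof.
move=> cphi phi0 t0; have e0 n : 0 < (n.+1%:R : R)^-1 <= 1.
  by rewrite invr_gt0 ltr0n /= invf_le1 ?ltr0n // ler1n.
have le_e n m : (n <= m)%N -> (m.+1%:R : R)^-1 <= n.+1%:R^-1.
  by move=> nm; rewrite lef_pV2 ?posrE ?ltr0n // ler_nat.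
pose A n := `[t * (n.+1%:R^-1) ^+ 3, t]%classic : set R.
pose B n := `[n.+1%:R^-1, 1]%classic : set R.
have cA : (integral leb (A n) (fun s => (phi s * pow13 s)%:E)) @[n --> \oo] -->
    integral leb `]0, t] (fun s => (phi s * pow13 s)%:E).
  rewrite -bigcup_shrink //; apply: ge0_nondecreasing_set_cvg_integral.
  - move=> n m nm; apply/subsetPset => s; rewrite /A /= !in_itv /= => /andP[ns ->].
    rewrite andbT; apply: le_trans ns; rewrite ler_pM2l //.
    by apply: lerXn2r; rewrite ?nnegrE ?invr_ge0 ?ler0n //; exact: le_e.
  - by move=> n; exact: measurable_itv.
  - by move=> n; apply/measurable_EFinP; exact: measurable_pow13.
  - by move=> n s _; rewrite lee_fin mulr_ge0 // powR_ge0.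
have cB : (integral leb (B n) (EFin \o cube_integrand t phi)) @[n --> \oo] -->
    integral leb `]0, 1] (EFin \o cube_integrand t phi).
  have -> : `]0, 1]%classic = \bigcup_n B n.
    apply/seteqP; split=> s; last first.
      move=> [n _]; rewrite /B /= !in_itv /= => /andP[ns ->]; rewrite andbT.
      by apply: lt_le_trans ns; case/andP: (e0 n).
    rewrite /= in_itv /= => /andP[s0 s1]; have [k] := ltr_add_invr s0.
    by rewrite add0r => Hk; exists k => //; rewrite /B /= in_itv /= s1 ltW.
  apply: ge0_nondecreasing_set_cvg_integral.
  - move=> n m nm; apply/subsetPset => s; rewrite /B /= !in_itv /= => /andP[ns ->].
    by rewrite andbT; apply: le_trans ns; exact: le_e.
  - by move=> n; exact: measurable_itv.
  - move=> n; apply/measurable_EFinP; apply: measurable_funTS.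
    by apply: continuous_measurable_fun; exact: continuous_cube_integrand.
  - move=> n r; rewrite /B /= in_itv /= => /andP[nr _]; rewrite lee_fin.
    have r0 : 0 <= r by apply: le_trans nr; apply: ltW; case/andP: (e0 n).
    by rewrite /cube_integrand !mulr_ge0 // powR_ge0.
have AB n : integral leb (A n) (fun s => (phi s * pow13 s)%:E) =
   integral leb (B n) (EFin \o cube_integrand t phi).
  exact: substitution_cube.
move: cA; under eq_fun do rewrite AB.
by move=> cA; apply: (cvg_unique _ cA cB); exact: ereal_hausdorff.
Qed.

(** Applied to |phi|, the substitution turns the improper integral into that of a continuous
    function on a bounded interval. *)
Lemma integrable_pow13 (phi : R -> R) (t : R) : continuous phi -> 0 < t ->
  leb.-integrable `]0, t] (EFin \o (fun s => phi s * pow13 s)).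
Proof.
move=> cphi t0; apply/integrableP; split.
  by apply/measurable_EFinP; exact: measurable_pow13.
have cn : continuous (fun s => `|phi s|) by move=> s; apply: cvg_norm; exact: cphi.
have -> : (fun s => abse ((EFin \o (fun s : R => (phi s * pow13 s)%R)) s)) =
    (fun s => (`|phi s| * pow13 s)%:E).
  by apply/funext => s /=; rewrite normrM (ger0_norm (powR_ge0 _ _)).
rewrite ge0_integral_cube //.
have /integrableP [_] := integrable_cube_integrand t cn.
apply: le_lt_trans; apply: ge0_le_integral => //.
- move=> r; rewrite /= in_itv /= => /andP[r0 _].
  by rewrite lee_fin /cube_integrand !mulr_ge0 ?powR_ge0 // ltW.
- apply/measurable_EFinP; apply: measurable_funTS.
  by apply: continuous_measurable_fun; exact: continuous_cube_integrand.
- apply: measurableT_comp => //; apply/measurable_EFinP; apply: measurable_funTS.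
  by apply: continuous_measurable_fun; exact: continuous_cube_integrand.
- by move=> r _ /=; rewrite lee_fin ler_norm.
Qed.

Lemma Rintegral_cube (phi : R -> R) (t : R) : continuous phi -> 0 < t ->
  \int[leb]_(s in `]0, t[) (phi s * pow13 s) = t `^ (2 / 3) * cube_int (fun r => 3 * r) phi t.
Proof.
move=> cphi t0; have ip := integrable_pow13 cphi t0.
rewrite Rintegral_itv_bndo_bndc; last first.
  by apply: integrableS ip => //; move=> s /=; rewrite !in_itv /= => /andP[-> /ltW ->].
(* Continuous positive and negative parts, since the improper substitution is available for
   non-negative functions. *)
pose pp s := (`|phi s| + phi s) / 2; pose pm s := (`|phi s| - phi s) / 2.
have cpp : continuous pp.
  by move=> s; apply: cvgM; [apply: cvgD; [apply: cvg_norm|]; exact: cphi|exact: cvg_cst].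
have cpm : continuous pm.
  by move=> s; apply: cvgM; [apply: cvgB; [apply: cvg_norm|]; exact: cphi|exact: cvg_cst].
have pp0 s : 0 <= pp s by rewrite /pp divr_ge0 // -lerBlDr sub0r -normrN ler_norm.
have pm0 s : 0 <= pm s by rewrite /pm divr_ge0 // subr_ge0 ler_norm.
have phiE s : phi s = pp s - pm s by rewrite /pp /pm; field.
have E1 : \int[leb]_(s in `]0, t]) (phi s * pow13 s) =
  \int[leb]_(s in `]0, t]) (pp s * pow13 s) - \int[leb]_(s in `]0, t]) (pm s * pow13 s).
  rewrite -RintegralB //; [|exact: integrable_pow13..].
  by apply: eq_Rintegral => s _; rewrite phiE mulrBl.
have E2 : \int[leb]_(r in `]0, 1]) cube_integrand t phi r =
  \int[leb]_(r in `]0, 1]) cube_integrand t pp r - \int[leb]_(r in `]0, 1]) cube_integrand t pm r.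
  rewrite -RintegralB //; [|exact: integrable_cube_integrand..].
  by apply: eq_Rintegral => s _; rewrite /cube_integrand phiE; ring.
have E3 (psi : R -> R) : continuous psi -> (forall s, 0 <= psi s) ->
    \int[leb]_(s in `]0, t]) (psi s * pow13 s) = \int[leb]_(r in `]0, 1]) cube_integrand t psi r.
  by move=> cpsi psi0; rewrite /Rintegral; congr fine; exact: ge0_integral_cube.
rewrite E1 !E3 // -E2 Rintegral_itv_obnd_cbnd; last exact: integrable_cube_integrand.
rewrite /cube_int -RintegralZl //.
apply: continuous_integrable_itv; apply: (@cube_integrand_continuous (fun r => 3 * r)) => //.
apply: (@Ck_setT_continuous _ 0); apply: CkM; [exact: openT|exact: Ck_cst|exact: Ck_id].
Qed.

End CubeIntegral.

(** * The smooth extension agrees with f and with its one-sided derivative *)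

Section ExtendedF.
Variables (R : realType) (F G : R -> R).
Hypothesis sG : smooth_on [set: R] G.
Hypothesis GF : forall t, 0 <= t -> G t = F t.

(* The substitution s = t r^3 turns f(t) into - t times the integral of 3 r F'(t r^3)
   over 0 <= r <= 1, which is smooth across t = 0. *)
Definition f_ext (t : R) : R := - (t * cube_int (fun r => 3 * r) ('D_1 G) t).

Lemma f_ext_Ck k : Ck k setT f_ext.
Proof.
apply: CkN; first exact: openT.
apply: CkM; [exact: openT|exact: Ck_id|].
apply: cube_int_Ck.
  apply: (@Ck_setT_continuous _ 0); apply: CkM; [exact: openT|exact: Ck_cst|exact: Ck_id].
by apply: (Ck_derive (1 : R)); have /smooth_on_Ck := sG; apply.
Qed.

Lemma f_of_ext t : 0 <= t -> f_of F t = f_ext t.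
Proof.
rewrite le_eqVlt => /orP[/eqP <-|t0].
  (* At t = 0 both sides vanish, as [powR] gives 0 for the cube root of 0. *)
  by rewrite /f_of /f_ext powR0 ?mulr0 ?mul0r ?oppr0 // invr_eq0.
have /smooth_on_Ck sGk := sG.
have cG : continuous ('D_1 G) := Ck_setT_continuous (Ck_derive (1 : R) (sGk 1%N)).
have -> : f_of F t = - (\int[lebesgue_measure]_(s in `]0, t[) ('D_1 G s * pow13 s)) * t `^ (3^-1).
  rewrite /f_of; set I1 := Rintegral _ _ _; set I2 := Rintegral _ _ _.
  suff -> : I1 = I2 by [].
  apply: eq_Rintegral => s; rewrite inE /= in_itv /= => /andP[s0 _].
  suff -> : derive1 F s = 'D_1 G s by [].
  (* [G] agrees with [F] on the closed half-line; the derivatives are compared at s > 0, where the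
     agreement holds on a neighbourhood. *)
  rewrite derive1E; have os := @open_gt R 0.
  exact (derive_near (1 : R) os s0 (fun y (y0 : 0 < y) => esym (GF (ltW y0)))).
rewrite (Rintegral_cube cG t0) /f_ext mulNr; congr (- _).
rewrite mulrAC -powRD ?(gt_eqF t0) ?implybT //.
have -> : 2 / 3 + 3^-1 = 1 :> R by field.
by rewrite powRr1 // ltW.
Qed.

(** Only increments h > 0 are compared, for which t + h stays in the half-line; this covers t = 0,
    the zeros of q. *)
Lemma rderiv_f_of t : 0 <= t -> rderiv (f_of F) t = 'D_1 f_ext t.
Proof.
move=> t0; have d := Ck_is_derive (1 : R) (f_ext_Ck 1) (I : setT t).
have [df _] := d.
have E : (fun h : R => h^-1 *: ((f_ext \o shift t) (h *: 1) - f_ext t)) =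
      (fun h : R => h^-1 * (f_ext (t + h) - f_ext t)).
  apply/funext => h; have hA : h *: 1 = h :> R by rewrite /GRing.scale /= mulr1.
  by rewrite /= hA [h + t]addrC.
have c : h^-1 * (f_ext (t + h) - f_ext t) @[h --> (0 : R)^'+] --> 'D_1 f_ext t.
  by rewrite -E; exact: (cvg_dnbhs_at_right df).
have nE : {near (0 : R)^'+, (fun h => h^-1 * (f_ext (t + h) - f_ext t)) =1
                            (fun h => h^-1 * (f_of F (t + h) - f_of F t))}.
  apply: (filterS _ (nbhs_right_gt (0 : R))) => h /= h0.
  by rewrite (f_of_ext t0) (f_of_ext (addr_ge0 t0 (ltW h0))).
exact: (cvg_lim (@Rhausdorff R) (cvg_trans (near_eq_cvg nE) c)).
Qed.

End ExtendedF.

(** * Integration on the surface *)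

Section DensityTransfer.
Import HBNNSimple.
Variables (d1 d2 : measure_display) (T1 : measurableType d1) (T2 : measurableType d2).
Variables (R : realType) (mu : {measure set T1 -> \bar R}) (nu : {measure set T2 -> \bar R}).
Variables (D : set T1) (D' : set T2) (g : T2 -> T1) (w : T2 -> R).
Hypothesis mD : measurable D.
Hypothesis mD' : measurable D'.
Hypothesis mg : measurable_fun D' g.
Hypothesis gD : forall x, D' x -> D (g x).
Hypothesis mw : measurable_fun D' w.
Hypothesis w0 : forall x, D' x -> 0 <= w x.
Hypothesis muE : forall B, measurable B -> B `<=` D ->
  mu B = (\int[nu]_(x in D' `&` g @^-1` B) (w x)%:E)%E.

(** [muE] prescribes [mu] on sets only. Simple functions follow by linearity, non-negative functions
    by monotone convergence. *)
Lemma ge0_integral_density (f : T1 -> R) :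
  measurable_fun D f -> (forall y, D y -> 0 <= f y) ->
  (\int[mu]_(y in D) (f y)%:E = \int[nu]_(x in D') (f (g x) * w x)%:E)%E.
Proof.
move=> mf f0.
have mfE : measurable_fun D (EFin \o f) by exact/measurable_EFinP.
have f0E y : D y -> (0 <= (EFin \o f) y)%E by move=> Dy; rewrite lee_fin f0.
pose f_ := nnsfun_approx mD mfE.
have mcomp (h : {nnsfun T1 >-> R}) : measurable_fun D' (fun x => h (g x)).
  by apply: (@measurable_comp _ _ _ _ _ _ setT h D' g) => //; exact: measurable_funP.
transitivity (limn (fun n => \int[mu]_(x in D) (f_ n x)%:E))%E.
  rewrite -monotone_convergence//.
  - apply: eq_integral => y /[!inE] yD; apply/esym/cvg_lim => //.
    exact: cvg_nnsfun_approx.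
  - by move=> n; exact/measurable_EFinP/measurable_funTS/measurable_funP.
  - by move=> n y _; rewrite lee_fin.
  - by move=> y _ m n mn; rewrite lee_fin; exact/lefP/nd_nnsfun_approx.
transitivity (limn (fun n => \int[nu]_(x in D') (f_ n (g x) * w x)%:E))%E; last first.
  rewrite -monotone_convergence//.
  - apply: eq_integral => x /[!inE] xD; apply/cvg_lim => //.
    have -> : (fun n => (f_ n (g x) * w x)%:E) = (fun n => ((f_ n (g x))%:E * (w x)%:E)%E).
      by apply/funext => n; rewrite EFinM.
    rewrite EFinM; apply: cvgeZr => //; apply: (cvg_nnsfun_approx mD mfE f0E); exact: gD.
  - by move=> n; apply/measurable_EFinP/measurable_funM => //; exact: mcomp.
  - by move=> n x D'x; rewrite lee_fin mulr_ge0// w0.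
  - move=> x D'x m n mn; rewrite lee_fin ler_wpM2r ?w0//.
    exact/lefP/nd_nnsfun_approx.
congr (limn _); apply/funext => n; set h := f_ n.
have mh r : measurable (h @^-1` [set r]) by [].
have mB r : measurable (D `&` h @^-1` [set r]) by apply: measurableI.
have muB r : mu (D `&` h @^-1` [set r]) =
    (\int[nu]_(x in D') (w x * \1_(h @^-1` [set r]) (g x))%:E)%E.
  rewrite muE//.
  transitivity (\int[nu]_(x in D' `&` g @^-1` (h @^-1` [set r])) (w x)%:E)%E.
    congr (integral _ _ _); apply/seteqP; split => x /=.
      by case=> D'x [_ hx].
    by case=> D'x hx; split => //; split => //; exact: gD.
  rewrite integral_mkcondr; apply: eq_integral => x /[!inE] D'x.
  rewrite patchE indicE.
  have -> : (x \in g @^-1` (h @^-1` [set r])) = (g x \in h @^-1` [set r]).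
    by apply/idP/idP; rewrite !inE.
  by case: ifP; rewrite ?mulr1 ?mulr0.
transitivity (\sum_(k \in range h) (k%:E * mu (D `&` h @^-1` [set k])))%E.
  under eq_integral do rewrite fimfunE -fsumEFin//.
  rewrite ge0_integral_fsum//; last 2 first.
  - by move=> y; apply/measurable_EFinP/measurable_funM => //; exact/measurable_funTS.
  - by move=> y x _; rewrite nnfun_muleindic_ge0.
  apply: eq_fsbigr => r _; rewrite integralZl_indic_nnsfun// integral_indic//=.
  by rewrite setIC.
transitivity (\sum_(k \in range h)
    \int[nu]_(x in D') (k * (w x * \1_(h @^-1` [set k]) (g x)))%:E)%E.
  apply: eq_fsbigr => r /[!inE] -[y _ yr]; rewrite muB.
  have r0 : 0 <= r by rewrite -yr.
  rewrite -ge0_integralZl//.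
  - by apply/measurable_EFinP/measurable_funM => //; exact: mcomp (indic_nnsfun R (mh r)).
  - by move=> x D'x; rewrite lee_fin mulr_ge0// ?w0.
rewrite -ge0_integral_fsum//.
- apply: eq_integral => x _; rewrite fsumEFin//; congr _%:E.
  rewrite [in RHS](fimfunE h) mulr_fsuml; apply: eq_fsbigr => r _.
  by rewrite [w x * _]mulrC mulrA.
- move=> r; apply/measurable_EFinP/measurable_funM => //; apply: measurable_funM => //.
  exact: mcomp (indic_nnsfun R (mh r)).
- move=> r x D'x; rewrite lee_fin mulrCA mulr_ge0// ?w0//.
  by have := nnfun_muleindic_ge0 h r (g x); rewrite lee_fin.
Qed.

Lemma integral_density (f : T1 -> R) : measurable_fun D f ->
  (\int[mu]_(y in D) (f y)%:E = \int[nu]_(x in D') (f (g x) * w x)%:E)%E.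
Proof.
move=> mf; rewrite integralE [RHS]integralE; congr (_ - _)%E.
- transitivity (\int[mu]_(y in D) (Num.max (f y) 0)%:E)%E.
    by apply: eq_integral => y _; rewrite funeposE EFin_max.
  rewrite ge0_integral_density.
  + apply: eq_integral => x /[!inE] D'x; rewrite funeposE -EFin_max; congr _%:E.
    by rewrite maxr_pMl ?w0// mul0r.
  + by apply: measurable_funrpos.
  + by move=> y _; rewrite le_max lexx orbT.
- transitivity (\int[mu]_(y in D) (Num.max (- f y) 0)%:E)%E.
    by apply: eq_integral => y _; rewrite funenegE EFin_max.
  rewrite ge0_integral_density.
  + apply: eq_integral => x /[!inE] D'x; rewrite funenegE -EFinN -EFin_max; congr _%:E.
    by rewrite maxr_pMl ?w0// mul0r mulNr.
  + by apply: measurable_funrneg.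
  + by move=> y _; rewrite le_max lexx orbT.
Qed.
End DensityTransfer.

(** * Measurability and integrals of derivatives in the plane *)

Section PlaneMeasure.
Variable R : realType.
Local Notation E := (R * R)%type.
Local Notation leb := (@lebesgue_measure R).
Local Notation leb2 := (leb \x leb)%E.

(** The plane carries the product sigma-algebra, so an open set has to be written as a countable
    union of boxes with rational ends. *)
Lemma open_measurable_plane (A : set E) : open A -> measurable A.
Proof.
move=> oA.
pose box (q : (rat * rat) * (rat * rat)) : set E :=
  `]ratr q.1.1, ratr q.1.2[%classic `*` `]ratr q.2.1, ratr q.2.2[%classic.
(* A box that is not contained in [A] contributes the empty set, so the union may run over all
   rational boxes. *)
have -> : A = \bigcup_q (box q `&` [set _ | box q `<=` A]).
  apply/seteqP; split => [x Ax|x [q _ [bx /(_ x bx)]]//].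
  have /nbhs_ballP[e /= e0 xA] : nbhs x A by exact: open_nbhs_nbhs.
  have H (t : R) : exists2 q : rat * rat, t \in `]ratr q.1, ratr q.2[ &
      forall s, s \in `]ratr q.1, ratr q.2[ -> `|t - s| < e.
    have [|q1] := @rat_in_itvoo R (t - e) t; first by rewrite ltrBlDr ltrDl.
    have [|q2] := @rat_in_itvoo R t (t + e); first by rewrite ltrDl.
    rewrite !in_itv /= => /andP[q2l q2r] /andP[q1l q1r].
    exists (q1, q2); rewrite /= ?in_itv /= ?q1r ?q2l// => s.
    by rewrite in_itv /= => /andP[s1 s2]; rewrite ltr_norml; apply/andP; split; lra.
  have [q1 xq1 Hq1] := H x.1; have [q2 xq2 Hq2] := H x.2.
  exists (q1, q2) => //; split; first by split.
  by move=> y [y1 y2]; apply: xA; split; [exact: Hq1|exact: Hq2].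
apply: countable_bigcupT_measurable => [|q]; first exact: countableP.
have [qA|qA] := pselect (box q `<=` A).
  have -> : [set _ : E | box q `<=` A] = setT by apply/seteqP; split.
  by rewrite setIT; apply: measurableX; exact: measurable_itv.
have -> : [set _ : E | box q `<=` A] = set0 by apply/seteqP; split.
by rewrite setI0.
Qed.

Lemma measurable_fun_preimage_open (d : measure_display) (T : measurableType d)
    (f : T -> R) (D : set T) :
  (forall B : set R, open B -> measurable (D `&` f @^-1` B)) -> measurable_fun D f.
Proof.
move=> H; apply: (measurability (@RGenOpens.G R)).
  exact: RGenOpens.measurableE.
by move=> _ [_ [a [b ->]] <-]; apply: H; exact: interval_open.
Qed.

Lemma open_preimage (T : topologicalType) (f : T -> R) (D : set T) (B : set R) : open D ->
  (forall x, D x -> {for x, continuous f}) -> open B -> open (D `&` f @^-1` B).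
Proof.
move=> oD cf oB; rewrite openE => x [Dx fx]; near=> y; split.
  by near: y; exact: open_nbhs_nbhs.
by near: y; apply: (cf x Dx); apply: open_nbhs_nbhs.
Unshelve. all: by end_near.
Qed.

Lemma continuous_measurable_plane (f : E -> R) (D : set E) : open D ->
  (forall x, D x -> {for x, continuous f}) -> measurable_fun D f.
Proof.
move=> oD cf; apply: measurable_fun_preimage_open => B oB.
apply: open_measurable_plane; exact: (open_preimage oD cf oB).
Qed.

Definition sqr_box (a : R) : set E := `[- a, a]%classic `*` `[- a, a]%classic.

Lemma sqr_box_compact a : compact (sqr_box a).
Proof. by apply: compact_setX; exact: segment_compact. Qed.

Lemma box_integrable (f : E -> R) (a : R) : (forall x, {for x, continuous f}) ->
  (forall x, ~ sqr_box a x -> f x = 0) -> leb2.-integrable setT (EFin \o f).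
Proof.
move=> cf f0.
have mB : measurable (sqr_box a) by apply: measurableX; exact: measurable_itv.
have -> : EFin \o f = (EFin \o f) \_ (sqr_box a).
  apply/funext => x; rewrite patchE; case: ifPn => //.
  by rewrite notin_setE => /f0 /= ->.
apply: (proj1 (@integrable_mkcond _ _ R leb2 _ (EFin \o f) mB)).
apply: measurable_bounded_integrable => //.
- rewrite [X in (X < _)%E](product_measure1E leb leb)//.
  have ltb : (leb `[(- a)%R, a]%classic < +oo)%E.
    rewrite (@lebesgue_measure_itv R `[(- a)%R, a]) /=.
    by case: ifP => _; rewrite ?ltry// -EFinB ltry.
  by rewrite lte_mul_pinfty// ge0_fin_numE.
- apply: (measurable_funS measurableT) => //.
  by apply: continuous_measurable_plane => // ; exact: openT.
- have cB : compact (f @` sqr_box a).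
    apply: continuous_compact; last exact: sqr_box_compact.
    by apply: continuous_subspaceT => x; exact: cf.
  have [N [_ HN]] := compact_bounded cB.
  exists N; split; first exact: num_real.
  move=> k Nk x Bx; apply: HN => //; by exists x.
Qed.

Lemma integral_derive_box (F F' : R -> R) (a : R) :
  (forall t : R, is_derive t 1 F (F' t)) -> continuous F' ->
  (forall t, a <= `|t| -> F t = 0) -> (\int[leb]_t (F' t)%:E = 0)%E.
Proof.
(* [b] is positive and strictly beyond [a], so [F] vanishes at both ends of [- b, b] and [F']
   vanishes outside. *)
move=> dF cF' F0; pose b := Num.max a 1 + 1.
have b0 : 0 < b by rewrite /b ltr_wpDl// le_max ler01 orbT.
have ab : a < b by rewrite /b ltr_pwDr// le_max lexx.
have cF (t : R) : F x @[x --> t] --> F t.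
  by apply: differentiable_continuous; apply/derivable1_diffP; case: (dF t).
have D0 t : a < `|t| -> F' t = 0.
  move=> at_; have oU : open [set s : R | a < `|s|].
    rewrite openE => s /= as_; near=> u.
    have : `|s - u| < `|s| - a by near: u; apply: nbhsx_ballx; rewrite subr_gt0.
    have := ler_distD u s 0; rewrite !subr0 /=; lra.
  have <- : 'D_1 F t = F' t by case: (dF t).
  rewrite (derive_near (1 : R) oU at_ (fun y Uy => F0 y (ltW Uy))).
  exact: derive_cst.
have -> : (\int[leb]_t (F' t)%:E)%E = integral leb `[- b, b] (fun t => (F' t)%:E).
  rewrite [RHS]integral_mkcond; apply: eq_integral => t _; rewrite patchE; case: ifPn => //.
  rewrite notin_setE /= in_itv /= => tb; rewrite D0//.
  apply: (lt_le_trans ab); rewrite leNgt ltr_norml; apply/negP => /andP[t1 t2].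
  by apply: tb; rewrite !ltW.
rewrite (@continuous_FTC2 _ _ F).
- by rewrite !F0 ?subee// ?normrN gtr0_norm// ltW.
- lra.
- by apply: continuous_subspaceT.
- split; first by move=> t _; case: (dF t).
  + by apply: cvg_at_right_filter; exact: cF.
  + by apply: cvg_at_left_filter; exact: cF.
- by move=> t _; rewrite derive1E; case: (dF t).
Unshelve. all: by end_near.
Qed.

Lemma derive_out_box (W : E -> R) (a : R) (v x : E) : (forall x, ~ sqr_box a x -> W x = 0) ->
  ~ sqr_box a x -> 'D_v W x = 0.
Proof.
move=> W0 nx; have oU : open (~` sqr_box a).
  rewrite openC; exact: compact_closed (@norm_hausdorff R E) (@sqr_box_compact a).
by rewrite (derive_near v oU nx W0); exact: derive_cst.
Qed.

Lemma is_derive_slice1 (W : E -> R) (t s d : R) :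
  is_derive ((t, s) : E) (1, 0) W d -> is_derive t 1 (fun r => W (r, s)) d.
Proof.
have e r : ((0, s) : E) + r *: (1, 0) = (r, s) by vec.
rewrite -(e t) => /is_derive_line; suff -> : (fun r => W ((0, s) + r *: (1, 0))) = (fun r => W (r, s)) by [].
by apply/funext => r; rewrite e.
Qed.

Lemma is_derive_slice2 (W : E -> R) (t s d : R) :
  is_derive ((t, s) : E) (0, 1) W d -> is_derive s 1 (fun r => W (t, r)) d.
Proof.
have e r : ((t, 0) : E) + r *: (0, 1) = (t, r) by vec.
rewrite -(e s) => /is_derive_line; suff -> : (fun r => W ((t, 0) + r *: (0, 1))) = (fun r => W (t, r)) by [].
by apply/funext => r; rewrite e.
Qed.

(** Fubini lets the differentiated variable be integrated first; that inner integral vanishes by the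
    fundamental theorem of calculus. *)
Lemma integral_derive_plane (W : E -> R) (a : R) : Ck 1 setT W ->
  (forall x, ~ sqr_box a x -> W x = 0) ->
  (\int[leb2]_x ('D_(1, 0) W x)%:E = 0)%E /\ (\int[leb2]_x ('D_(0, 1) W x)%:E = 0)%E.
Proof.
move=> cW W0.
have cD v x : {for x, continuous ('D_v W)} by exact: Ck_continuous (Ck_derive v cW) I.
have iD v : leb2.-integrable setT (EFin \o 'D_v W).
  by apply: (box_integrable (a := a)) => // x; exact: derive_out_box.
have W0' x : `|a| + 1 <= `|x.1| \/ `|a| + 1 <= `|x.2| -> W x = 0.
  move=> H; apply: W0 => -[/=]; rewrite !in_itv /= -!ler_norml => h1 h2.
  by have := ler_norm a; case: H; lra.
split.
- rewrite -(@integral21_prod_meas1 _ _ _ _ _ leb leb _ (iD _)) /=.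
  apply: integral0_eq => s _; apply: (@integral_derive_box (fun t => W (t, s)) _ (`|a| + 1)).
  + by move=> t; apply: is_derive_slice1; exact: Ck_is_derive cW I.
  + move=> t; apply: (@continuous_comp _ _ _ (fun t => (t, s)) ('D_(1, 0) W)); last exact: cD.
    exact: (@cvg_pair _ _ _ _ _ _ _ _ _ _ _ (@cvg_id _ _) (@cvg_cst _ _ _ _ _)).
  + by move=> t ht; apply: W0'; left.
- rewrite -(@integral12_prod_meas1 _ _ _ _ _ leb leb _ (iD _)) /=.
  apply: integral0_eq => t _; apply: (@integral_derive_box (fun s => W (t, s)) _ (`|a| + 1)).
  + by move=> s; apply: is_derive_slice2; exact: Ck_is_derive cW I.
  + move=> s; apply: (@continuous_comp _ _ _ (fun s => (t, s)) ('D_(0, 1) W)); last exact: cD.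
    exact: (@cvg_pair _ _ _ _ _ _ _ _ _ _ _ (@cvg_cst _ _ _ _ _) (@cvg_id _ _)).
  + by move=> s hs; apply: W0'; right.
Qed.
End PlaneMeasure.

(** * Bump functions *)

Section Bump.
Variable R : realType.
Local Notation E := (R * R)%type.

(* max(s, 0)^2, a C^1 cut-off. *)
Definition pos_sq (s : R) : R := (s ^+ 2 + s * `|s|) / 2.

Lemma pos_sq_ge0 s : 0 <= pos_sq s.
Proof.
rewrite /pos_sq; have [s0|s0] := leP 0 s.
  by rewrite ger0_norm// divr_ge0// addr_ge0 ?sqr_ge0// mulr_ge0.
by rewrite ltr0_norm// mulrN -expr2 subrr mul0r.
Qed.

Lemma pos_sq_gt0 s : 0 < s -> 0 < pos_sq s.
Proof. by move=> s0; rewrite /pos_sq gtr0_norm// divr_gt0// addr_gt0// ?exprn_gt0// mulr_gt0. Qed.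

Lemma pos_sq_le0 s : s <= 0 -> pos_sq s = 0.
Proof. by move=> s0; rewrite /pos_sq ler0_norm// mulrN -expr2 subrr mul0r. Qed.

(** Away from 0 the function is a signed square; at 0 its difference quotient is |h|. *)
Lemma is_derive_mul_norm (s : R) : is_derive s 1 (fun u : R => u * `|u|) (2 * `|s|).
Proof.
have [s0|s0|->] := ltgtP s 0.
- have d := is_deriveN_fun (is_deriveM_fun (is_derive_id s 1) (is_derive_id s 1)).
  have e : forall u, [set u : R | u < 0] u -> - (u * u) = u * `|u|.
    by move=> u /= u0; rewrite ltr0_norm// mulrN.
  have d2 := is_derive_near (g := fun u : R => u * `|u|) (@open_lt R 0) s0 e d.
  apply: (is_derive_eq d2).
  by rewrite ltr0_norm//; ring.
- have d := is_deriveM_fun (is_derive_id s 1) (is_derive_id s 1).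
  have e : forall u, [set u : R | 0 < u] u -> u * u = u * `|u|.
    by move=> u /= u0; rewrite gtr0_norm.
  have d2 := is_derive_near (g := fun u : R => u * `|u|) (@open_gt R 0) s0 e d.
  apply: (is_derive_eq d2).
  by rewrite gtr0_norm//; ring.
- rewrite normr0 mulr0; suff c : h^-1 *: (((fun u : R => u * `|u|) \o shift 0) (h *: 1) - (0 : R) * `|0 : R|)
      @[h --> (0 : R)^'] --> (0 : R).
    by apply: DeriveDef; [apply/cvg_ex; eexists; exact: c|exact: cvg_lim c].
  have c0 : `|h| @[h --> (0 : R)^'] --> (0 : R).
    rewrite -[X in _ --> X](@normr0 _ R); apply: cvg_norm.
    exact: cvg_within.
  apply: cvg_trans c0; apply: near_eq_cvg; near=> h.
  have h0 : h != 0 by near: h; exact: nbhs_dnbhs_neq.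
  by rewrite /= [h *: 1]mulr1 addr0 mul0r subr0 /GRing.scale /= mulrA mulVf// mul1r.
Unshelve. all: by end_near.
Qed.

Lemma pos_sq_Ck1 : Ck 1 setT pos_sq.
Proof.
have d (s : R) : is_derive s 1 pos_sq (s + `|s|).
  have d1 := is_deriveM_fun (is_derive_id s 1) (is_derive_id s 1).
  have d2 := is_deriveM_fun (is_deriveD_fun d1 (is_derive_mul_norm s)) (is_derive_cst (2^-1 : R) s 1).
  by apply: (is_derive_eq d2); rewrite /cst; field.
split=> [s _|].
  by apply: differentiable_continuous; apply/derivable1_diffP; case: (d s).
split=> [s v _|v]; first by case: (is_derive1_dir v (d s)).
have -> : 'D_v pos_sq = fun s => v * (s + `|s|).
  by apply/funext => s; case: (is_derive1_dir v (d s)).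
apply: continuous_Ck0 => s; apply: cvgM; first exact: cvg_cst.
by apply: cvgD; [exact: cvg_id|exact: norm_continuous].
Qed.

Definition bump (c : E) (r : R) (x : E) : R :=
  pos_sq (1 - ((x.1 - c.1) / r) ^+ 2) * pos_sq (1 - ((x.2 - c.2) / r) ^+ 2).

Definition cbox (c : E) (r : R) : set E := [set x | `|x.1 - c.1| <= r /\ `|x.2 - c.2| <= r].

Lemma bump_ge0 c r x : 0 <= bump c r x.
Proof. by rewrite mulr_ge0// pos_sq_ge0. Qed.

Lemma bump_gt0 c r : 0 < bump c r c.
Proof. by rewrite /bump !subrr mul0r expr0n subr0 mulr_gt0// pos_sq_gt0. Qed.

Lemma bump_eq0 c r x : 0 < r -> ~ cbox c r x -> bump c r x = 0.
Proof.
move=> r0 nx; have H (t : R) : ~ (`|t| <= r) -> pos_sq (1 - (t / r) ^+ 2) = 0.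
  move=> /negP; rewrite -ltNge => rt; apply: pos_sq_le0.
  rewrite subr_le0 -(real_normK (num_real _)) normrM normfV (gtr0_norm r0) exprn_ege1//.
  by rewrite ler_pdivlMr// mul1r ltW.
rewrite /bump; have [h1|h1] := pselect (`|x.1 - c.1| <= r); last by rewrite H// mul0r.
by rewrite [X in _ * X]H ?mulr0// => h2; apply: nx.
Qed.

Lemma bump_Ck1 (V : normedModType R) (U : set V) (T : V -> E) c r : open U ->
  Ck 1 U (fun x => (T x).1) -> Ck 1 U (fun x => (T x).2) -> Ck 1 U (fun x => bump c r (T x)).
Proof.
move=> oU c1 c2.
have H (a : R) (f : V -> R) : Ck 1 U f -> Ck 1 U (fun x => pos_sq (1 - ((f x - a) / r) ^+ 2)).
  move=> cf; apply: (Ck_comp (h := pos_sq) oU pos_sq_Ck1).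
  have c0 := CkB oU cf (Ck_cst 1 U a).
  have c1' := CkM oU c0 (Ck_cst 1 U r^-1).
  exact (CkB oU (Ck_cst 1 U 1) (CkX 2 oU c1')).
exact (CkM oU (H _ _ c1) (H _ _ c2)).
Qed.

Lemma cbox_compact c r : compact (cbox c r).
Proof.
have -> : cbox c r = `[c.1 - r, c.1 + r]%classic `*` `[c.2 - r, c.2 + r]%classic.
  by apply/seteqP; split => x; rewrite /cbox /setX /= !in_itv /= !ler_distl => -[].
by apply: compact_setX; exact: segment_compact.
Qed.

Lemma cbox_closed c r : closed (cbox c r).
Proof. exact: compact_closed (@norm_hausdorff R E) (@cbox_compact c r). Qed.

Lemma cbox_sqr_box c r : exists a, cbox c r `<=` sqr_box a.
Proof.
exists (`|c.1| + `|c.2| + r) => x [h1 h2]; split; rewrite /= in_itv /= -ler_norml.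
  have := ler_normD (x.1 - c.1) c.1; rewrite subrK; have := normr_ge0 c.2; lra.
have := ler_normD (x.2 - c.2) c.2; rewrite subrK; have := normr_ge0 c.1; lra.
Qed.

Lemma cbox_in_open (A : set E) c : open A -> A c -> exists2 r, 0 < r & cbox c r `<=` A.
Proof.
move=> oA Ac; have /nbhs_ballP[e /= e0 H] : nbhs c A by exact: open_nbhs_nbhs.
exists (e / 2); first by rewrite divr_gt0.
have e2 : e / 2 < e by lra.
move=> x [h1 h2]; apply: H; split; rewrite /ball /= distrC; exact: le_lt_trans e2.
Qed.

End Bump.

(** * A partition of unity subordinate to the charts *)

Section PartitionOfUnity.
Variables (R : realType) (M : ptopologicalType) (S : oriented_atlas R M).
Local Notation E := (R * R)%type.

Lemma chart_continuous (T : topologicalType) (a : M -> T) :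
  (forall (j : chart S) x, img j x -> {for x, continuous (a \o param j)}) -> continuous a.
Proof.
move=> ca m; set j := chart_at S m; have dm : dom j m := dom_chart_at S m.
have c1 := continuous_comp (Defs.coord_continuous dm) (ca j (Defs.coord j m) (ex_intro2 _ _ m dm erefl)).
rewrite /continuous_at -[in X in _ --> X](coordK dm).
apply: cvg_trans c1; apply: near_eq_cvg; near=> m' => /=.
rewrite coordK//; near: m'; apply: open_nbhs_nbhs; split => //; exact: dom_open.
Unshelve. all: by end_near.
Qed.

(** [coord i] has arbitrary values off [dom i], hence the explicit 0 there. *)
Definition chart_bump (i : chart S) (c : E) (r : R) (m : M) : R :=
  if `[< dom i m >] then bump c r (Defs.coord i m) else 0.

Section ChartBump.
Variables (i : chart S) (c : E) (r : R).
Hypothesis hM : hausdorff_space M.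
Hypothesis r0 : 0 < r.
Hypothesis cr : cbox c r `<=` img i.

Lemma param_cbox_closed : closed (param i @` cbox c r).
Proof.
apply: compact_closed => //; apply: continuous_compact; last exact: cbox_compact.
apply: continuous_in_subspaceT => x /[!inE] /cr ix; exact: param_continuous ix.
Qed.

Lemma chart_bump_ge0 m : 0 <= chart_bump i c r m.
Proof. by rewrite /chart_bump; case: ifP => // _; exact: bump_ge0. Qed.

Lemma chart_bump_supp m : chart_bump i c r m != 0 -> dom i m /\ cbox c r (Defs.coord i m).
Proof.
rewrite /chart_bump; case: asboolP => [dm|_]; last by rewrite eqxx.
move=> b0; split=> //; apply: contrapT => nb.
by move/eqP: b0; apply; exact: bump_eq0.
Qed.

(** Inside [dom i] this is a bump composed with a transition map. Outside, the image of the box is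
    compact and thus closed in the Hausdorff space [M], so the function vanishes on a whole
    neighbourhood. *)
Lemma chart_bump_Ck1 (j : chart S) : Ck 1 (img j) (chart_bump i c r \o param j).
Proof.
apply: Ck_local => x jx; have [m dm mx] := jx.
have pm : param j x = m by rewrite -mx coordK.
have [im|im] := pselect (dom i m).
  exists (overlap j i); first by exists m.
  have oO : open (overlap j i) by exact: overlap_open.
  have sT : smooth_on (overlap j i) (trans j i) by exact: trans_smooth.
  have c1 := proj1 (smooth_on_Ck _ _) (smooth_on_fst oO sT) 1%N.
  have c2 := proj1 (smooth_on_Ck _ _) (smooth_on_snd oO sT) 1%N.
  apply: (Ck_eq oO _ (bump_Ck1 c r oO c1 c2)) => y [m' [jm' im'] <-].
  by rewrite /trans /= /chart_bump coordK// asboolT.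
pose K := param i @` cbox c r.
have nK : (~` K) (param j x).
  rewrite pm => -[y /cr [m' dm' my] ym]; apply: im; rewrite -ym -my coordK//.
exists (img j `&` param j @^-1` (~` K)) => //.
have oU : open (img j `&` param j @^-1` (~` K)).
  rewrite openE => y [jy Ky]; apply: filterI.
    by apply: open_nbhs_nbhs; split=> //; exact: img_open.
  apply: (param_continuous jy); apply: open_nbhs_nbhs; split=> //.
  by rewrite openC; exact: param_cbox_closed.
apply: (Ck_eq oU _ (Ck_cst 1 _ 0)) => y [jy Ky]; apply/esym/eqP; apply: contrapT => /negP b0.
have [dy by_] := chart_bump_supp b0.
by apply: Ky; exists (Defs.coord i (param j y)) => //; exact: coordK.
Qed.
End ChartBump.

(** By compactness finitely many bumps have no common zero, and they are divided by their positive
    sum. The functions [chi k] are indexed by all points, but only those in [s] are summed. *)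
Lemma partition_of_unity : closed_connected M ->
  exists (s : seq M) (r : M -> R) (chi : M -> M -> R),
  [/\ forall k, cbox (Defs.coord (chart_at S k) k) (r k) `<=` img (chart_at S k),
      forall k m, chi k m != 0 ->
        dom (chart_at S k) m /\ cbox (Defs.coord (chart_at S k) k) (r k) (Defs.coord (chart_at S k) m),
      forall k (j : chart S), Ck 1 (img j) (chi k \o param j)
    & forall m, \sum_(k <- s) chi k m = 1].
Proof.
move=> [hM cM _]; pose c k := Defs.coord (chart_at S k) k.
have H k : exists r, 0 < r /\ cbox (c k) r `<=` img (chart_at S k).
  have [r r0 cr] := @cbox_in_open R _ (c k) (@img_open _ _ S (chart_at S k)) (ex_intro2 _ _ k (dom_chart_at S k) erefl).
  by exists r.
pose r k := projT1 (cid (H k)).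
have r0 k : 0 < r k by rewrite /r; case: cid => ? [].
have cr k : cbox (c k) (r k) `<=` img (chart_at S k) by rewrite /r; case: cid => ? [].
pose b k := chart_bump (chart_at S k) (c k) (r k).
have cb k : continuous (b k).
  apply: chart_continuous => j x jx; exact: Ck_continuous (chart_bump_Ck1 hM (r0 k) (cr k) j) jx.
have bk k : 0 < b k k.
  by rewrite /b /chart_bump asboolT; [exact: bump_gt0|exact: dom_chart_at].
have oU k : setT k -> open [set m | 0 < b k m].
  move=> _; have -> : [set m | 0 < b k m] = setT `&` (b k @^-1` [set t | 0 < t]) by rewrite setTI.
  apply: open_preimage; [exact: openT|move=> x _; exact: cb|exact: open_gt].
rewrite compact_cover in cM.
have [D' _ covD] := cM _ _ _ oU (fun m _ => ex_intro2 _ _ m I (bk m)).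
pose B m := \sum_(k <- finmap.enum_fset D') b k m.
have b0 k m : 0 <= b k m by exact: chart_bump_ge0.
have B0 m : 0 < B m.
  have [k kD bkm] := covD m I.
  rewrite /B (big_rem k)//=; apply: ltr_pwDl => //; exact: sumr_ge0.
exists (finmap.enum_fset D'), r, (fun k m => b k m / B m); split => //.
- move=> k m h; apply: chart_bump_supp => //; apply: contra h => /eqP b0'.
  by rewrite /b b0' mul0r.
- move=> k j; have oj := @img_open _ _ S j.
  have cbj k' := chart_bump_Ck1 hM (r0 k') (cr k') j.
  have cB : Ck 1 (img j) (B \o param j).
    exact (Ck_sum (finmap.enum_fset D') oj (fun k' => cbj k')).
  apply: (CkM oj (cbj k)).
  by apply: (CkV oj _ cB) => x _; rewrite /= gt_eqF.
- by move=> m; rewrite -mulr_suml -/(B m) divff// gt_eqF// B0.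
Qed.

End PartitionOfUnity.

(** * Integrals of functions supported in one chart *)

Section ChartIntegral.
Local Notation plane R := (measurableTypeR R * measurableTypeR R)%type.
Variables (R : realType) (M : ptopologicalType) (S : oriented_atlas R M).
Local Notation E := (R * R)%type.
Local Notation borelM := (g_sigma_algebraType (@open M)).
Local Notation leb := (@lebesgue_measure R).
Local Notation leb2 := (leb \x leb)%E.
Variables (rho : form2 S) (mu : {measure set borelM -> \bar R}).
Hypothesis rho_area : is_area_form rho.
Hypothesis mu_area : is_area_measure rho mu.

Lemma open_measurable_surface (A : set borelM) : @open M A -> measurable A.
Proof. by move=> oA; exact: sub_sigma_algebra. Qed.

Lemma continuous_measurable_surface (a : M -> R) : continuous a ->
  measurable_fun setT (a : borelM -> R).
Proof.
move=> ca; apply: measurable_fun_preimage_open => B oB.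
apply: open_measurable_surface; exact: (open_preimage (@openT M) (fun x _ => ca x) oB).
Qed.

Definition area (i : chart S) (x : E) : R := rho i x (1, 0) (0, 1).

Lemma area_gt0 i x : img i x -> 0 < area i x.
Proof. by case: rho_area => _ _ _ _; exact. Qed.

Lemma area_smooth i : smooth_on (img i) (area i).
Proof. by case: rho_area => _ _ s _ _; exact: s. Qed.

Variable i : chart S.

Lemma param_measurable : measurable_fun (img i) (param i : E -> borelM).
Proof.
apply: (@measurability _ _ E borelM (img i) (param i) (@open M)) => // _ [B oB <-].
apply: open_measurable_plane; rewrite openE => x [ix Bx]; apply: filterI.
  by apply: open_nbhs_nbhs; split=> //; exact: img_open.
by apply: (param_continuous ix); apply: open_nbhs_nbhs; split.
Qed.

Lemma mu_area_param (B : set borelM) : measurable B -> B `<=` dom i ->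
  mu B = (\int[leb2]_(x in img i `&` param i @^-1` B) (area i x)%:E)%E.
Proof.
move=> mB Bi; rewrite (mu_area mB Bi); congr (integral _ _ _); apply/seteqP; split.
  move=> _ [m Bm <-]; split; first by exists m => //; exact: Bi.
  by rewrite /= coordK//; exact: Bi.
by move=> _ [[m im <-]]; rewrite /= coordK// => Bm; exists m.
Qed.

Lemma img_param x : img i x -> dom i (param i x).
Proof. by move=> [m im <-]; rewrite coordK. Qed.

Variables (a : M -> R) (W : E -> R) (b : R).
Hypothesis ca : continuous a.
Hypothesis a0 : forall m, ~ dom i m -> a m = 0.
Hypothesis cW : forall x, {for x, continuous W}.
Hypothesis W0 : forall x, ~ sqr_box b x -> W x = 0.
Hypothesis WE : forall x, img i x -> W x = a (param i x) * area i x.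
Hypothesis Wout : forall x, ~ img i x -> W x = 0.

(** [W] is the product of [a] and the area density, extended by zero to the plane, where continuity
    and bounded support give integrability. *)
Lemma chart_integral : mu.-integrable setT (EFin \o (a : borelM -> R)) /\
  (\int[mu]_m (a m)%:E = \int[leb2]_x (W x)%:E)%E.
Proof.
have mD : measurable (dom i : set borelM) by apply: open_measurable_surface; exact: dom_open.
have mI : measurable (img i) by apply: open_measurable_plane; exact: img_open.
have mw : measurable_fun (img i) (area i).
  apply: continuous_measurable_plane; first exact: img_open.
  by move=> x ix; exact: smooth_on_continuous (@area_smooth i) ix.
have w0 x : img i x -> 0 <= area i x by move=> ix; exact/ltW/area_gt0.
have ma := continuous_measurable_surface ca.
have iW : leb2.-integrable setT (EFin \o W) := box_integrable cW W0.
pose leb2m : {measure set (plane R) -> \bar R} := leb2.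
(* Passage from the chart to the whole surface and the whole plane, used both for [a] and for its
   absolute value. *)
have T (f : borelM -> R) (V : E -> R) : (forall m, ~ dom i m -> f m = 0) ->
    (forall x, img i x -> V x = f (param i x) * area i x) -> (forall x, ~ img i x -> V x = 0) ->
    (\int[mu]_(m in dom i) (f m)%:E = \int[leb2]_(x in img i) (f (param i x) * area i x)%:E)%E ->
    (\int[mu]_m (f m)%:E = \int[leb2]_x (V x)%:E)%E.
  move=> f0 VE V0 H; transitivity (\int[mu]_(m in dom i) (f m)%:E)%E.
    rewrite [RHS]integral_mkcond; apply: eq_integral => m _; rewrite patchE.
    by case: ifPn => //; rewrite notin_setE => /f0 ->.
  rewrite H [LHS]integral_mkcond; apply: eq_integral => x _; rewrite patchE.
  case: ifPn => [/set_mem ix|]; first by rewrite VE.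
  by rewrite notin_setE => /V0 ->.
split.
  apply/integrableP; split; first exact/measurable_EFinP.
  have -> : (\int[mu]_x `|(EFin \o a) x| = \int[mu]_x (`|a x|)%:E)%E by apply: eq_integral.
  rewrite (T (fun m => `|a m|) (fun x => `|W x|)).
  - by have /integrableP[_] := iW; congr (_ < _)%E; apply: eq_integral.
  - by move=> m /a0 ->; rewrite normr0.
  - by move=> x ix; rewrite WE// normrM (ger0_norm (w0 _ ix)).
  - by move=> x /Wout ->; rewrite normr0.
  - apply: (@ge0_integral_density _ _ borelM (plane R) R mu leb2m _ _ _ _ mD mI param_measurable img_param mw w0 mu_area_param (fun m => `|a m|)) => //.
    by apply: measurable_funTS; apply: measurableT_comp.
apply: T => //.
apply: (@integral_density _ _ borelM (plane R) R mu leb2m _ _ _ _ mD mI param_measurable img_param mw w0 mu_area_param a).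
exact: measurable_funTS.
Qed.
End ChartIntegral.

(** * The divergence theorem on the closed surface *)

Section DivergenceTheorem.
Variables (R : realType) (M : ptopologicalType) (S : oriented_atlas R M).
Local Notation E := (R * R)%type.
Local Notation borelM := (g_sigma_algebraType (@open M)).
Local Notation leb := (@lebesgue_measure R).
Local Notation leb2 := (leb \x leb)%E.

Definition invariant (s : chart S -> E -> R) := forall i j x, overlap i j x ->
  s j (trans i j x) = s i x.

(** [on_surface] reads one chosen chart at each point; invariance allows it to be computed in any
    other. *)
Lemma on_surface_param s (j : chart S) x : invariant s -> img j x ->
  on_surface s (param j x) = s j x.
Proof.
move=> inv [m jm <-]; rewrite coordK// /on_surface.
have o : overlap j (chart_at S m) (Defs.coord j m) by exists m => //; split=> //; exact: dom_chart_at.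
by rewrite -(inv _ _ _ o) /trans /= coordK.
Qed.

Lemma on_surface_continuous s : invariant s ->
  (forall i x, img i x -> {for x, continuous (s i)}) -> continuous (on_surface s).
Proof.
move=> inv cs; apply: (chart_continuous (S := S)) => j x jx.
rewrite /prop_for /continuous_at /= (on_surface_param inv jx).
apply: cvg_trans (cs j x jx); apply: near_eq_cvg.
have jn : \forall y \near x, img j y by apply: open_nbhs_nbhs; split=> //; exact: img_open.
by apply: filterS jn => y jy; rewrite /= (on_surface_param inv jy).
Qed.

Lemma param_trans (i j : chart S) x : overlap i j x -> param j (trans i j x) = param i x.
Proof. by move=> [m [im jm] <-]; rewrite /trans /= !coordK. Qed.

Lemma extend0_Ck k (U : set E) (V : E -> R) c r : open U -> cbox c r `<=` U -> Ck k U V ->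
  (forall x, U x -> ~ cbox c r x -> V x = 0) ->
  Ck k setT (fun x => if `[< U x >] then V x else 0).
Proof.
move=> oU cU cV V0; apply: Ck_local => x _.
have [Ux|nU] := pselect (U x).
  by exists U => //; apply: (Ck_eq oU _ cV) => y Uy; rewrite asboolT.
have oC : open (~` cbox c r) by rewrite openC; exact: cbox_closed.
exists (~` cbox c r); first by move=> /cU.
apply: (Ck_eq oC _ (Ck_cst k _ 0)) => y ny; case: asboolP => // Uy.
by rewrite V0.
Qed.

Lemma is_derive_bigsum (V : normedModType R) (I : Type) (s : seq I) (f : I -> V -> R) x v (d : I -> R) :
  (forall k, is_derive x v (f k) (d k)) ->
  is_derive x v (fun y => \sum_(k <- s) f k y) (\sum_(k <- s) d k).
Proof.
move=> df; elim: s => [|k s IH].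
  rewrite big_nil; suff -> : (fun y => \sum_(k <- [::]) f k y) = cst 0 by exact: is_derive_cst.
  by apply/funext => y; rewrite big_nil.
rewrite big_cons; suff -> : (fun y => \sum_(l <- k :: s) f l y) = (fun y => f k y + \sum_(l <- s) f l y).
  exact: is_deriveD_fun.
by apply/funext => y; rewrite big_cons.
Qed.

Lemma integrable_bigsum (d : measure_display) (T : measurableType d) (nu : {measure set T -> \bar R})
    (I : Type) (s : seq I) (f : I -> T -> R) :
  (forall k, nu.-integrable setT (EFin \o f k)) ->
  nu.-integrable setT (EFin \o (fun m => \sum_(k <- s) f k m)) /\
  (\int[nu]_m (\sum_(k <- s) f k m)%R%:E = \sum_(k <- s) \int[nu]_m (f k m)%:E)%E.
Proof.
move=> If; elim: s => [|k s [IH1 IH2]].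
  have e : (EFin \o (fun m => \sum_(k <- [::]) f k m)) = cst 0%E.
    by apply/funext => m /=; rewrite big_nil.
  by rewrite e big_nil; split; [exact: integrable0|rewrite -[RHS](@integral0 _ _ _ nu setT); apply: eq_integral => m _; rewrite big_nil].
have e : (EFin \o (fun m => \sum_(l <- k :: s) f l m)) = ((EFin \o f k) \+ (EFin \o (fun m => (\sum_(l <- s) f l m)%R)))%E.
  by apply/funext => m /=; rewrite big_cons.
split; first by rewrite e; apply: integrableD.
rewrite big_cons -IH2.
have -> : (fun m => (\sum_(l <- k :: s) f l m)%R%:E) = ((EFin \o f k) \+ (EFin \o (fun m => (\sum_(l <- s) f l m)%R)))%E := e.
by rewrite integralD.
Qed.

Variables (rho : form2 S) (mu : {measure set borelM -> \bar R}).
Hypothesis rho_area : is_area_form rho.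
Hypothesis mu_area : is_area_measure rho mu.
Hypothesis M_closed : closed_connected M.

(** [is_area_measure] speaks only of sets inside one chart domain. Finiteness comes from writing 1
    as a finite sum of integrable functions with support in charts. *)
Lemma area_measure_finite : (mu setT < +oo)%E.
Proof.
have [s [r [chi [cr supp cchi chi1]]]] := partition_of_unity S M_closed.
have If k : mu.-integrable setT (EFin \o (chi k : borelM -> R)).
  set i := chart_at S k; set c := Defs.coord i k.
  have oi : open (img i) by exact: img_open.
  have sa := proj1 (smooth_on_Ck _ _) (area_smooth rho_area (i := i)) 0%N.
  have c0 := CkM oi (Ck_pred (cchi k i)) sa.
  have V0 x : img i x -> ~ cbox c (r k) x -> chi k (param i x) * area rho i x = 0.
    move=> ix nx; suff -> : chi k (param i x) = 0 by rewrite mul0r.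
    apply/eqP; apply: contrapT => /negP /supp[dm]; rewrite -/i -/c.
    by case: ix nx => m im <-; rewrite coordK.
  have cW := extend0_Ck oi (cr k) c0 V0.
  have [b cb] := cbox_sqr_box c (r k).
  apply: (proj1 (@chart_integral R M S rho mu rho_area mu_area i (chi k) _ b _ _ _ _ _ _)).
  - apply: (chart_continuous (S := S)) => j x jx; exact: Ck_continuous (cchi k j) jx.
  - by move=> m nm; apply/eqP; apply: contrapT => /negP /supp[].
  - by move=> x; exact: Ck_continuous cW I.
  - by move=> x nx /=; case: asboolP => // ix; rewrite V0// => /cb.
  - by move=> x ix /=; rewrite asboolT.
  - by move=> x ix /=; rewrite asboolF.
have [I1 _] := integrable_bigsum s If.
have e : EFin \o (fun m => \sum_(k <- s) chi k m) = cst 1%E.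
  by apply/funext => m /=; rewrite chi1.
move/integrableP: I1 => [_]; rewrite e.
have -> : (\int[mu]_x `|cst 1 x| = \int[mu]_x cst 1 x)%E.
  by apply: eq_integral => m _; rewrite /cst gee0_abs.
by rewrite integral_cst// mul1e.
Qed.

Lemma continuous_bounded_surface (a : M -> R) : continuous a -> exists C, forall m, `|a m| <= C.
Proof.
move=> ca; have [_ cM _] := M_closed.
have cB : compact (a @` setT) by apply: continuous_compact => //; exact: continuous_subspaceT.
have [N [_ HN]] := compact_bounded cB.
by exists (N + 1) => m; apply: (HN (N + 1)); [rewrite ltrDl|exists m].
Qed.

Lemma continuous_integrable_surface (a : M -> R) : continuous a ->
  mu.-integrable setT (EFin \o (a : borelM -> R)).
Proof.
move=> ca; apply: measurable_bounded_integrable => //.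
- exact: area_measure_finite.
- exact: continuous_measurable_surface.
- have [C HC] := continuous_bounded_surface ca.
  exists C; split; first exact: num_real.
  by move=> k Ck m _; apply: le_trans (HC m) (ltW Ck).
Qed.

Section PartialIntegral.
Variables (chi : M -> R) (psi : chart S -> E -> R) (Z : chart S -> E -> E).
Variables (i : chart S) (c : E) (r : R).
Hypothesis cr : cbox c r `<=` img i.
Hypothesis supp : forall m, chi m != 0 -> dom i m /\ cbox c r (Defs.coord i m).
Hypothesis cchi : forall j : chart S, Ck 1 (img j) (chi \o param j).
Hypothesis cZ1 : forall j : chart S, Ck 1 (img j) (fun x => (Z j x).1).
Hypothesis cZ2 : forall j : chart S, Ck 1 (img j) (fun x => (Z j x).2).
Hypothesis ZT : forall i j x, overlap i j x -> Z j (trans i j x) = 'D_(Z i x) (trans i j) x.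
Hypothesis psi_inv : invariant psi.
Hypothesis psiE : forall j x, img j x -> psi j x * area rho j x =
  'D_(1, 0) (fun y => area rho j y * (Z j y).1) x + 'D_(0, 1) (fun y => area rho j y * (Z j y).2) x.

Lemma area_Ck k (j : chart S) : Ck k (img j) (area rho j).
Proof. exact: (proj1 (smooth_on_Ck _ _) (area_smooth rho_area (i := j)) k). Qed.

Lemma div_continuous j x : img j x -> {for x, continuous (psi j)}.
Proof.
move=> jx; have oj : open (img j) by exact: img_open.
have c1 := Ck_derive ((1, 0) : E) (CkM oj (area_Ck 1 j) (cZ1 j)).
have c2 := Ck_derive ((0, 1) : E) (CkM oj (area_Ck 1 j) (cZ2 j)).
have a0 y : img j y -> area rho j y != 0 by move=> jy; rewrite gt_eqF// area_gt0.
have c3 := CkM oj (CkD oj c1 c2) (CkV oj a0 (area_Ck 0 j)).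
apply: (@Ck_continuous R _ 0%N (img j)) => //; apply: (Ck_eq oj _ c3) => y jy.
by rewrite -psiE// mulfK// a0.
Qed.

(* div(chi Z), to be summed over a partition of unity. *)
Definition cut_div (j : chart S) (x : E) : R :=
  chi (param j x) * psi j x + 'D_(Z j x) (chi \o param j) x.

Lemma cut_div_invariant : invariant cut_div.
Proof.
move=> j k x o; rewrite /cut_div (psi_inv o) (param_trans o) (ZT o); congr (_ + _).
have oo : open (overlap j k) by exact: overlap_open.
have kx : img k (trans j k x) by case: o => m [jm km] <-; exists m => //; rewrite /trans /= coordK.
have [dg _] := Ck1_diff (@img_open _ _ S k) kx (cchi k).
have d := derive_chain (Z j x) (trans_diff o) dg.
have e : forall y, overlap j k y -> ((chi \o param k) \o trans j k) y = (chi \o param j) y.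
  by move=> y oy; rewrite /= (param_trans oy).
by have [_ <-] := is_derive_near oo o e d.
Qed.

Lemma chi_derive (j : chart S) x v : img j x -> 'D_v (chi \o param j) x =
  v.1 * 'D_(1, 0) (chi \o param j) x + v.2 * 'D_(0, 1) (chi \o param j) x.
Proof. by move=> jx; have [_] := Ck1_diff (@img_open _ _ S j) jx (cchi j); exact. Qed.

Lemma cut_div_continuous j x : img j x -> {for x, continuous (cut_div j)}.
Proof.
move=> jx; have oj : open (img j) by exact: img_open.
have cp : Ck 0 (img j) (psi j) by split=> // y jy; exact: div_continuous.
have d v := Ck_derive (v : E) (cchi j).
have c1 := CkM oj (Ck_pred (cchi j)) cp.
have c2 := CkD oj (CkM oj (Ck_pred (cZ1 j)) (d (1, 0))) (CkM oj (Ck_pred (cZ2 j)) (d (0, 1))).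
apply: (@Ck_continuous R _ 0%N (img j)) => //; apply: (Ck_eq oj _ (CkD oj c1 c2)) => y jy.
by rewrite /cut_div (chi_derive (Z j y) jy).
Qed.

(** The derivative term vanishes too: [chi] is supported in a closed set contained in [dom i], so it
    is zero near [m]. *)
Lemma cut_div_out m : ~ dom i m -> on_surface cut_div m = 0.
Proof.
have [hM _ _] := M_closed.
move=> nm; set j := chart_at S m; set x := Defs.coord j m.
have jx : img j x by exists m => //; exact: dom_chart_at.
have pm : param j x = m by rewrite coordK//; exact: dom_chart_at.
pose U := img j `&` param j @^-1` (~` (param i @` cbox c r)).
have nK m' : (~` (param i @` cbox c r)) m' -> chi m' = 0.
  move=> H; apply/eqP; apply: contrapT => /negP /supp[dm' cm']; apply: H.
  by exists (Defs.coord i m') => //; rewrite coordK.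
have oU : open U.
  rewrite openE => y [jy Ky]; apply: filterI.
    by apply: open_nbhs_nbhs; split=> //; exact: img_open.
  apply: (param_continuous jy); apply: open_nbhs_nbhs; split=> //.
  by rewrite openC; exact: (param_cbox_closed hM cr).
have Ux : U x.
  split=> //; rewrite /preimage /= pm => -[y /cr [m' dm' my] ym].
  by apply: nm; rewrite -ym -my coordK.
rewrite /on_surface -/j -/x /cut_div pm.
have -> : chi m = 0 by apply: nK; rewrite -pm; case: Ux.
have e : forall y, U y -> (chi \o param j) y = 0 by move=> y [_ Ky]; exact: nK.
by rewrite (derive_near (Z j x) oU Ux e) mul0r add0r; exact: derive_cst.
Qed.

(** In the chart, the area density times div(chi Z) is the sum of the partial derivatives of the
    components of chi area Z. These extend by zero to C^1 functions on the plane, whose derivatives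
    integrate to zero. *)
Lemma cut_div_integral : mu.-integrable setT (EFin \o (on_surface cut_div : borelM -> R)) /\
  (\int[mu]_m (on_surface cut_div m)%:E = 0)%E.
Proof.
have oi : open (img i) by exact: img_open.
have V0 x : img i x -> ~ cbox c r x -> chi (param i x) = 0.
  move=> ix nx; apply/eqP; apply: contrapT => /negP /supp[dm].
  by case: ix nx => m im <-; rewrite coordK.
have V0' (f : E -> R) x : img i x -> ~ cbox c r x -> chi (param i x) * f x = 0.
  by move=> ix nx; rewrite V0// mul0r.
have c1 := CkM oi (cchi i) (CkM oi (area_Ck 1 i) (cZ1 i)).
have c2 := CkM oi (cchi i) (CkM oi (area_Ck 1 i) (cZ2 i)).
pose W1 x := if `[< img i x >] then chi (param i x) * (area rho i x * (Z i x).1) else 0.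
pose W2 x := if `[< img i x >] then chi (param i x) * (area rho i x * (Z i x).2) else 0.
have cW1 : Ck 1 setT W1 := extend0_Ck oi cr c1 (V0' (fun x => area rho i x * (Z i x).1)).
have cW2 : Ck 1 setT W2 := extend0_Ck oi cr c2 (V0' (fun x => area rho i x * (Z i x).2)).
have [b cb] := cbox_sqr_box c r.
have z1 x : ~ cbox c r x -> W1 x = 0 by move=> nx; rewrite /W1; case: asboolP => // ix; rewrite (V0 x ix nx) mul0r.
have z2 x : ~ cbox c r x -> W2 x = 0 by move=> nx; rewrite /W2; case: asboolP => // ix; rewrite (V0 x ix nx) mul0r.
have b1 x : ~ sqr_box b x -> W1 x = 0 by move=> nx; apply: z1 => /cb.
have b2 x : ~ sqr_box b x -> W2 x = 0 by move=> nx; apply: z2 => /cb.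
have oC : open (~` cbox c r) by rewrite openC; exact: cbox_closed.
have cD1 x : {for x, continuous ('D_(1, 0) W1)} by exact: Ck_continuous (Ck_derive ((1, 0) : E) cW1) I.
have cD2 x : {for x, continuous ('D_(0, 1) W2)} by exact: Ck_continuous (Ck_derive ((0, 1) : E) cW2) I.
pose W x := 'D_(1, 0) W1 x + 'D_(0, 1) W2 x.
have cW x : {for x, continuous W} by apply: cvgD; [exact: cD1|exact: cD2].
have WE x : img i x -> W x = on_surface cut_div (param i x) * area rho i x.
  move=> ix; rewrite (on_surface_param cut_div_invariant ix) /cut_div chi_derive//.
  have dchi v := Ck_is_derive v (cchi i) ix.
  have dA1 := Ck_is_derive ((1, 0) : E) (CkM oi (area_Ck 1 i) (cZ1 i)) ix.
  have dA2 := Ck_is_derive ((0, 1) : E) (CkM oi (area_Ck 1 i) (cZ2 i)) ix.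
  have e1 y : img i y -> W1 y = chi (param i y) * (area rho i y * (Z i y).1).
    by move=> iy; rewrite /W1 asboolT.
  have e2 y : img i y -> W2 y = chi (param i y) * (area rho i y * (Z i y).2).
    by move=> iy; rewrite /W2 asboolT.
  have [_ D1] := is_deriveM_fun (dchi (1, 0)) dA1.
  have [_ D2] := is_deriveM_fun (dchi (0, 1)) dA2.
  rewrite /W (derive_near ((1, 0) : E) oi ix e1) (derive_near ((0, 1) : E) oi ix e2).
  rewrite [X in X + _]D1 [X in _ + X]D2 mulrDl -mulrA psiE//=; ring.
have Wout x : ~ img i x -> W x = 0.
  move=> nx; have ncx : ~ cbox c r x by move=> /cr.
  rewrite /W (derive_near ((1, 0) : E) oC ncx z1) (derive_near ((0, 1) : E) oC ncx z2).
  by rewrite !derive_cst addr0.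
have W0 x : ~ sqr_box b x -> W x = 0.
  by move=> nx; rewrite /W (derive_out_box _ b1 nx) (derive_out_box _ b2 nx) addr0.
have [I1 I2] := @chart_integral R M S rho mu rho_area mu_area i (on_surface cut_div) W b
  (on_surface_continuous cut_div_invariant cut_div_continuous) cut_div_out cW W0 WE Wout.
split=> //; rewrite I2; have [H1 _] := integral_derive_plane cW1 b1; have [_ H2] := integral_derive_plane cW2 b2.
have i1 : leb2.-integrable setT (EFin \o 'D_(1, 0) W1).
  by apply: (box_integrable (a := b)) => // x; exact: derive_out_box.
have i2 : leb2.-integrable setT (EFin \o 'D_(0, 1) W2).
  by apply: (box_integrable (a := b)) => // x; exact: derive_out_box.
transitivity (\int[leb2]_x (('D_(1, 0) W1 x)%:E + ('D_(0, 1) W2 x)%:E))%E.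
  by apply: eq_integral => x _; rewrite EFinD.
by rewrite (integralD _ i1 i2)// [X in (X + _)%E]H1 [X in (_ + X)%E]H2 adde0.
Qed.
End PartialIntegral.

(** The divergences of the fields chi_k Z add up to that of Z, and each integrates to zero in its
    own chart. *)
Lemma divergence_theorem (psi : chart S -> E -> R) (Z : chart S -> E -> E) :
  (forall j : chart S, Ck 1 (img j) (fun x => (Z j x).1)) ->
  (forall j : chart S, Ck 1 (img j) (fun x => (Z j x).2)) ->
  (forall i j x, overlap i j x -> Z j (trans i j x) = 'D_(Z i x) (trans i j) x) ->
  invariant psi ->
  (forall j x, img j x -> psi j x * area rho j x =
    'D_(1, 0) (fun y => area rho j y * (Z j y).1) x + 'D_(0, 1) (fun y => area rho j y * (Z j y).2) x) ->
  (\int[mu]_m (on_surface psi m)%:E = 0)%E.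
Proof.
move=> cZ1 cZ2 ZT psi_inv psiE.
have [s [r [chi [cr supp cchi chi1]]]] := partition_of_unity S M_closed.
have H k := @cut_div_integral (chi k) psi Z (chart_at S k) (Defs.coord (chart_at S k) k) (r k)
  (cr k) (supp k) (cchi k) cZ1 cZ2 ZT psi_inv psiE.
have [_ H2] := integrable_bigsum s (fun k => proj1 (H k)).
have e m : on_surface psi m = \sum_(k <- s) on_surface (cut_div (chi k) psi Z) m.
  set i := chart_at S m; set x := Defs.coord i m.
  have ix : img i x by exists m => //; exact: dom_chart_at.
  rewrite /on_surface /cut_div big_split/= -mulr_suml chi1 mul1r -/i -/x.
  (* The derivative terms sum to the derivative of the constant 1. *)
  have d := is_derive_bigsum s (fun k => Ck_is_derive (Z i x) (cchi k i) ix).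
  have e1 : (fun y => \sum_(k <- s) (chi k \o param i) y) = cst 1.
    by apply/funext => y; rewrite /= chi1.
  move: d; rewrite e1 => -[_]; rewrite derive_cst => <-.
  by rewrite addr0.
transitivity (\int[mu]_m (\sum_(k <- s) on_surface (cut_div (chi k) psi Z) m)%R%:E)%E.
  by apply: eq_integral => m _; rewrite e.
by rewrite H2 big1// => k _; case: (H k).
Qed.

End DivergenceTheorem.

(** * The generator of the circle action *)

Section TangentAlgebra.
Variables (R : realType) (M : ptopologicalType) (S : oriented_atlas R M).
Local Notation E := (R * R)%type.
Variables (rho : form2 S) (p v X : pairJA S) (i : chart S) (x : E).
Variables (a b m n k l m' n' k' l' n1 n2 n3 pa pb : R) (N : E -> E) (P : E -> E -> E).
Local Notation J := (p.1 i).
Local Notation g := (gJ rho p i).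
Hypothesis H : hermitian_at x J g (rho i x).
Hypothesis FA : cubic_format x J (p.2 i x) a b.
Hypothesis Fv1 : Jdot_format x J (v.1 i x) m n.
Hypothesis Fv2 : Adot_format x J a b (v.2 i x) m n k l.
Hypothesis FX1 : Jdot_format x J (X.1 i x) m' n'.
Hypothesis FX2 : Adot_format x J a b (X.2 i x) m' n' k' l'.
Hypothesis FN : frmat J x N n1 n2 n3 (- n1).
Hypothesis FP : cubic_format x J P pa pb.
(* X = (0, - A J) + L_Y (J, A), with N = nabla Y and P = nabla_Y A. *)
Hypothesis hX1 : forall w, X.1 i x w = J x (N w) - N (J x w).
Hypothesis hX2 : forall u w z, g x (X.2 i x u w) z =
  - g x (p.2 i x u (J x w)) z + g x (P u w) z + g x (p.2 i x (N u) w) z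
  + g x (p.2 i x u (N w)) z + g x (p.2 i x u w) (N z).

(** [hX1] and [hX2], evaluated on frame vectors, are solved for the coordinates of [X]. The entry
    [- n1] of [N] records that Y is divergence free. *)
Lemma lie_coefficients :
  [/\ m' = - (n2 + n3), n' = 2 * n1, k' = - b + pa + 3 * (n1 * a + n3 * b)
    & l' = a + pb + n1 * b - 2 * n3 * a + n2 * a].
Proof.
have := hX1 (frv J x 1 0); rewrite FX1 (J_fr H) !FN (J_fr H) !frE => /(fr_inj H) [e1 e2].
have e3 := hX2 (frv J x 1 0) (frv J x 1 0) (frv J x 1 0).
have e4 := hX2 (frv J x 1 0) (frv J x 1 0) (frv J x 0 1).
move: e3 e4; rewrite !FN !(J_fr H) !(formatE FX2) !(formatE FA) !(formatE FP) !(g_fr H).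
have G0 := gfr_neq0 H.
rewrite -!mulrN -!mulrDr => /(mulfI G0) e3 /(mulfI G0) e4.
split; lra.
Qed.

(** The trace-free part of I v is - Adot_0 J. Paired with the circle part - A J of [X] it gives <A,
    Adot_0>, because the two factors [J] cancel against anticommutation; with weight f'/6 this is
    the first term on the right. What remains is linear in [N] and [P] and will be recognised as a
    divergence. *)
Lemma lie_integrand (s s' : R) : let ip := ipA J g x in
  (1 - s) * (2^-1 * trE (X.1 i x \o (Istr p v).1 i x))
  + s' / 6 * ip (A0 p X i x) (A0 p (Istr p v) i x)
  - s' / 12 * ip (Atr p X i x) (Atr p (Istr p v) i x) =
  2 / 3 * (s' / 4 * ip (p.2 i x) (A0 p v i x))
  + (s' / 6 * ip (fun Y u => P Y (J x u)) (A0 p v i x)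
     - (1 - s) * trE (v.1 i x \o N) + s' / 4 * ip (p.2 i x) (A0 p v i x) * trE (J x \o N)).
Proof.
have [em en ek el] := lie_coefficients; move=> ip.
have FIv1 := Istr1_format H Fv1.
have FIv2 := Istr2_format H FA Fv1 Fv2.
have FAX := A0_format H FA FX1 FX2.
have FAI := A0_format H FA FIv1 FIv2.
have FTX := Atr_format H FA FX1.
have FTI := Atr_format H FA FIv1.
have FAv := A0_format H FA Fv1 Fv2.
have FPJ := formatJ H FP.
rewrite /ip (fmat_tr_comp H FX1 FIv1) (ipA_format H FAX FAI) (ipA_format H FTX FTI).
rewrite (ipA_format H FA FAv) (ipA_format H FPJ FAv) (fmat_tr_comp H Fv1 FN).
rewrite (fmat_tr_comp H (fmatJ H) FN) em en ek el.
by field; exact: gfr_neq0 H.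
Qed.
End TangentAlgebra.

Lemma app_comb (V : zmodType) (a b c d : V) : a + b + c = a + c - d + (b + d).
Proof. by rewrite [b + d]addrC addrA subrK addrAC. Qed.

Lemma scaler_add2 (R : realType) (V : lmodType R) (c : R) (a1 a2 b1 b2 : V) :
  c *: a1 + a2 + (c *: b1 + b2) = c *: (a1 + b1) + (a2 + b2).
Proof. by rewrite addrACA -scalerDr. Qed.

Lemma sub_comb (V : zmodType) (a b c d : V) : a - b - d + c = c + a - (d + b).
Proof. by rewrite [d + b]addrC opprD addrC !addrA. Qed.

Lemma is_deriveZ_fun (R : realType) (V : normedModType R) (h : V -> R) (Y : V -> R * R) x v dh dY :
  is_derive x v h dh -> is_derive x v Y dY ->
  is_derive x v (fun y => h y *: Y y) (dh *: Y x + h x *: dY).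
Proof.
move=> D1 D2; exact: (is_derive_pair (is_deriveM_fun D1 (is_derive_fst D2)) (is_deriveM_fun D1 (is_derive_snd D2))).
Qed.

Lemma combine_divergence (V : zmodType) (a b c a' b' c' : V) :
  a + b - c + (a' + b' - c') = a + a' + (b + b') - (c + c').
Proof. by rewrite addrACA [a + b + _]addrACA opprD. Qed.

(** * Divergence as the trace of the covariant derivative *)

Section VolumeCalculus.
Variable R : realType.
Local Notation E := (R * R)%type.
Variables (U : set E) (J : E -> E -> E) (g : E -> E -> E -> R) (rho : E -> E -> E -> R).
Hypothesis oU : open U.
Hypothesis herm : forall x, U x -> hermitian_at x J g (rho x).
Hypothesis sJ : forall u, smooth_on U (fun y => J y u).
Hypothesis srho : forall u v, smooth_on U (fun y => rho y u v).
Variable x : E.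
Hypothesis Ux : U x.
Let H := herm Ux.
Local Notation L := (LC J g x).

Lemma LC_Zr u c w : L u (c *: w) = c *: L u w.
Proof. exact: (lin_funZ (fun c a b => LC_linr oU herm sJ srho Ux c u a b)). Qed.

Lemma LC_Nr u w : L u (- w) = - L u w.
Proof. exact: (lin_funN (fun c a b => LC_linr oU herm sJ srho Ux c u a b)). Qed.

Lemma LC_Dr u v w : L u (v + w) = L u v + L u w.
Proof. exact: (lin_funD (fun c a b => LC_linr oU herm sJ srho Ux c u a b)). Qed.

Lemma rho_g y u v : U y -> rho y u v = g y u (- J y v).
Proof.
move=> Uy; have Hy := herm Uy.
by rewrite (gE Hy) (lin_funN (J_lin Hy)) (J_sq Hy) opprK.
Qed.

Lemma g_Nr u w : g x u (- w) = - g x u w.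
Proof. exact: (lin_funN (V := E) (W := R^o) (fun c a b => g_linr herm Ux c a b u)). Qed.

Lemma g_Dr u v w : g x u (v + w) = g x u v + g x u w.
Proof. exact: (lin_funD (V := E) (W := R^o) (fun c a b => g_linr herm Ux c a b u)). Qed.

Lemma DJE u w : DJ J x u w = J x (L u w) - L u (J x w).
Proof.
have := nabla_J oU herm sJ srho Ux u w => /eqP.
by rewrite subr_eq0 => /eqP <-; rewrite addrK.
Qed.

(** The area form is - g(., J .), and both [g] and [J] are parallel. *)
Lemma nabla_rho u v w : 'D_u (fun y => rho y v w) x = rho x (L u v) w + rho x v (L u w).
Proof.
have e y : U y -> g y v (- J y w) = rho y v w by move=> Uy; rewrite rho_g.
have dJ : is_derive x u (fun y => - J y w) (- DJ J x u w).
  by apply: is_deriveN_fun; exact: (smooth_on_is_derive u (sJ w) Ux).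
have d := is_derive_lin_appR oU Ux (fun y Uy c a b => g_linr herm Uy c a b v)
   (fun a => is_derive_g oU herm sJ srho Ux u v a) dJ.
have [_ ->] := is_derive_near oU Ux e d.
rewrite (nabla_g oU herm sJ srho Ux) DJE !rho_g// LC_Nr.
rewrite opprB (g_Dr v (L u (J x w)) (- J x (L u w))) (g_Nr v (L u (J x w))).
by rewrite addrA subrK.
Qed.

Lemma trE_lin1 (c : R) (B : E -> E -> E) u v :
  (forall c u v w, B (c *: u + v) w = c *: B u w + B v w) ->
  trE (B (c *: u + v)) = c * trE (B u) + trE (B v).
Proof. by move=> l1; rewrite /trE !l1 /= /GRing.scale /=; ring. Qed.

Lemma derive_area u : 'D_u (fun y => rho y (1, 0) (0, 1)) x = rho x (1, 0) (0, 1) * trE (L u).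
Proof.
rewrite nabla_rho (rho_det H (L u (1, 0))) (rho_det H (1, 0) (L u _)) /trE /=; ring.
Qed.

(** The derivative of the area density along e is the density times tr (nabla_e), so the product
    rule yields the coordinate divergence of Z plus connection terms. *)
Lemma divergence_trace (Z : E -> E) (d1 d2 : E) :
  is_derive x (1, 0) Z d1 -> is_derive x (0, 1) Z d2 ->
  'D_(1, 0) (fun y => rho y (1, 0) (0, 1) * (Z y).1) x
  + 'D_(0, 1) (fun y => rho y (1, 0) (0, 1) * (Z y).2) x
  = rho x (1, 0) (0, 1) * trE (fun v => 'D_v Z x + L v (Z x)).
Proof.
move=> D1 D2.
have da u := smooth_on_is_derive u (srho (1, 0) (0, 1)) Ux.
have [_ ->] := is_deriveM_fun (da (1, 0)) (is_derive_fst D1).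
have [_ ->] := is_deriveM_fun (da (0, 1)) (is_derive_snd D2).
have [_ e1] := D1; have [_ e2] := D2.
have lL c u v w := LC_linl oU herm sJ srho Ux c u v w.
have : trE (L (Z x)) = (Z x).1 * trE (L (1, 0)) + (Z x).2 * trE (L (0, 1)).
  rewrite {1}(plane_basisE (Z x)) (trE_lin1 (Z x).1 (1, 0) ((Z x).2 *: (0, 1)) lL); congr (_ + _).
  have := trE_lin1 (Z x).2 (0, 1) 0 lL; rewrite addr0 => ->.
  by rewrite [trE (L 0)]/trE -(scale0r (0 : E)) !(lin_funZ (fun c u v => lL c u v _)) !scale0r /= addr0 addr0.
(* Absence of torsion replaces nabla_Z e by nabla_e Z for constant fields, which matches the
   connection terms with the trace of nabla Z. *)
rewrite [X in X = _]/trE (LC_sym oU herm Ux (Z x)) (LC_sym oU herm Ux (Z x) (0, 1)) => e.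
have -> : trE (fun v => 'D_v Z x + L v (Z x)) = (d1.1 + (L (1, 0) (Z x)).1) + (d2.2 + (L (0, 1) (Z x)).2).
  by rewrite -e1 -e2.
rewrite !derive_area.
have -> : (L (1, 0) (Z x)).1 = (Z x).1 * trE (L (1, 0)) + (Z x).2 * trE (L (0, 1)) - (L (0, 1) (Z x)).2.
  by rewrite -e; ring.
by ring.
Qed.

Lemma osum_trace (T : E -> E) : (forall (c : R) u v, T (c *: u + v) = c *: T u + T v) ->
  osum J g x (fun e => g x (T e) e) = trE T.
Proof.
move=> lT; have [t1 [t2 [t3 [t4 FT]]]] := fmat_exists H lT.
rewrite (osum_fr H) !FT !(g_fr H) (fmat_tr H FT).
have k2 := sqrtG_sq H; have G0 := gfr_neq0 H; set k := (Num.sqrt _)^-1 in k2 *.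
rewrite !mulr0 !addr0 !add0r.
have -> : gfr g x * (t1 * k * k) + gfr g x * (t4 * k * k) = (t1 + t4) * (gfr g x * (k * k)) by ring.
by rewrite k2 divff// mulr1.
Qed.

Section EndField.
Variable B : E -> E -> E.
Hypothesis B_lin : forall y, U y -> forall (c : R) u v, B y (c *: u + v) = c *: B y u + B y v.
Hypothesis sB : forall u, smooth_on U (fun y => B y u).

Lemma nabla_end_lin1 (c : R) u u' v :
  nabla_end J g B x (c *: u + u') v = c *: nabla_end J g B x u v + nabla_end J g B x u' v.
Proof.
have dB := smooth_on_diff2 oU Ux (sB v).
rewrite /nabla_end (derive_linear c u u' dB) !(LC_linl oU herm sJ srho Ux c u u').
rewrite (B_lin Ux); exact: scaler_comb3.
Qed.

Lemma divE_trace X : divE J g B x X = trE (fun v => nabla_end J g B x v X).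
Proof.
rewrite /divE; apply: (osum_trace (T := fun v => nabla_end J g B x v X)) => c u v.
exact: nabla_end_lin1.
Qed.

Lemma nabla_app (Y : E -> E) v : smooth_on U Y ->
  'D_v (fun y => B y (Y y)) x + L v (B x (Y x)) =
  nabla_end J g B x v (Y x) + B x ('D_v Y x + L v (Y x)).
Proof.
move=> sY; have [_ ->] := is_derive_lin_app oU Ux B_lin
  (fun a => smooth_on_is_derive v (sB a) Ux) (smooth_on_is_derive v sY Ux).
rewrite (lin_funD (B_lin Ux) ('D_v Y x) (L v (Y x))) /nabla_end; exact: app_comb.
Qed.
End EndField.

Lemma nabla_scale (h : E -> R) (Y : E -> E) v dh dY : is_derive x v h dh -> is_derive x v Y dY ->
  'D_v (fun y => h y *: Y y) x + L v (h x *: Y x) = dh *: Y x + h x *: (dY + L v (Y x)).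
Proof.
move=> D1 D2; have [_ ->] := is_deriveZ_fun D1 D2.
by rewrite LC_Zr; move: (L v (Y x)) => z; rewrite -addrA -scalerDr.
Qed.

End VolumeCalculus.

(** * Covariant derivative of the real part of a cubic form *)

Section CubicNabla.
Variable R : realType.
Local Notation E := (R * R)%type.
Variables (U : set E) (J : E -> E -> E) (g : E -> E -> E -> R) (rho : E -> E -> E -> R).
Hypothesis oU : open U.
Hypothesis herm : forall x, U x -> hermitian_at x J g (rho x).
Hypothesis sJ : forall u, smooth_on U (fun y => J y u).
Hypothesis srho : forall u v, smooth_on U (fun y => rho y u v).
Variable x : E.
Hypothesis Ux : U x.
Let H := herm Ux.
Local Notation L := (LC J g x).

Lemma nabla_form_sym (B B' : E -> E -> E -> E) u X w :
  (forall y, U y -> forall X w, B y X w = B' y w X) ->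
  nabla_form J g B x u X w = nabla_form J g B' x u w X.
Proof.
move=> BB'; rewrite /nabla_form (derive_near u oU Ux (fun y Uy => BB' y Uy X w)).
by rewrite (BB' x Ux X w) (BB' x Ux (L u X) w) (BB' x Ux X (L u w)) addrAC.
Qed.

Variable B : E -> E -> E -> E.
Hypothesis B_lin1 : forall y, U y -> forall c u v w, B y (c *: u + v) w = c *: B y u w + B y v w.
Hypothesis B_lin2 : forall y, U y -> forall c u v w, B y w (c *: u + v) = c *: B y w u + B y w v.
Hypothesis sB : forall X u, smooth_on U (fun y => B y X u).

Lemma nabla_form_J u X w :
  nabla_form J g (fun y X w => B y X (J y w)) x u X w = nabla_form J g B x u X (J x w).
Proof.
have e y : U y -> forall X w, B y X (J y w) = 0 *: B y X w - (-1) *: B y X (J y w).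
  by move=> Uy X' w'; rewrite scale0r scaleN1r opprK add0r.
rewrite (nabla_form_rot oU herm sJ srho Ux B_lin2 sB e).
by rewrite scale0r scaleN1r opprK add0r.
Qed.

Lemma derive_cubic u X w z : 'D_u (fun y => g y (B y X w) z) x =
  g x (nabla_form J g B x u X w) z + g x (B x (L u X) w) z + g x (B x X (L u w)) z
  + g x (B x X w) (L u z).
Proof.
have d := is_derive_lin_appR oU Ux (fun y Uy c a b => g_linl (herm Uy) c a b z)
   (fun a => is_derive_g oU herm sJ srho Ux u a z) (smooth_on_is_derive u (sB X w) Ux).
have [_ ->] := d; rewrite (nabla_g oU herm sJ srho Ux) /nabla_form.
have gD a b := lin_funD (V := E) (W := R^o) (fun c a b => g_linl H c a b z) a b.
have gN a := lin_funN (V := E) (W := R^o) (fun c a b => g_linl H c a b z) a.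
set d1 := 'D_u _ x; set d2 := L u (B x X w); set d3 := B x (L u X) w; set d4 := B x X (L u w).
rewrite (gD (d1 + d2 - d3) (- d4)) (gD (d1 + d2) (- d3)) (gD d1 d2) (gN d3) (gN d4).
by rewrite /d1 /d2 /d3 /d4; move: (g x _ _) (g x _ _) (g x _ _) (g x _ _) (g x _ _) => *; ring.
Qed.

Hypothesis B_sym : forall y, U y -> forall X w, B y X w = B y w X.
Hypothesis B_g : forall y, U y -> forall X u v, g y (B y X u) v = g y u (B y X v).
Hypothesis B_J : forall y, U y -> forall X w, B y (J y X) w = B y X (J y w).
Local Notation P := (nabla_form J g B x).

Lemma nabla_cubic_sym u X w z : g x (P u X w) z = g x w (P u X z).
Proof.
have e := derive_cubic u X w z; have e' := derive_cubic u X z w.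
have eq1 y : U y -> g y (B y X w) z = g y (B y X z) w.
  by move=> Uy; rewrite (B_g Uy) (g_sym (herm Uy)).
rewrite (derive_near u oU Ux eq1) e' in e.
rewrite (g_sym H w (P u X z)).
move: e; rewrite (B_g Ux X z (L u w)) (g_sym H z (B x X (L u w))).
rewrite (B_g Ux X (L u z) w) (g_sym H (L u z) (B x X w)).
rewrite (B_g Ux (L u X) z w) (g_sym H z (B x (L u X) w)).
by move: (g x _ _) (g x _ _) (g x _ _) (g x _ _) (g x _ _) => *; lra.
Qed.

Lemma nabla_cubic_J u X w : P u (J x X) w = P u X (J x w).
Proof.
rewrite (nabla_form_sym u (J x X) w B_sym) -nabla_form_J.
rewrite (@nabla_form_sym _ (fun y X w => B y X (J y w))) ?nabla_form_J// => y Uy X' w'.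
by rewrite -(B_J Uy) (B_sym Uy).
Qed.

(** As [g] and [J] are parallel, nabla_u B inherits the algebraic symmetries of B and is again
    described by two numbers. *)
Lemma nabla_cubic_format u : exists a b, cubic_format x J (P u) a b.
Proof.
apply: (cubic_format_exists H).
- move=> c a b w; exact: (nabla_form_lin1 oU herm sJ srho Ux B_lin1 sB).
- move=> c a b w; exact: (nabla_form_lin2 oU herm sJ srho Ux B_lin2 sB).
- move=> X; have [t1 [t2 [t3 [t4 FT]]]] := fmat_exists H (fun c a b => nabla_form_lin2 oU herm sJ srho Ux B_lin2 sB u c X a b).
  rewrite (fmat_tr H FT).
  (* Trace-freeness is deduced from the other symmetries: as P(J X) = P(X) J, the symmetry of P(J X)
     makes the diagonal entries of P(X) opposite. *)
  have := nabla_cubic_sym u (J x X) (frv J x 1 0) (frv J x 0 1).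
  rewrite !nabla_cubic_J !(J_fr H) !FT !(g_fr H) => /(mulfI (gfr_neq0 H)); lra.
- exact: nabla_cubic_sym.
- exact: nabla_cubic_J.
Qed.

End CubicNabla.

(** Any vector y with g(y, y) nonzero, together with J y, computes the pairing after division by
    g(y, y). This avoids the square root of the normalised frame, and it allows y to be the image of
    d_1 under a change of chart. *)
Lemma ipA_any (R : realType) (x : R * R) (J : R * R -> R * R -> R * R)
    (g : R * R -> R * R -> R * R -> R) (rho : R * R -> R * R -> R)
    (A B : R * R -> R * R -> R * R) (y : R * R) :
  hermitian_at x J g rho ->
  (forall c u v w, A (c *: u + v) w = c *: A u w + A v w) ->
  (forall c u v w, A w (c *: u + v) = c *: A w u + A w v) ->
  (forall c u v w, B (c *: u + v) w = c *: B u w + B v w) ->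
  (forall c u v w, B w (c *: u + v) = c *: B w u + B w v) -> g x y y != 0 ->
  ipA J g x A B = (trE (A y \o B y) + trE (A (J x y) \o B (J x y))) / g x y y.
Proof.
move=> H A1 A2 B1 B2.
have [a1 [a2 [a3 [a4 [a5 [a6 [a7 [a8 FA]]]]]]]] := format_exists H A1 A2.
have [b1 [b2 [b3 [b4 [b5 [b6 [b7 [b8 FB]]]]]]]] := format_exists H B1 B2.
have [c [d ->]] := fr_surj H y; rewrite (J_fr H) (g_fr H) => g0.
rewrite (ipA_format H FA FB) (fmat_tr_comp H (FA c d) (FB c d)) (fmat_tr_comp H (FA (- d) c) (FB (- d) c)).
by have := g0; rewrite mulf_eq0 negb_or => /andP[n1 n2]; field; rewrite n1 n2.
Qed.

Section SmoothPairing.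
Variable R : realType.
Local Notation E := (R * R)%type.
Variables (U : set E) (J : E -> E -> E) (g : E -> E -> E -> R) (rho : E -> E -> E -> R).
Hypothesis oU : open U.
Hypothesis herm : forall x, U x -> hermitian_at x J g (rho x).
Hypothesis sJ : forall u, smooth_on U (fun y => J y u).
Hypothesis srho : forall u v, smooth_on U (fun y => rho y u v).

Lemma smooth_trE (T : E -> E -> E) : (forall u, smooth_on U (fun y => T y u)) ->
  smooth_on U (fun y => trE (T y)).
Proof.
move=> sT; apply: smooth_onD => //; first exact: (smooth_on_fst oU (sT (1, 0))).
exact: (smooth_on_snd oU (sT (0, 1))).
Qed.

Variables A B : E -> E -> E -> E.
Hypothesis A1 : forall y, U y -> forall c u v w, A y (c *: u + v) w = c *: A y u w + A y v w.
Hypothesis A2 : forall y, U y -> forall c u v w, A y w (c *: u + v) = c *: A y w u + A y w v.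
Hypothesis sA : forall X u, smooth_on U (fun y => A y X u).
Hypothesis B1 : forall y, U y -> forall c u v w, B y (c *: u + v) w = c *: B y u w + B y v w.
Hypothesis B2 : forall y, U y -> forall c u v w, B y w (c *: u + v) = c *: B y w u + B y w v.
Hypothesis sB : forall X u, smooth_on U (fun y => B y X u).

Lemma smooth_bilin (C : E -> E -> E -> E) (Y Z : E -> E) :
  (forall y, U y -> forall c u v w, C y (c *: u + v) w = c *: C y u w + C y v w) ->
  (forall y, U y -> forall c u v w, C y w (c *: u + v) = c *: C y w u + C y w v) ->
  (forall X u, smooth_on U (fun y => C y X u)) -> smooth_on U Y -> smooth_on U Z ->
  smooth_on U (fun y => C y (Y y) (Z y)).
Proof.
move=> C1 C2 sC sY sZ.
have s1 u : smooth_on U (fun y => C y (Y y) u).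
  exact (@smooth_on_lin_app _ _ U (fun y a => C y a u) Y oU (fun y Uy c a b => C1 y Uy c a b u)
    (fun X => sC X u) sY).
exact (@smooth_on_lin_app _ _ U (fun y => C y (Y y)) Z oU (fun y Uy c a b => C2 y Uy c a b (Y y)) s1 sZ).
Qed.

Lemma smooth_ipA : smooth_on U (fun y => ipA J g y (A y) (B y)).
Proof.
have se : smooth_on U (fun=> (1, 0) : E) by exact: smooth_on_cstE.
have sb (Y : E -> E) u : smooth_on U Y -> smooth_on U (fun y => A y (Y y) (B y (Y y) u)).
  move=> sY; have sc : smooth_on U (fun=> u) by exact: smooth_on_cstE.
  exact (smooth_bilin A1 A2 sA sY (smooth_bilin B1 B2 sB sY sc)).
have s1 := smooth_onD oU
  (smooth_trE (T := fun y => A y (1, 0) \o B y (1, 0)) (fun u => sb (fun=> (1, 0)) u se))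
  (smooth_trE (T := fun y => A y (J y (1, 0)) \o B y (J y (1, 0))) (fun u => sb (fun y => J y (1, 0)) u (sJ (1, 0)))).
have g0 y : U y -> gfr g y != 0 by move=> Uy; exact: gfr_neq0 (herm Uy).
have s2 := smooth_onM oU s1 (smooth_onV oU g0 (smooth_g oU herm sJ srho (1, 0) (1, 0))).
apply: (smooth_on_eq oU _ s2) => y Uy.
by rewrite (ipA_any (herm Uy) (A1 Uy) (A2 Uy) (B1 Uy) (B2 Uy) (g0 y Uy)).
Qed.
End SmoothPairing.

(** * Lie derivatives along Y and the divergence of the gauge field *)

Section GaugeDivergence.
Variables (R : realType) (M : ptopologicalType) (S : oriented_atlas R M).
Local Notation E := (R * R)%type.
Variables (rho : form2 S) (p v : pairJA S) (f fx : R -> R).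
Hypothesis rho_area : is_area_form rho.
Hypothesis Dp : in_D3 rho p.
Hypothesis Tv : tangent_D3 rho p v.
Hypothesis f_fx : forall t, 0 <= t -> f t = fx t.
Hypothesis f'_fx : forall t, 0 <= t -> rderiv f t = 'D_1 fx t.
Hypothesis cfx : forall k, Ck k setT fx.

Lemma normA0_ge0 i x : img i x -> 0 <= normA0 rho p i x.
Proof.
move=> ix; have H := herm_p rho_area Dp ix; have [a [b FA]] := in_D3_format rho_area Dp ix.
rewrite (normA0_format H FA) !divr_ge0 ?addr_ge0 ?sqr_ge0//.
exact: ltW (gfr_gt0 H).
Qed.

Lemma smooth_normA0 i : smooth_on (img i) (normA0 rho p i).
Proof.
have oi : open (img i) by exact: img_open.
apply: (smooth_onM oi); first exact: smooth_on_cst.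
exact (smooth_ipA oi (@herm_p _ _ _ _ rho_area p Dp i) (@smooth_p1 _ _ _ _ p Dp i)
  (@smooth_rho _ _ _ _ rho_area i)
  (@p2_lin1 _ _ _ _ p Dp i) (@p2_lin2 _ _ _ _ p Dp i) (@smooth_p2 _ _ _ _ p Dp i)
  (@p2_lin1 _ _ _ _ p Dp i) (@p2_lin2 _ _ _ _ p Dp i) (@smooth_p2 _ _ _ _ p Dp i)).
Qed.

Lemma smooth_ip_A_A0 i : smooth_on (img i) (fun x => ipA (p.1 i) (gJ rho p i) x (p.2 i x) (A0 p v i x)).
Proof.
have oi : open (img i) by exact: img_open.
exact (smooth_ipA oi (@herm_p _ _ _ _ rho_area p Dp i) (@smooth_p1 _ _ _ _ p Dp i)
  (@smooth_rho _ _ _ _ rho_area i)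
  (@p2_lin1 _ _ _ _ p Dp i) (@p2_lin2 _ _ _ _ p Dp i) (@smooth_p2 _ _ _ _ p Dp i)
  (@A0_lin1 _ _ _ _ rho_area p Dp v Tv i) (@A0_lin2 _ _ _ _ rho_area p Dp v Tv i)
  (@smooth_A0 _ _ _ _ rho_area p Dp v Tv i)).
Qed.

Lemma smooth_comp_normA0 (h : R -> R) i : (forall k, Ck k setT h) ->
  smooth_on (img i) (fun x => h (normA0 rho p i x)).
Proof.
move=> ch; apply/smooth_on_Ck => k; apply: (Ck_comp (@img_open _ _ _ i) (ch k)).
exact: (proj1 (smooth_on_Ck _ _) (@smooth_normA0 i)).
Qed.

Lemma smooth_fdot i : smooth_on (img i) (fdot rho f p v i).
Proof.
have oi : open (img i) by exact: img_open.
have s1 := smooth_onM oi (smooth_onM oi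
  (@smooth_comp_normA0 ('D_1 fx) i (fun k => Ck_derive (1 : R) (cfx k.+1))) (@smooth_on_cst _ _ (img i) 4^-1))
  (@smooth_ip_A_A0 i).
apply: (smooth_on_eq oi _ s1) => y iy.
by rewrite /fdot f'_fx// normA0_ge0.
Qed.

Definition scaled_Jdot i (y u : E) : E := (f (normA0 rho p i y) - 1) *: v.1 i y u.

Lemma scaled_Jdot_lin i y : img i y -> forall (c : R) a b,
  scaled_Jdot i y (c *: a + b) = c *: scaled_Jdot i y a + scaled_Jdot i y b.
Proof.
move=> iy c a b; have [[l1 _ _] _ _] := Tv; rewrite /scaled_Jdot l1//.
by rewrite scalerDr !scalerA mulrC.
Qed.

Lemma smooth_scaled_Jdot i u : smooth_on (img i) (fun y => scaled_Jdot i y u).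
Proof.
have oi : open (img i) by exact: img_open.
have s1 := smooth_onB oi (@smooth_comp_normA0 fx i cfx) (@smooth_on_cst _ _ (img i) 1).
have sv := @smooth_v1 _ _ _ _ p v Tv i u.
have s2 := smooth_on_pair oi (smooth_onM oi s1 (smooth_on_fst oi sv)) (smooth_onM oi s1 (smooth_on_snd oi sv)).
apply: (smooth_on_eq oi _ s2) => y iy.
by rewrite /scaled_Jdot f_fx// normA0_ge0.
Qed.

Variables (Y : vec_field S) (pot : M -> R).
Hypothesis YV : is_vec_field Y.
Hypothesis Yrho : forall i x, img i x -> forall a b, lie_rho rho Y i x a b = 0.
Hypothesis pot_smooth : smooth_fun S pot.
Hypothesis pot_alpha : forall i x, img i x -> forall w,
  'D_w (pot \o param i) x = alpha1 rho f p v i x w.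

Definition nablaY i (x u : E) : E := 'D_u (Y i) x + LC (p.1 i) (gJ rho p i) x u (Y i x).

(* The vector field whose divergence is the part of the integrand that involves Y. *)
Definition gauge_field i (x : E) : E :=
  scaled_Jdot i x (Y i x) + fdot rho f p v i x *: p.1 i x (Y i x) - pot (param i x) *: Y i x.

Section InChart.
Variables (i : chart S) (x : E).
Hypothesis ix : img i x.
Let oi : open (img i) := @img_open _ _ _ i.
Let hp := @herm_p _ _ _ _ rho_area p Dp i.
Let sJ := @smooth_p1 _ _ _ _ p Dp i.
Let srho := @smooth_rho _ _ _ _ rho_area i.
Let sY : smooth_on (img i) (Y i) := proj1 YV i.
Let H := hp ix.
Local Notation J := (p.1 i).
Local Notation g := (gJ rho p i).
Local Notation L := (LC J g x).
Local Notation N := (nablaY i x).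

Lemma nablaY_lin (c : R) a b : N (c *: a + b) = c *: N a + N b.
Proof.
rewrite /nablaY (derive_linear c a b (smooth_on_diff2 oi ix sY)).
rewrite (LC_linl oi hp sJ srho ix c a b (Y i x)).
exact: scaler_add2.
Qed.

(** Since rho is parallel, L_Y rho (d_1, d_2) is rho(nabla_1 Y, d_2) + rho(d_1, nabla_2 Y), that is,
    the area density times the trace of nabla Y. *)
Lemma nablaY_trace : trE N = 0.
Proof.
have := Yrho ix (1, 0) (0, 1); rewrite /lie_rho (nabla_rho oi hp sJ srho ix).
rewrite /trE /nablaY (LC_sym oi hp ix (Y i x) (1, 0)) (LC_sym oi hp ix (Y i x) (0, 1)).
move: (L (1, 0) (Y i x)) (L (0, 1) (Y i x)) ('D_(1, 0) (Y i) x) ('D_(0, 1) (Y i) x) => l1 l2 d1 d2.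
rewrite (rho_det H l1) (rho_det H (1, 0) l2) (rho_det H d1) (rho_det H (1, 0) d2) /= => e.
have r0 : rho i x (1, 0) (0, 1) != 0 by rewrite gt_eqF// (area_gt0 rho_area ix).
by apply: (mulfI r0); rewrite mulr0 -[RHS]e; ring.
Qed.

Lemma nablaY_frmat : exists n1 n2 n3, frmat J x N n1 n2 n3 (- n1).
Proof.
have [n1 [n2 [n3 [n4 FN]]]] := fmat_exists H nablaY_lin.
have := fmat_tr H FN; rewrite nablaY_trace => e; exists n1, n2, n3.
by have -> : - n1 = n4 by lra.
Qed.

(** Without torsion, a Lie derivative may be computed with covariant derivatives; [J] being
    parallel, only nabla Y remains. In [lie_C_nabla] the term nabla_Y A survives as well. *)
Lemma lie_J_nabla w : lie_J p Y i x w = J x (N w) - N (J x w).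
Proof.
have e := DJE oi hp sJ srho ix (Y i x) w; rewrite /DJ in e.
rewrite /lie_J e /nablaY (lin_funD (J_lin H) ('D_w (Y i) x)).
rewrite (LC_sym oi hp ix w) (LC_sym oi hp ix (J x w)).
exact: sub_comb.
Qed.

Lemma lie_C_nabla a b c : lie_C rho p Y i x a b c =
  g x (nabla_form J g (p.2 i) x (Y i x) a b) c + cubic rho p i x (N a) b c
  + cubic rho p i x a (N b) c + cubic rho p i x a b (N c).
Proof.
rewrite /lie_C /cubic.
rewrite (derive_cubic oi hp sJ srho ix (@smooth_p2 _ _ _ _ p Dp i)).
rewrite /nablaY (LC_sym oi hp ix a) (LC_sym oi hp ix b) (LC_sym oi hp ix c).
have A1 := @p2_lin1 _ _ _ _ p Dp i x ix; have A2 := @p2_lin2 _ _ _ _ p Dp i x ix.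
rewrite (lin_funD (fun k u w => A1 k u w b) ('D_a (Y i) x)) (lin_funD (fun k u w => A2 k u w a) ('D_b (Y i) x)).
rewrite (g_Dr hp ix (p.2 i x a b) ('D_c (Y i) x)).
have gD u w := lin_funD (V := E) (W := R^o) (fun k a b => g_linl H k a b c) u w.
rewrite (gD (p.2 i x ('D_a (Y i) x) b)) (gD (p.2 i x a ('D_b (Y i) x))).
by move: (g x _ _) (g x _ _) (g x _ _) (g x _ _) (g x _ _) (g x _ _) (g x _ _) => *; ring.
Qed.

Local Notation s := (f (normA0 rho p i x)).
Local Notation fd := (fdot rho f p v i).

(** The trace of the rank-one endomorphism dh (x) w is dh(w). *)
Lemma trE_scale (h : E -> R) (w : E) : (forall u, 'D_u h x = u.1 * 'D_(1, 0) h x + u.2 * 'D_(0, 1) h x) ->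
  trE (fun u => 'D_u h x *: w) = 'D_w h x.
Proof. move=> hE; rewrite /trE (hE w); move: ('D_(1, 0) h x) ('D_(0, 1) h x) => a b.
by rewrite /= /GRing.scale /= [a * _]mulrC [b * _]mulrC. Qed.

Lemma trE_comb (T1 T2 T3 T4 T5 T6 : E -> E) :
  trE (fun u => T1 u + T2 u + (T3 u + T4 u) - (T5 u + T6 u)) =
  trE T1 + trE T2 + (trE T3 + trE T4) - (trE T5 + trE T6).
Proof. by rewrite /trE /=; ring. Qed.

Lemma trEZ (c : R) (B : E -> E) : trE (fun u => c *: B u) = c * trE B.
Proof. by rewrite /trE /= /GRing.scale /=; ring. Qed.

Lemma smooth_onZ_fun (h : E -> R) (Z : E -> E) : smooth_on (img i) h -> smooth_on (img i) Z ->
  smooth_on (img i) (fun y => h y *: Z y).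
Proof.
move=> sh sZ.
exact (smooth_on_pair oi (smooth_onM oi sh (smooth_on_fst oi sZ)) (smooth_onM oi sh (smooth_on_snd oi sZ))).
Qed.

Lemma smooth_JY : smooth_on (img i) (fun y => J y (Y i y)).
Proof. exact: (smooth_on_lin_app oi (fun y iy => J_lin (hp iy)) sJ sY). Qed.

Lemma nabla_JY u : 'D_u (fun y => J y (Y i y)) x + L u (J x (Y i x)) = J x (N u).
Proof.
rewrite (nabla_app J g oi ix (fun y iy => J_lin (hp iy)) sJ u sY).
by rewrite /nabla_end (nabla_J oi hp sJ srho ix) add0r.
Qed.

Lemma nabla_gauge_field u : 'D_u (gauge_field i) x + L u (gauge_field i x) =
  nabla_end J g (scaled_Jdot i) x u (Y i x) + scaled_Jdot i x (N u)
  + ('D_u fd x *: J x (Y i x) + fd x *: J x (N u))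
  - ('D_u (pot \o param i) x *: Y i x + pot (param i x) *: N u).
Proof.
have sB := smooth_on_lin_app oi (fun y iy => scaled_Jdot_lin iy) (@smooth_scaled_Jdot i) sY.
have e1 := nabla_app J g oi ix (fun y iy => scaled_Jdot_lin iy) (@smooth_scaled_Jdot i) u sY.
have df := smooth_on_is_derive u (@smooth_fdot i) ix.
have dp := smooth_on_is_derive u (@pot_smooth i) ix.
have dJY := smooth_on_is_derive u smooth_JY ix.
have dY := smooth_on_is_derive u sY ix.
have e2 := nabla_scale oi hp sJ srho ix df dJY.
have e3 := nabla_scale oi hp sJ srho ix dp dY.
rewrite -e1 -(nabla_JY u) -e2 -e3.
have d2 := is_deriveZ_fun df dJY; have d3 := is_deriveZ_fun dp dY.
have [_ ->] := is_deriveB_fun (is_deriveD_fun (smooth_on_is_derive u sB ix) d2) d3.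
have [_ <-] := d2; have [_ <-] := d3.
rewrite /gauge_field (LC_Dr oi hp sJ srho ix u (scaled_Jdot i x (Y i x) + fd x *: J x (Y i x))).
rewrite (LC_Dr oi hp sJ srho ix u (scaled_Jdot i x (Y i x))) (LC_Nr oi hp sJ srho ix u).
exact: combine_divergence.
Qed.

Lemma smooth_gauge_field : smooth_on (img i) (gauge_field i).
Proof.
have sB := smooth_on_lin_app oi (fun y iy => scaled_Jdot_lin iy) (@smooth_scaled_Jdot i) sY.
have s2 := smooth_onZ_fun (@smooth_fdot i) smooth_JY.
have s3 := smooth_onZ_fun (@pot_smooth i) sY.
have := smooth_on_lincomb 1 (-1) oi (smooth_on_lincomb 1 1 oi sB s2) s3.
by apply: smooth_on_eq => // y _; rewrite !scale1r scaleN1r.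
Qed.

(** The three summands of the field produce div((f - 1) Jdot)(Y), the derivative of fdot along J Y,
    and - alpha1(Y), the last from the derivative of the potential. By definition of alpha1 they
    collapse to (f'/6) beta(Y). The undifferentiated potential multiplies tr (nabla Y) = 0, and the
    other terms in nabla Y are kept. *)
Lemma gauge_divergence :
  'D_(1, 0) (fun y => area rho i y * (gauge_field i y).1) x
  + 'D_(0, 1) (fun y => area rho i y * (gauge_field i y).2) x =
  area rho i x * (rderiv f (normA0 rho p i x) / 6 * betaf rho p v i x (Y i x)
   - (1 - s) * trE (v.1 i x \o N) + fd x * trE (J x \o N)).
Proof.
have dZ u := smooth_on_is_derive u smooth_gauge_field ix.
rewrite /area (divergence_trace oi hp sJ srho ix (dZ (1, 0)) (dZ (0, 1))); congr (_ * _).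
have -> : (fun u => 'D_u (gauge_field i) x + L u (gauge_field i x)) = (fun u =>
  nabla_end J g (scaled_Jdot i) x u (Y i x) + scaled_Jdot i x (N u)
  + ('D_u fd x *: J x (Y i x) + fd x *: J x (N u))
  - ('D_u (pot \o param i) x *: Y i x + pot (param i x) *: N u)).
  by apply/funext => u; exact: nabla_gauge_field.
rewrite trE_comb (trEZ (fd x) (fun u => J x (N u))) (trEZ (pot (param i x)) N) nablaY_trace.
rewrite (trEZ (s - 1) (fun u => v.1 i x (N u))).
rewrite -(divE_trace oi hp sJ srho ix (fun y iy => scaled_Jdot_lin iy) (@smooth_scaled_Jdot i)).
have c1 h : smooth_on (img i) h -> forall u, 'D_u h x = u.1 * 'D_(1, 0) h x + u.2 * 'D_(0, 1) h x.
  by move=> sh u; have [_] := Ck1_diff oi ix (proj1 (smooth_on_Ck _ _) sh 1%N); exact.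
rewrite (trE_scale _ (c1 _ (@smooth_fdot i))) (trE_scale _ (c1 _ (@pot_smooth i))).
rewrite (pot_alpha ix) /alpha1 /divf -/J.
rewrite -[fun u => J x (N u)]/(J x \o N) -[fun u => v.1 i x (N u)]/(v.1 i x \o N).
move: (divE _ _ _ _ _) (trE _) (trE _) ('D_(J x (Y i x)) fd x) (fd x) (betaf _ _ _ _ _ _) => *.
ring.
Qed.

End InChart.
End GaugeDivergence.

(** * Independence of the chart *)

Section TraceConjugation.
Variable R : realType.
Local Notation E := (R * R)%type.

Lemma trE_det (B : E -> E) (y z : E) : (forall (c : R) u v, B (c *: u + v) = c *: B u + B v) ->
  (B y).1 * z.2 - (B y).2 * z.1 + (y.1 * (B z).2 - y.2 * (B z).1) = trE B * (y.1 * z.2 - y.2 * z.1).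
Proof.
move=> lB; rewrite (lin_funE lB y) (lin_funE lB z) /trE.
move: (B (1, 0)) (B (0, 1)) => b1 b2; rewrite /GRing.scale /= /GRing.scale /=; ring.
Qed.

(** No inverse of T is formed: the identity det(B'y, z) + det(y, B'z) = tr(B') det(y, z) is applied
    to the images of the basis vectors, and their nonzero determinant is cancelled. *)
Lemma trE_conj (T B B' : E -> E) : (forall (c : R) u v, B (c *: u + v) = c *: B u + B v) ->
  (forall (c : R) u v, B' (c *: u + v) = c *: B' u + B' v) ->
  (forall (c : R) u v, T (c *: u + v) = c *: T u + T v) ->
  (T (1, 0)).1 * (T (0, 1)).2 - (T (1, 0)).2 * (T (0, 1)).1 != 0 ->
  (forall u, B' (T u) = T (B u)) -> trE B' = trE B.
Proof.
move=> lB lB' lT d0 BT; apply: (mulIf d0); rewrite -trE_det// !BT.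
rewrite (lin_funE lT (B _)) (lin_funE lT (B (0, 1))) /trE.
move: (T (1, 0)) (T (0, 1)) (B (1, 0)) (B (0, 1)) => t1 t2 b1 b2.
rewrite /GRing.scale /= /GRing.scale /=; ring.
Qed.

End TraceConjugation.

Section ChartInvariance.
Variables (R : realType) (M : ptopologicalType) (S : oriented_atlas R M).
Local Notation E := (R * R)%type.
Variables (rho : form2 S).
Hypothesis rho_area : is_area_form rho.

(** The pointwise part of the field conditions, with smoothness left out, so that it passes directly
    from [v] to [Istr p v]. *)
Definition linear_pair (q : pairJA S) i x : Prop :=
  [/\ forall (c : R) u v, q.1 i x (c *: u + v) = c *: q.1 i x u + q.1 i x v,
      forall (c : R) u v w, q.2 i x (c *: u + v) w = c *: q.2 i x u w + q.2 i x v w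
    & forall (c : R) u v w, q.2 i x w (c *: u + v) = c *: q.2 i x w u + q.2 i x w v].

Definition tensorial_pair (q : pairJA S) i j x : Prop :=
  let T u := 'D_u (trans i j) x in
  (forall u, q.1 j (trans i j x) (T u) = T (q.1 i x u)) /\
  (forall u w, q.2 j (trans i j x) (T u) (T w) = T (q.2 i x u w)).

Lemma field_linear (q : pairJA S) i x : is_end_field q.1 -> is_endform_field q.2 -> img i x ->
  linear_pair q i x.
Proof.
move=> [l1 _ _] [l2 _ _] ix; split; first exact: l1.
  by move=> c u v w; case: (l2 i x ix c u v w).
by move=> c u v w; case: (l2 i x ix c u v w).
Qed.

Lemma field_tensorial (q : pairJA S) i j x : is_end_field q.1 -> is_endform_field q.2 -> overlap i j x ->
  tensorial_pair q i j x.
Proof. by move=> [_ _ t1] [_ _ t2] o; split; [exact: t1|exact: t2]. Qed.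

Variables (i j : chart S) (x : E).
Hypothesis o : overlap i j x.
Local Notation T := (fun u => 'D_u (trans i j) x).

Lemma transD_lin (c : R) u v : T (c *: u + v) = c *: T u + T v.
Proof. exact: derive_linear (trans_diff o). Qed.

Lemma transD_det : (T (1, 0)).1 * (T (0, 1)).2 - (T (1, 0)).2 * (T (0, 1)).1 != 0.
Proof. by have := transition_oriented o => /=; rewrite mulrC => h; rewrite gt_eqF// mulrC. Qed.

Lemma overlap_trans : img j (trans i j x).
Proof. by case: o => m [im jm] <-; exists m => //; rewrite /trans /= coordK. Qed.

Lemma trE_trans (B B' : E -> E) : (forall (c : R) u v, B (c *: u + v) = c *: B u + B v) ->
  (forall (c : R) u v, B' (c *: u + v) = c *: B' u + B' v) ->
  (forall u, B' (T u) = T (B u)) -> trE B' = trE B.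
Proof. by move=> lB lB'; apply: (trE_conj lB lB' transD_lin transD_det). Qed.

Variable p : pairJA S.
Hypothesis Dp : in_D3 rho p.
Let ix : img i x := overlap_img o.
Let jx := overlap_trans.
Let Hi := herm_p rho_area Dp ix.
Let Hj := herm_p rho_area Dp jx.

Lemma p_linear k y : img k y -> linear_pair p k y.
Proof. by case: Dp => e1 e2 _; exact: field_linear. Qed.

Lemma p_tensorial : tensorial_pair p i j x.
Proof. by case: Dp => e1 e2 _; exact: field_tensorial. Qed.

Lemma gJ_trans u w : gJ rho p j (trans i j x) (T u) (T w) = gJ rho p i x u w.
Proof.
have [t1 _] := p_tensorial; rewrite /gJ t1.
by case: rho_area => _ _ _ tr _; exact: tr.
Qed.

Lemma ipA_trans (A B A' B' : E -> E -> E) :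
  (forall c u v w, A (c *: u + v) w = c *: A u w + A v w) ->
  (forall c u v w, A w (c *: u + v) = c *: A w u + A w v) ->
  (forall c u v w, B (c *: u + v) w = c *: B u w + B v w) ->
  (forall c u v w, B w (c *: u + v) = c *: B w u + B w v) ->
  (forall c u v w, A' (c *: u + v) w = c *: A' u w + A' v w) ->
  (forall c u v w, A' w (c *: u + v) = c *: A' w u + A' w v) ->
  (forall c u v w, B' (c *: u + v) w = c *: B' u w + B' v w) ->
  (forall c u v w, B' w (c *: u + v) = c *: B' w u + B' w v) ->
  (forall u w, A' (T u) (T w) = T (A u w)) -> (forall u w, B' (T u) (T w) = T (B u w)) ->
  ipA (p.1 j) (gJ rho p j) (trans i j x) A' B' = ipA (p.1 i) (gJ rho p i) x A B.
Proof.
move=> A1 A2 B1 B2 A1' A2' B1' B2' TA TB.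
have g0 : gJ rho p i x (1, 0) (1, 0) != 0 by exact: gfr_neq0 Hi.
have g0' : gJ rho p j (trans i j x) (T (1, 0)) (T (1, 0)) != 0 by rewrite gJ_trans.
have [t1 _] := p_tensorial.
rewrite (ipA_any Hi A1 A2 B1 B2 g0) (ipA_any Hj A1' A2' B1' B2' g0') gJ_trans t1.
have tr w : trE (A' (T w) \o B' (T w)) = trE (A w \o B w).
  apply: trE_trans.
  - by move=> c u v /=; rewrite B2 A2.
  - by move=> c u v /=; rewrite B2' A2'.
  - by move=> u /=; rewrite TB TA.
exact (congr1 (fun z => z / gJ rho p i x (1, 0) (1, 0)) (congr2 +%R (tr (1, 0)) (tr (p.1 i x (1, 0))))).
Qed.

Section Tangent.
Variable v : pairJA S.
Hypothesis lvi : linear_pair v i x.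
Hypothesis lvj : linear_pair v j (trans i j x).
Hypothesis tv : tensorial_pair v i j x.

Lemma tr_JAV_trans u : trE (p.1 j (trans i j x) \o p.2 j (trans i j x) (T u) \o v.1 j (trans i j x)) =
  trE (p.1 i x \o p.2 i x u \o v.1 i x).
Proof.
have [pi1 pi2 pi3] := p_linear ix; have [pj1 pj2 pj3] := p_linear jx.
have [vi1 _ _] := lvi; have [vj1 _ _] := lvj.
have [tp1 tp2] := p_tensorial; have [tv1 _] := tv.
apply: trE_trans => [c a b|c a b|a] /=.
- by rewrite vi1 pi3 pi1.
- by rewrite vj1 pj3 pj1.
- by rewrite tv1 tp2 tp1.
Qed.

Lemma Atr_trans u w : Atr p v j (trans i j x) (T u) (T w) = T (Atr p v i x u w).
Proof. by rewrite /Atr tr_JAV_trans (lin_funZ transD_lin). Qed.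

Lemma A0_trans u w : A0 p v j (trans i j x) (T u) (T w) = T (A0 p v i x u w).
Proof.
have [_ tv2] := tv; rewrite /A0 Atr_trans tv2 (lin_funD transD_lin (v.2 i x u w)).
by rewrite (lin_funN transD_lin).
Qed.
End Tangent.

Lemma Atr_linear v k y : img k y -> linear_pair v k y ->
  (forall c a b w, Atr p v k y (c *: a + b) w = c *: Atr p v k y a w + Atr p v k y b w) /\
  (forall c a b w, Atr p v k y w (c *: a + b) = c *: Atr p v k y w a + Atr p v k y w b).
Proof.
move=> ky [v1 _ _]; have [p1 p2 p3] := p_linear ky; split=> c a b w; rewrite /Atr.
  have -> : trE (p.1 k y \o p.2 k y (c *: a + b) \o v.1 k y) =
     c * trE (p.1 k y \o p.2 k y a \o v.1 k y) + trE (p.1 k y \o p.2 k y b \o v.1 k y).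
    by rewrite /trE /= !p2 !p1 /= /GRing.scale /=; ring.
  by rewrite scalerA -scalerDl; congr (_ *: _); ring.
by rewrite scalerDr !scalerA mulrC.
Qed.

Lemma A0_linear v k y : img k y -> linear_pair v k y ->
  (forall c a b w, A0 p v k y (c *: a + b) w = c *: A0 p v k y a w + A0 p v k y b w) /\
  (forall c a b w, A0 p v k y w (c *: a + b) = c *: A0 p v k y w a + A0 p v k y w b).
Proof.
move=> ky lv; have [t1 t2] := Atr_linear ky lv; have [_ v2 v3] := lv.
split=> c a b w; rewrite /A0.
  by rewrite t1 v2 scalerBr opprD addrACA.
by rewrite t2 v3 scalerBr opprD addrACA.
Qed.

Lemma Istr_linear v k y : img k y -> linear_pair v k y -> linear_pair (Istr p v) k y.
Proof.
move=> ky [v1 v2 v3]; have [p1 p2 p3] := p_linear ky; split=> [c a b|c a b w|c a b w] /=.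
- by rewrite v1 p1 opprD scalerN.
- by rewrite v2 p2 scalerBr scalerN !opprD addrACA.
- by rewrite p1 v1 v3 p3 scalerBr scalerN !opprD addrACA.
Qed.

Lemma Istr_tensorial v : tensorial_pair v i j x -> tensorial_pair (Istr p v) i j x.
Proof.
move=> [v1 v2]; have [p1 p2] := p_tensorial; split=> [u|u w] /=.
  by rewrite v1 p1 (lin_funN transD_lin).
rewrite p1 v2 v1 p2 (lin_funD transD_lin (- _)) !(lin_funN transD_lin).
by [].
Qed.

Lemma normA0_trans : normA0 rho p j (trans i j x) = normA0 rho p i x.
Proof.
have [pi1 pi2 pi3] := p_linear ix; have [pj1 pj2 pj3] := p_linear jx.
by rewrite /normA0 (ipA_trans pi2 pi3 pi2 pi3 pj2 pj3 pj2 pj3)//; exact: (proj2 p_tensorial).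
Qed.

Lemma norm2qJ_trans : norm2qJ rho p j (trans i j x) = norm2qJ rho p i x.
Proof.
have := normA0_trans; rewrite !(normA0_norm2qJ rho_area Dp)// => h.
by apply: (mulIf _ h); rewrite invr_eq0 pnatr_eq0.
Qed.

End ChartInvariance.

(** * The symplectic pairing with the generator *)

Section Moment.
Variables (R : realType) (M : ptopologicalType) (S : oriented_atlas R M).
Local Notation E := (R * R)%type.
Local Notation borelM := (g_sigma_algebraType (@open M)).
Variables (rho : form2 S) (mu : {measure set borelM -> \bar R}).
Variables (F f fx : R -> R) (p : pairJA S).
Hypothesis rho_area : is_area_form rho.
Hypothesis mu_area : is_area_measure rho mu.
Hypothesis M_closed : closed_connected M.
Hypothesis Dp : in_D3 rho p.
Hypothesis f_fx : forall t, 0 <= t -> f t = fx t.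
Hypothesis f'_fx : forall t, 0 <= t -> rderiv f t = 'D_1 fx t.
Hypothesis cfx : forall k, Ck k setT fx.

Lemma Psi_generator u i x : velocity rho (fun theta => Psi theta p) u -> img i x ->
  (forall w, u.1 i x w = 0) /\
  (forall a b c, gJ rho p i x (u.2 i x a b) c = - gJ rho p i x (p.2 i x a (p.1 i x b)) c).
Proof.
move=> Vu ix; have [V1 V2] := Vu i x ix; split=> [w|a b c].
  by have [_ <-] := V1 w; exact: derive_cst.
have H := herm_p rho_area Dp ix.
have e : (fun theta => cubic rho (Psi theta p) i x a b c) =
  (fun theta => cos theta * gJ rho p i x (p.2 i x a b) c
     - sin theta * gJ rho p i x (p.2 i x a (p.1 i x b)) c).
  by apply/funext => theta; exact: (gJ_rot rho_area p (cos theta) (sin theta) _ _ _ ix).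
have d1 := is_deriveM_fun (is_derive_cos (0 : R)) (is_derive_cst (gJ rho p i x (p.2 i x a b) c) (0 : R) 1).
have d2 := is_deriveM_fun (is_derive_sin (0 : R)) (is_derive_cst (gJ rho p i x (p.2 i x a (p.1 i x b)) c) (0 : R) 1).
have [_ e1] := is_deriveB_fun d1 d2.
have := V2 a b c; rewrite e => -[_ e2].
transitivity ('D_1 (fun theta => cos theta * gJ rho p i x (p.2 i x a b) c
     - sin theta * gJ rho p i x (p.2 i x a (p.1 i x b)) c) 0); first by rewrite e2.
rewrite [LHS]e1 /cst sin0 cos0; ring.
Qed.

Variables (v X : pairJA S).
Hypothesis Vv : V_space rho F f p v.
Hypothesis GX : generates_Psi rho F f p X.

Let Tv : tangent_D3 rho p v. Proof. by case: Vv. Qed.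
Let TX : tangent_D3 rho p X. Proof. by case: GX => -[]. Qed.

Definition omega_integrand i (x : E) : R :=
  let ip := ipA (p.1 i) (gJ rho p i) x in
  let t := normA0 rho p i x in
  (1 - f t) * (2^-1 * trE (X.1 i x \o (Istr p v).1 i x))
  + rderiv f t / 6 * ip (A0 p X i x) (A0 p (Istr p v) i x)
  - rderiv f t / 12 * ip (Atr p X i x) (Atr p (Istr p v) i x).

Lemma pair_linear (q : pairJA S) i x : tangent_D3 rho p q -> img i x -> linear_pair q i x.
Proof. by move=> [e1 e2 _] ix; exact: field_linear. Qed.

Lemma pair_tensorial (q : pairJA S) i j x : tangent_D3 rho p q -> overlap i j x -> tensorial_pair q i j x.
Proof. by move=> [e1 e2 _] o; exact: field_tensorial. Qed.

Lemma fdot_invariant : invariant (fdot rho f p v).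
Proof.
move=> i j x o; have ix := overlap_img o; have jx := overlap_trans o.
have [pi1 pi2 pi3] := p_linear Dp ix; have [pj1 pj2 pj3] := p_linear Dp jx.
have lvi := pair_linear Tv ix; have lvj := pair_linear Tv jx.
have [ai1 ai2] := A0_linear Dp ix lvi; have [aj1 aj2] := A0_linear Dp jx lvj.
rewrite /fdot (normA0_trans rho_area o Dp).
rewrite (ipA_trans rho_area o Dp pi2 pi3 ai1 ai2 pj2 pj3 aj1 aj2 (proj2 (p_tensorial o Dp))) //.
exact (A0_trans o Dp lvi lvj (pair_tensorial Tv o)).
Qed.

Lemma omega_integrand_invariant : invariant omega_integrand.
Proof.
move=> i j x o; have ix := overlap_img o; have jx := overlap_trans o.
have lvi := Istr_linear Dp ix (pair_linear Tv ix); have lvj := Istr_linear Dp jx (pair_linear Tv jx).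
have tv := Istr_tensorial o Dp (pair_tensorial Tv o).
have lXi := pair_linear TX ix; have lXj := pair_linear TX jx; have tX := pair_tensorial TX o.
have [ai1 ai2] := A0_linear Dp ix lvi; have [aj1 aj2] := A0_linear Dp jx lvj.
have [bi1 bi2] := A0_linear Dp ix lXi; have [bj1 bj2] := A0_linear Dp jx lXj.
have [ci1 ci2] := Atr_linear Dp ix lvi; have [cj1 cj2] := Atr_linear Dp jx lvj.
have [di1 di2] := Atr_linear Dp ix lXi; have [dj1 dj2] := Atr_linear Dp jx lXj.
rewrite /omega_integrand (normA0_trans rho_area o Dp).
rewrite (ipA_trans rho_area o Dp bi1 bi2 ai1 ai2 bj1 bj2 aj1 aj2 (A0_trans o Dp lXi lXj tX) (A0_trans o Dp lvi lvj tv)).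
rewrite (ipA_trans rho_area o Dp di1 di2 ci1 ci2 dj1 dj2 cj1 cj2 (Atr_trans o Dp lXi lXj tX) (Atr_trans o Dp lvi lvj tv)).
have [Xi _ _] := lXi; have [Xj _ _] := lXj; have [vi _ _] := lvi; have [vj _ _] := lvj.
have [tX1 _] := tX; have [tv1 _] := tv.
have -> : trE (X.1 j (trans i j x) \o (Istr p v).1 j (trans i j x)) = trE (X.1 i x \o (Istr p v).1 i x).
  apply: (trE_trans o) => [c a b|c a b|a].
  - by rewrite /comp vi Xi.
  - by rewrite /comp vj Xj.
  - by rewrite /comp tv1 tX1.
by [].
Qed.

Lemma moment_identity : omega_f rho mu f p X v = 2 / 3 * \int[mu]_m on_surface (fdot rho f p v) m.
Proof.
have [_ [u Vu [Y [YV HY]]]] := GX.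
have [_ _ _ [pot pot_smooth pot_alpha] _] := Vv.
have Yrho i x : img i x -> forall a b, lie_rho rho Y i x a b = 0 by move=> ix; case: (HY i x ix).
pose psi i x := omega_integrand i x - 2 / 3 * fdot rho f p v i x.
pose Z := gauge_field rho p v f Y pot.
have psiE i x : img i x -> psi i x * area rho i x =
    'D_(1, 0) (fun y => area rho i y * (Z i y).1) x + 'D_(0, 1) (fun y => area rho i y * (Z i y).2) x.
  move=> ix; rewrite (gauge_divergence rho_area Dp Tv f_fx f'_fx cfx YV Yrho pot_smooth pot_alpha ix).
  rewrite [RHS]mulrC; congr (_ * _).
  have H := herm_p rho_area Dp ix; have [a [b FA]] := in_D3_format rho_area Dp ix.
  have [m [n [k [l [F1 F2]]]]] := tangent_D3_format rho_area Dp Tv ix FA.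
  have [m' [n' [k' [l' [F1' F2']]]]] := tangent_D3_format rho_area Dp TX ix FA.
  have [n1 [n2 [n3 FN]]] := nablaY_frmat rho_area Dp YV Yrho ix.
  have hp := @herm_p _ _ _ _ rho_area p Dp i.
  (* The symmetries of A on the whole chart put nabla_Y A in the two-parameter format that
     [lie_integrand] expects. *)
  have [pa [pb FP]] : exists pa pb, cubic_format x (p.1 i) (nabla_form (p.1 i) (gJ rho p i) (p.2 i) x (Y i x)) pa pb.
    have [_ _ Ap] := Dp.
    have As y : img i y -> forall X' w, p.2 i y X' w = p.2 i y w X'.
      by move=> iy X' w; have [_ _ _ _ h] := Ap i y iy; case: (h X' w).
    have Ag y : img i y -> forall X' a' b', gJ rho p i y (p.2 i y X' a') b' = gJ rho p i y a' (p.2 i y X' b').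
      by move=> iy X' a' b'; have [_ _ _ h _] := Ap i y iy; exact: h.
    have AJ y : img i y -> forall X' w, p.2 i y (p.1 i y X') w = p.2 i y X' (p.1 i y w).
      by move=> iy X' w; have [_ _ _ _ h] := Ap i y iy; case: (h X' w).
    exact (nabla_cubic_format (@img_open _ _ _ i) hp (@smooth_p1 _ _ _ _ p Dp i)
      (@smooth_rho _ _ _ _ rho_area i) ix (@p2_lin1 _ _ _ _ p Dp i) (@p2_lin2 _ _ _ _ p Dp i)
      (@smooth_p2 _ _ _ _ p Dp i) As Ag AJ (Y i x)).
  have [u1 u2] := Psi_generator Vu ix.
  have [_ XJ XC] := HY i x ix.
  have hX1 w : X.1 i x w = p.1 i x (nablaY rho p Y i x w) - nablaY rho p Y i x (p.1 i x w).
    by rewrite XJ u1 add0r (lie_J_nabla rho_area Dp Y ix).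
  have hX2 s w z : gJ rho p i x (X.2 i x s w) z = - gJ rho p i x (p.2 i x s (p.1 i x w)) z
      + gJ rho p i x (nabla_form (p.1 i) (gJ rho p i) (p.2 i) x (Y i x) s w) z
      + gJ rho p i x (p.2 i x (nablaY rho p Y i x s) w) z
      + gJ rho p i x (p.2 i x s (nablaY rho p Y i x w)) z
      + gJ rho p i x (p.2 i x s w) (nablaY rho p Y i x z).
    by rewrite XC u2 (lie_C_nabla rho_area Dp Y ix) /cubic !addrA.
  rewrite /psi /omega_integrand (lie_integrand H FA F1 F2 F1' F2' FN FP hX1 hX2).
  rewrite /fdot /betaf /=.
  by rewrite [X in X - _]addrC addrK.
have oi i := @img_open _ _ S i.
have sZ i : smooth_on (img i) (Z i) := @smooth_gauge_field _ _ _ _ _ _ _ _ rho_area Dp Tv f_fx f'_fx cfx _ _ YV pot_smooth i.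
have cZ1 i : Ck 1 (img i) (fun x => (Z i x).1) := proj1 (smooth_on_Ck _ _) (smooth_on_fst (oi i) (sZ i)) 1%N.
have cZ2 i : Ck 1 (img i) (fun x => (Z i x).2) := proj1 (smooth_on_Ck _ _) (smooth_on_snd (oi i) (sZ i)) 1%N.
have psi_inv : invariant psi.
  by move=> i j x o; rewrite /psi (omega_integrand_invariant o) (fdot_invariant o).
have ZT i j x : overlap i j x -> Z j (trans i j x) = 'D_(Z i x) (trans i j) x.
  move=> o; have jx := overlap_trans o.
  have [p1 _] := p_tensorial o Dp; have [v1 _] := pair_tensorial Tv o.
  have TY := proj2 YV i j x o; have lT := transD_lin o.
  rewrite /Z /gauge_field /scaled_Jdot (normA0_trans rho_area o Dp) (fdot_invariant o) (param_trans o) TY.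
  rewrite v1 p1 (lin_funD lT (_ + _)) (lin_funD lT) (lin_funN lT) !(lin_funZ lT).
  by [].
have int0 := divergence_theorem rho_area mu_area M_closed cZ1 cZ2 ZT psi_inv psiE.
have cfd : continuous (on_surface (fdot rho f p v)).
  apply: on_surface_continuous; first exact: fdot_invariant.
  move=> i x ix.
  have sf : smooth_on (img i) (fdot rho f p v i) := @smooth_fdot _ _ _ _ _ _ _ _ rho_area Dp Tv f'_fx cfx i.
  exact (smooth_on_continuous sf ix).
have cpsi : continuous (on_surface psi).
  apply: on_surface_continuous => // i x ix.
  exact: (div_continuous rho_area cZ1 cZ2 psiE ix).
(* Splitting the real-valued integral into a sum requires both summands to be integrable. *)
have i1 := continuous_integrable_surface rho_area mu_area M_closed cfd.
have i2 := continuous_integrable_surface rho_area mu_area M_closed cpsi.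
rewrite /omega_f /g_f.
transitivity (\int[mu]_m (on_surface psi m + 2 / 3 * on_surface (fdot rho f p v) m)).
  apply: eq_Rintegral => m _; rewrite /on_surface /psi subrK.
  by [].
have i3 : mu.-integrable setT (EFin \o (fun m : borelM => 2 / 3 * on_surface (fdot rho f p v) m)).
  exact: (integrableZl _ _ i1).
rewrite RintegralD// RintegralZl//.
by rewrite {1}/Rintegral int0 add0r.
Qed.

End Moment.

(** * Derivative of the Hamiltonian along a path *)

Section ProductSlices.
Variables (R : realType) (V : normedModType R).

(** The difference quotients of the composite in direction w are those of [h] in direction [w.2], so
    the two derivatives agree by conversion. *)
Lemma Ck_comp_snd k (U : set V) (h : V -> R) : Ck k U h ->
  Ck k [set tx : R * V | U tx.2] (fun tx => h tx.2).
Proof.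
elim: k h => [|k IH] h [ch dh].
  by split=> // tx Ux; apply: continuous_comp (ch _ Ux); exact: cvg_snd.
split=> [tx Ux|]; first by apply: continuous_comp (ch _ Ux); exact: cvg_snd.
have [d1 d2] := dh; split=> [tx w Ux|w]; first exact: (d1 tx.2 w.2 Ux).
exact: (IH ('D_(w.2) h) (d2 w.2)).
Qed.

Lemma is_derive_slice (f : R * V -> R) (t : R) (x : V) d :
  is_derive ((t, x) : R * V) (1, 0) f d -> is_derive t 1 (fun s => f (s, x)) d.
Proof.
have e r : ((0, x) : R * V) + r *: (1, 0) = (r, x).
  by apply: injective_projections; rewrite /= ?scaler0 ?addr0// /GRing.scale /= mulr1 add0r.
rewrite -(e t) => /is_derive_line.
suff -> : (fun s => f ((0, x) + s *: (1, 0))) = (fun s => f (s, x)) by [].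
by apply/funext => s; rewrite e.
Qed.

End ProductSlices.

Section PathCalculus.
Variables (R : realType) (M : ptopologicalType) (S : oriented_atlas R M).
Local Notation E := (R * R)%type.
Variables (rho : form2 S) (c : R -> pairJA S) (eps : R).
Hypothesis rho_area : is_area_form rho.
Hypothesis Dc : forall t, `|t| < eps -> in_D3 rho (c t).
Hypothesis sc1 : forall i u, smooth_on [set tx : R * E | `|tx.1| < eps /\ img i tx.2]
  (fun tx : R * E => (c tx.1).1 i tx.2 u).
Hypothesis sc2 : forall i u v, smooth_on [set tx : R * E | `|tx.1| < eps /\ img i tx.2]
  (fun tx : R * E => (c tx.1).2 i tx.2 u v).

Definition path_dom (i : chart S) : set (R * E) := [set tx : R * E | `|tx.1| < eps /\ img i tx.2].

Lemma path_dom_open i : open (path_dom i).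
Proof. exact: (open_prod_set (@open_abs_lt R eps) (@img_open _ _ S i)). Qed.

(* Free of the square root of [frame1]. *)
Lemma norm2qJ_e1 p i x : in_D3 rho p -> img i x -> norm2qJ rho p i x =
  (cubic rho p i x (1, 0) (1, 0) (1, 0) ^+ 2
   + cubic rho p i x (p.1 i x (1, 0)) (1, 0) (1, 0) ^+ 2) / gJ rho p i x (1, 0) (1, 0) ^+ 3.
Proof.
move=> Dp ix; have H := herm_p rho_area Dp ix; have [a [b FA]] := in_D3_format rho_area Dp ix.
have G0 := gfr_neq0 H.
rewrite (norm2qJ_format H FA) /cubic -(fr10 x (p.1 i)) (J_fr H) !(formatE FA) !(g_fr H).
by field.
Qed.

Definition half_norm i (tx : R * E) : R := norm2qJ rho (c tx.1) i tx.2 / 2.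

(** By [norm2qJ_e1] and [rho_det] the function is rational in the components of the path and in the
    area density, with the cube of g(d_1, d_1) as nonvanishing denominator. The regularity is joint
    in time and position. *)
Lemma half_norm_Ck i : Ck 1 (path_dom i) (half_norm i).
Proof.
have oU := @path_dom_open i.
have c1 u : Ck 1 (path_dom i) (fun tx => ((c tx.1).1 i tx.2 u).1) :=
  proj1 (smooth_on_Ck _ _) (smooth_on_fst oU (@sc1 i u)) 1%N.
have c2 u : Ck 1 (path_dom i) (fun tx => ((c tx.1).1 i tx.2 u).2) :=
  proj1 (smooth_on_Ck _ _) (smooth_on_snd oU (@sc1 i u)) 1%N.
have a1 u v : Ck 1 (path_dom i) (fun tx => ((c tx.1).2 i tx.2 u v).1) :=
  proj1 (smooth_on_Ck _ _) (smooth_on_fst oU (@sc2 i u v)) 1%N.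
have a2 u v : Ck 1 (path_dom i) (fun tx => ((c tx.1).2 i tx.2 u v).2) :=
  proj1 (smooth_on_Ck _ _) (smooth_on_snd oU (@sc2 i u v)) 1%N.
have cr : Ck 1 (path_dom i) (fun tx => area rho i tx.2).
  apply: (Ck_sub _ (Ck_comp_snd (proj1 (smooth_on_Ck _ _) (area_smooth rho_area (i := i)) 1%N))).
  by move=> tx [].
pose J1 (tx : R * E) := (c tx.1).1 i tx.2 (1, 0).
have j1 := c1 (1, 0); have j2 := c2 (1, 0).
have p1 := a1 (1, 0) (1, 0); have p2 := a2 (1, 0) (1, 0).
have q1 := a1 (0, 1) (1, 0); have q2 := a2 (0, 1) (1, 0).
have cC1 := CkM oU cr (CkB oU (CkM oU p1 j2) (CkM oU p2 j1)).
have cC2 := CkM oU cr (CkB oU (CkM oU (CkD oU (CkM oU j1 p1) (CkM oU j2 q1)) j2)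
                             (CkM oU (CkD oU (CkM oU j1 p2) (CkM oU j2 q2)) j1)).
have cG := CkM oU cr j2.
have G0 tx : path_dom i tx -> (area rho i tx.2 * (J1 tx).2) ^+ 3 != 0.
  move=> [te ix]; have H := herm_p rho_area (Dc te) ix.
  rewrite expf_neq0// mulf_neq0//; first by rewrite gt_eqF// (area_gt0 rho_area ix).
  by case: (J_trace H).
have cN := CkM oU (CkD oU (CkX 2 oU cC1) (CkX 2 oU cC2)) (CkV oU G0 (CkX 3 oU cG)).
apply: (Ck_eq oU _ (CkM oU cN (Ck_cst 1 _ 2^-1))) => tx [te ix].
have H := herm_p rho_area (Dc te) ix.
rewrite /half_norm (norm2qJ_e1 (Dc te) ix) /cubic /gJ.
have A1E := p2_lin1 (Dc te) ix.
rewrite [(c tx.1).2 i tx.2 ((c tx.1).1 i tx.2 (1, 0)) (1, 0)](lin_funE (fun k a b => A1E k a b (1, 0))).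
rewrite /J1 /area.
move: ((c tx.1).2 i tx.2 (1, 0) (1, 0)) ((c tx.1).2 i tx.2 (0, 1) (1, 0)) ((c tx.1).1 i tx.2 (1, 0)) => a b j.
rewrite (rho_det H a) (rho_det H (j.1 *: a + j.2 *: b)) (rho_det H (1, 0) j).
move: (rho i tx.2 (1, 0) (0, 1)) => r; rewrite /= /GRing.scale /=.
congr (_ / _); congr (_ / _); last by ring.
Qed.

Lemma half_norm_invariant t : `|t| < eps -> invariant (fun i x => half_norm i (t, x)).
Proof. by move=> te i j x o; rewrite /half_norm /= (norm2qJ_trans rho_area o (Dc te)). Qed.

Lemma is_derive_half_norm i (t : R) x : `|t| < eps -> img i x ->
  is_derive t 1 (fun s => half_norm i (s, x)) ('D_(1, 0) (half_norm i) (t, x)).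
Proof.
move=> te ix; apply: is_derive_slice.
have Ux : path_dom i (t, x) by split.
exact: (Ck_is_derive _ (@half_norm_Ck i) Ux).
Qed.

(** The transition maps do not depend on time, so the invariance of the norm may be differentiated
    in t. *)
Lemma half_norm_derive_invariant t : `|t| < eps -> invariant (fun i x => 'D_(1, 0) (half_norm i) (t, x)).
Proof.
move=> te i j x o; have ix := overlap_img o; have jx := overlap_trans o.
have d1 := is_derive_half_norm te ix; have d2 := is_derive_half_norm te jx.
have e s : [set s : R | `|s| < eps] s -> half_norm j (s, trans i j x) = half_norm i (s, x).
  by move=> se; exact: half_norm_invariant.
have [_ <-] := is_derive_near (@open_abs_lt R eps) te e d2.
by case: d1.
Qed.

Lemma half_norm_normA0 i t x : `|t| < eps -> img i x -> half_norm i (t, x) = normA0 rho (c t) i x.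
Proof. by move=> te ix; rewrite (normA0_norm2qJ rho_area (Dc te)). Qed.

Variable v : pairJA S.
Hypothesis eps0 : 0 < eps.
Hypothesis Vc : velocity rho c v.
Hypothesis Tv : tangent_D3 rho (c 0) v.

(** C, the argument J d_1 and the metric coefficient all move with t. Their contributions combine so
    that only Adot_0 is left, paired with A. *)
Lemma half_norm_velocity i x : img i x -> 'D_(1, 0) (half_norm i) (0, x) =
  4^-1 * ipA ((c 0).1 i) (gJ rho (c 0) i) x ((c 0).2 i x) (A0 (c 0) v i x).
Proof.
move=> ix; have z0 : `|0 : R| < eps by rewrite normr0.
set p := c 0.
have Dp : in_D3 rho p by exact: Dc.
have H := herm_p rho_area Dp ix; have [a [b FA]] := in_D3_format rho_area Dp ix.
have [m [n [k [l [F1 F2]]]]] := tangent_D3_format rho_area Dp Tv ix FA.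
have [V1 V2] := Vc ix.
have oU := @open_abs_lt R eps.
pose G t := gJ rho (c t) i x (1, 0) (1, 0).
pose C1 t := cubic rho (c t) i x (1, 0) (1, 0) (1, 0).
pose C2 t := cubic rho (c t) i x ((c t).1 i x (1, 0)) (1, 0) (1, 0).
have Hr := rho_det H.
have dG : is_derive (0 : R) 1 G (rho i x (1, 0) (v.1 i x (1, 0))).
  have lr (s : R) : [set s : R | `|s| < eps] s -> forall (k : R) u w,
      rho i x (1, 0) (k *: u + w) = k * rho i x (1, 0) u + rho i x (1, 0) w.
    by move=> _ k' u w; rewrite (Hr _ (_ + _)) (Hr _ u) (Hr _ w) /= /GRing.scale /=; ring.
  have := is_derive_lin_appR oU z0 lr (fun u => is_derive_cst (rho i x (1, 0) u) (0 : R) 1) (V1 (1, 0)).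
  by rewrite add0r.
have dC1 := V2 (1, 0) (1, 0) (1, 0).
have dC2 : is_derive (0 : R) 1 C2 (gJ rho p i x (v.2 i x (p.1 i x (1, 0)) (1, 0)) (1, 0)
    + cubic rho p i x (v.1 i x (1, 0)) (1, 0) (1, 0)).
  have lC s : [set s : R | `|s| < eps] s -> forall (k : R) u w,
      cubic rho (c s) i x (k *: u + w) (1, 0) (1, 0) =
      k * cubic rho (c s) i x u (1, 0) (1, 0) + cubic rho (c s) i x w (1, 0) (1, 0).
    move=> se k' u w; rewrite /cubic (p2_lin1 (Dc se) ix k' u w (1, 0)).
    exact: (gJ_linl rho_area).
  exact: (is_derive_lin_appR oU z0 lC (fun u => V2 u (1, 0) (1, 0)) (V1 (1, 0))).
have G0 : G 0 ^+ 3 != 0 by rewrite expf_neq0//; exact: gfr_neq0 H.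
have dC1s := is_deriveM_fun dC1 dC1; have dC2s := is_deriveM_fun dC2 dC2.
have dG3 := is_deriveM_fun (is_deriveM_fun dG dG) dG.
have G0' : G 0 * G 0 * G 0 != 0 by move: G0; rewrite !exprS expr0 mulr1 mulrA.
have dN := is_deriveM_fun (is_deriveM_fun (is_deriveD_fun dC1s dC2s) (is_deriveV_fun (f := fun t => G t * G t * G t) G0' dG3))
  (is_derive_cst (2^-1 : R) (0 : R) 1).
have e (t : R) : [set s : R | `|s| < eps] t ->
    (C1 t * C1 t + C2 t * C2 t) / (G t * G t * G t) / 2 = half_norm i (t, x).
  move=> te; rewrite /half_norm (norm2qJ_e1 (Dc te) ix) /= -/(C1 t) -/(C2 t) -/(G t).
  by rewrite !expr2 !exprS expr0 mulr1 mulrA.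
have [_ D1] := is_derive_near oU z0 e dN; have [_ D2] := is_derive_half_norm z0 ix.
rewrite -D2 D1.
have F0 := A0_format H FA F1 F2.
rewrite (ipA_format H FA F0) /cst /C1 /C2 /cubic -/p.
have -> : G 0 = gfr (gJ rho p i) x by [].
have GG := gfr_neq0 H.
rewrite -[(1, 0)](fr10 x (p.1 i)) (J_fr H) !F1 !(formatE F2) !(formatE FA) (det_fr H) !(g_fr H).
by field.
Qed.

Section Integrals.
Local Notation borelM := (g_sigma_algebraType (@open M)).
Variables (mu : {measure set borelM -> \bar R}) (fx : R -> R).
Hypothesis mu_area : is_area_measure rho mu.
Hypothesis M_closed : closed_connected M.
Hypothesis cfx : forall k, Ck k setT fx.

Definition f_norm (t : R) (m : M) : R := on_surface (fun i x => fx (half_norm i (t, x))) m.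

Definition df_norm (tm : R * M) : R :=
  on_surface (fun i x => 'D_1 fx (half_norm i (tm.1, x)) * 'D_(1, 0) (half_norm i) (tm.1, x)) tm.2.

Lemma f_norm_derive (t : R) m : `|t| < eps -> is_derive t 1 (f_norm ^~ m) (df_norm (t, m)).
Proof.
move=> te; set i := chart_at S m; set x := Defs.coord i m.
have ix : img i x by exists m => //; exact: dom_chart_at.
have d1 := is_derive_half_norm te ix.
have d2 := Ck_is_derive (1 : R) (cfx 1) (I : setT (half_norm i (t, x))).
have d3 := is_derive_comp1 (f := fun s : R => half_norm i (s, x)) d2 d1.
exact d3.
Qed.

(** The chart chosen by [on_surface] may jump with the point; invariance permits staying in the
    chart at [m] throughout a neighbourhood. *)
Lemma df_norm_continuous (t : R) m : `|t| < eps -> {for (t, m), continuous df_norm}.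
Proof.
move=> te; set i := chart_at S m.
have dm : dom i m := dom_chart_at S m.
have Ux : path_dom i (t, Defs.coord i m) by split=> //; exists m.
pose k (tx : R * E) := 'D_1 fx (half_norm i tx) * 'D_(1, 0) (half_norm i) tx.
have ck : {for (t, Defs.coord i m), continuous k}.
  have oU := @path_dom_open i.
  have c1 := Ck_comp oU (Ck_derive (1 : R) (cfx 1)) (Ck_pred (@half_norm_Ck i)).
  exact: (Ck_continuous (CkM oU c1 (Ck_derive ((1, 0) : R * E) (@half_norm_Ck i))) Ux).
have cc : {for (t, m), continuous (fun tm : R * M => (tm.1, Defs.coord i tm.2))}.
  have h1 : (fun tm : R * M => tm.1) tm @[tm --> (t, m)] --> t by exact: cvg_fst.
  have h2 : (fun tm : R * M => Defs.coord i tm.2) tm @[tm --> (t, m)] --> Defs.coord i m.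
    have h0 : (fun tm : R * M => tm.2) tm @[tm --> (t, m)] --> m by exact: cvg_snd.
    exact: (cvg_comp _ _ h0 (Defs.coord_continuous dm)).
  exact: (@cvg_pair _ _ _ _ _ _ _ _ _ _ _ h1 h2).
have ckc : {for (t, m), continuous (k \o (fun tm : R * M => (tm.1, Defs.coord i tm.2)))}.
  exact: continuous_comp.
apply: cvg_trans ckc; apply: near_eq_cvg.
have n1 : \forall tm \near (t, m), `|tm.1| < eps /\ dom i tm.2.
  have := open_nbhs_nbhs (conj (open_prod_set (@open_abs_lt R eps) (dom_open i)) (conj te dm : (_ `*` _) (t, m))).
  by [].
apply: filterS n1 => -[s m'] [/= se dm'].
have o : overlap i (chart_at S m') (Defs.coord i m').
  by exists m' => //; split=> //; exact: dom_chart_at.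
rewrite /df_norm /k /on_surface /=.
rewrite -(half_norm_invariant se o) -(half_norm_derive_invariant se o) /trans /= coordK//.
Qed.

(** A continuous function is bounded on the compact product of the closed half-size interval with
    [M]. The constant is integrable because the area is finite, and it dominates the derivative
    under the integral. *)
Lemma df_norm_bounded : exists C, forall t m, `|t| <= eps / 2 -> `|df_norm (t, m)| <= C.
Proof.
have [_ cM _] := M_closed; have e2 : eps / 2 < eps by have := eps0; lra.
have cB : compact (df_norm @` (`[- (eps / 2), eps / 2]%classic `*` setT)).
  apply: continuous_compact; last by apply: compact_setX => //; exact: segment_compact.
  apply: continuous_in_subspaceT => -[t m] /[!inE] -[/=]; rewrite in_itv /= -ler_norml => te _.
  by apply: df_norm_continuous; exact: le_lt_trans te e2.
have [N [_ HN]] := compact_bounded cB.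
exists (N + 1) => t m te; apply: (HN (N + 1)); first by rewrite ltrDl.
by exists (t, m) => //; split=> //=; rewrite in_itv /= -ler_norml.
Qed.

Lemma f_norm_continuous t : `|t| < eps -> continuous (f_norm t).
Proof.
move=> te; apply: (@on_surface_continuous _ _ S (fun i x => fx (half_norm i (t, x)))).
  by move=> i j x o; rewrite (half_norm_invariant te o).
move=> i x ix.
have sf : smooth_on (img i) (fun x => fx (normA0 rho (c t) i x)) :=
  @smooth_comp_normA0 _ _ _ _ _ rho_area (Dc te) fx i cfx.
have s2 := Ck_eq (@img_open _ _ _ i) (fun y iy => congr1 fx (esym (half_norm_normA0 te iy)))
  (proj1 (smooth_on_Ck _ _) sf 0%N).
exact: Ck_continuous s2 ix.
Qed.

Lemma f_norm_integral_derive :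
  is_derive (0 : R) 1 (fun t => \int[mu]_m f_norm t m) (\int[mu]_m df_norm (0, m)).
Proof.
have [C HC] := df_norm_bounded.
have e2 : 0 < eps / 2 by rewrite divr_gt0.
have in_eps (t : R) : `]- (eps / 2), eps / 2[%classic t -> `|t| < eps / 2.
  by rewrite /= in_itv /= -ltr_norml.
have lt_eps (t : R) : `|t| < eps / 2 -> `|t| < eps by move=> h; apply: lt_trans h _; lra.
have Ia : `]- (eps / 2), eps / 2[%classic (0 : R) by rewrite /= in_itv /=; apply/andP; split; lra.
have d1f (t : R) m : `|t| < eps / 2 -> partial1of2 f_norm t m = df_norm (t, m).
  by move=> te; rewrite partial1of2E; case: (f_norm_derive m (lt_eps _ te)).
have := @cvg_differentiation_under_integral R _ _ mu f_norm setT _ (0 : R) (- (eps / 2)) (eps / 2) Ia _ _ (fun=> C) _ _ _.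
have -> : \int[mu]_(y in setT) partial1of2 f_norm 0 y = \int[mu]_m df_norm (0, m).
  by apply: eq_Rintegral => m _; rewrite d1f// normr0.
move=> H; suff cv : h^-1 *: (((fun t => \int[mu]_m f_norm t m) \o shift 0) (h *: 1) - \int[mu]_m f_norm 0 m)
    @[h --> 0^'] --> \int[mu]_m df_norm (0, m).
  by apply: DeriveDef; [apply/cvg_ex; eexists; exact: cv|exact: cvg_lim cv].
have -> : (fun h : R => h^-1 *: (((fun t => \int[mu]_m f_norm t m) \o shift 0) (h *: 1) - \int[mu]_m f_norm 0 m)) =
  (fun h : R => h^-1 *: (\int[mu]_m f_norm (h + 0) m - \int[mu]_m f_norm 0 m)).
  by apply/funext => h /=; rewrite [h *: 1]mulr1.
have C0 : 0 <= C.
  by apply: (le_trans (normr_ge0 (df_norm (0, point)))); apply: HC; rewrite normr0 ltW.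
apply: H.
- exact: measurableT.
- move=> t tI; exact: (continuous_integrable_surface rho_area mu_area M_closed (f_norm_continuous (lt_eps _ (in_eps _ tI)))).
- by move=> t m tI _; case: (f_norm_derive m (lt_eps _ (in_eps _ tI))).
- by move=> m.
- apply: (continuous_integrable_surface rho_area mu_area M_closed (a := cst C)) => m; exact: cvg_cst.
- by move=> t m tI _; rewrite d1f ?in_eps//; apply: HC; exact: ltW (in_eps _ tI).
Qed.

End Integrals.

End PathCalculus.

Theorem theoremC (R : realType) (M : ptopologicalType)
    (S : oriented_atlas R M) (n : nat) (rho : form2 S)
    (mu : {measure set (g_sigma_algebraType (@open M)) -> \bar R})
    (F : R -> R)
    (M_closed : closed_connected M)
    (S_genus : has_genus S n) (n_ge2 : (2 <= n)%N)
    (rho_area : is_area_form rho) (mu_area : is_area_measure rho mu)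
    (F_def : is_F (2 * pi * (2 - 2 * n%:R) / volume mu) F) :
  let f := f_of F in
  let H := fun p : pairJA S =>
    2 / 3 * \int[mu]_m on_surface (fun i x => f (norm2qJ rho p i x / 2)) m in
  (forall (p X : pairJA S), in_HS rho F p -> generates_Psi rho F f p X ->
     forall (v : pairJA S) (c : R -> pairJA S), V_space rho F f p v ->
       path_in_HS rho F c -> c 0 = p -> velocity rho c v ->
       is_derive (0 : R) 1 (fun t => H (c t)) (omega_f rho mu f p X v)) /\
  (forall (theta : R) (p v w : pairJA S), in_HS rho F p ->
     V_space rho F f p v -> V_space rho F f p w ->
     exists v' w' : pairJA S,
       [/\ dPsi rho F theta p v v' /\ dPsi rho F theta p w w',
           V_space rho F f (Psi theta p) v',
           V_space rho F f (Psi theta p) w'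
         & g_f rho mu f (Psi theta p) v' w' = g_f rho mu f p v w]).
Proof.
move=> f H; split; last first.
  by move=> theta p v w; exact: Psi_isometry.
move=> p X HSp GX v c Vv [eps eps0 [HSc sc]] cp Vc.
have [_ _ [G sG GF]] := F_def.
have f_fx := f_of_ext sG GF; have f'_fx := rderiv_f_of sG GF; have cfx k := f_ext_Ck sG k.
have Dc t : `|t| < eps -> in_D3 rho (c t) by move=> te; case: (HSc t te).
have sc1 i u := proj1 (sc i) u.
have sc2 i u w := proj2 (sc i) u w.
have Dp : in_D3 rho p by case: HSp.
have Tv : tangent_D3 rho (c 0) v by rewrite cp; case: Vv.
rewrite (moment_identity rho_area mu_area M_closed Dp f_fx f'_fx cfx Vv GX).
have z0 : `|0 : R| < eps by rewrite normr0.
(* [fdot] is formed from [v] alone, while [df_norm] differentiates along the path; they coincide at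
   time 0 because the path has velocity [v]. *)
have -> : \int[mu]_m on_surface (fdot rho f p v) m = \int[mu]_m df_norm rho c (f_ext G) (0, m).
  apply: eq_Rintegral => m _; rewrite /df_norm /on_surface /fdot /=.
  have im : img (chart_at S m) (Defs.coord (chart_at S m) m) by exists m => //; exact: dom_chart_at.
  rewrite (half_norm_velocity rho_area Dc sc1 sc2 eps0 Vc Tv im).
  rewrite (half_norm_normA0 rho_area Dc z0 im) cp f'_fx; last exact: (normA0_ge0 rho_area Dp im).
  by rewrite mulrA.
have d := f_norm_integral_derive rho_area Dc sc1 sc2 eps0 mu_area M_closed cfx.
(* Half the squared norm is non-negative, where [f] and its extension agree; equality for all small
   t is what carries the derivative over to [H]. *)
have e t : [set s : R | `|s| < eps] t -> 2 / 3 * (\int[mu]_m f_norm rho c (f_ext G) t m) = H (c t).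
  move=> te; congr (_ * _); apply: eq_Rintegral => m _.
  have im : img (chart_at S m) (Defs.coord (chart_at S m) m) by exists m => //; exact: dom_chart_at.
  rewrite /f_norm /on_surface -f_fx//.
  by rewrite (half_norm_normA0 rho_area Dc te im) (normA0_ge0 rho_area (Dc t te) im).
have d2 := is_deriveM_fun (is_derive_cst (2 / 3 : R) (0 : R) 1) d.
apply: (is_derive_eq (is_derive_near (@open_abs_lt R eps) z0 e d2)).
by rewrite mul0r add0r.
Qed.
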